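(* For every odd prime $p$, put $m=(p-1)/2$. Then $$S_{p-1}\equiv(-1)^{m+1}T_p\equiv\left(\frac{-2}{p}\right)\pmod p,$$ $$S_{p+1}\equiv(-1)^mT_p\equiv-\left(\frac{-2}{p}\right)\pmod p,$$ $$S_{2p}\equiv-pT_p^2\equiv-p\pmod{p^2}.$$ In particular, $$S_{p-1}+S_{p+1}\equiv0\pmod p,\qquad S_{p-1}S_{p+1}\equiv\frac{S_{2p}}{p}\equiv-1\pmod p.$$ Here $\left(\frac{\cdot}{p}\right)$ is the Legendre symbol, and $S_n$ and $T_p$ are the signed sums defined in the context.
   Context: Signs of matchings. For a perfect matching $M$ of a finite linearly ordered set of even size, let $\operatorname{cr}(M)$ be the number of unordered pairs of edges $\{a,c\},\{b,d\}\in M$ with $a<b<c<d$, and put $\varepsilon(M)=(-1)^{\operatorname{cr}(M)}$. Signed count $S_n$. Let $n$ be even and order the vertices of $K_n$ as $0<1<\dots<n-1$. A one-factorization of $K_n$ is a partition of its edge set into perfect matchings (an unordered collection). For a one-factorization $\mathcal F$ put $\varepsilon(\mathcal F)=\prod_{M\in\mathcal F}\varepsilon(M)$, and define $S_n=\sum_{\mathcal F}\varepsilon(\mathcal F)$, the sum over all one-factorizations of $K_n$. Starter sum $T_p$. A starter in $\mathbb F_p$ is a perfect matching $A$ of $\mathbb F_p\setminus\{0\}$ such that, as $\{a,b\}$ runs through its $(p-1)/2$ pairs, the differences $\pm(a-b)$ run through all nonzero residues (i.e. the classes $\{\pm(a-b)\}$ represent all classes of $\mathbb F_p^\times/\{\pm1\}$).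 Order the nonzero residues as $1,\dots,p-1$, giving each starter a sign $\varepsilon(A)$, and put $T_p=\sum_{A\text{ starter}}\varepsilon(A)$. *)

(* Defs.v *)
From mathcomp Require Import all_boot all_order all_algebra.

Set Implicit Arguments.
Unset Strict Implicit.
Unset Printing Implicit Defensive.

Import Order.TTheory GRing.Theory Num.Theory.
Local Open Scope ring_scope.

Section Matchings.
Context {disp : Order.disp_t} {T : finOrderType disp}.

Definition perfect_matching (V : {set T}) (M : {set {set T}}) : bool :=
  partition M V && [forall e in M, #|e| == 2%N].

(* The quantification over two-element sets P of edges makes the crossing pairs
   unordered, so that each is counted once. *)
Definition cr (M : {set {set T}}) : nat :=
  #|[set P : {set {set T}} | (P \subset M) &&
      [exists a : T, exists b : T, exists c : T, exists d : T,
        [&& (a < b)%O, (b < c)%O, (c < d)%O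
          & P == [set [set a; c]; [set b; d]]]]]|.

Definition eps (M : {set {set T}}) : int := (-1) ^+ cr M.

End Matchings.

Definition edges (n : nat) : {set {set 'I_n}} := [set e : {set 'I_n} | #|e| == 2%N].

Definition one_factorization (n : nat) (F : {set {set {set 'I_n}}}) : bool :=
  partition F (edges n) && [forall M in F, perfect_matching [set: 'I_n] M].

Definition signed_count (n : nat) : int :=
  \sum_(F : {set {set {set 'I_n}}} | one_factorization F) \prod_(M in F) eps M.

(* Since [set a; b] = [set b; a], both differences of each pair are covered. *)
Definition starter (p : nat) (A : {set {set 'F_p}}) : bool :=
  perfect_matching [set x : 'F_p | x != 0] A
  && [forall (x : 'F_p | x != 0),
       exists a : 'F_p, exists b : 'F_p, ([set a; b] \in A) && (a - b == x)].

(* 'F_p is an ordinal type: eps A refers to the order 1 < 2 < ... < p - 1 of the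
   representatives. *)
Definition starter_sum (p : nat) : int :=
  \sum_(A : {set {set 'F_p}} | starter A) eps A.

Definition legendre (a : int) (p : nat) : int :=
  if (p %| a)%Z then 0
  else if [exists x : 'F_p, x ^+ 2 == a%:~R] then 1 else -1.

(* Main.v *)
(** Computing signs in an arbitrary tournament [s] (an antisymmetric function with values
    +1 and -1) instead of the linear order changes no [signed_count], because every pair of
    vertices is unmatched in an even number of factors. This makes the weight of a
    one-factorization invariant under all permutations of the vertices.

    [p + 1] and [2p] vertices: a weighted Burnside congruence for the translations of
    [F_p] plus a point at infinity, and for [F_p x F_p] acting on two copies of [F_p].
    The one-factorizations fixed by a translation of the former are those generated by a
    starter. In the latter case a translation of one copy only fixes none, and any other
    nontrivial element fixes those given by two starters and one of [p] shifts.

    [p - 1] vertices: put [N = p - 2], so there are [N + 1] vertices. The count is a sum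
    over proper edge colourings with [N] colours. For a vertex [i], matching the darts at
    [i] with those at [N - i] in all possible ways turns it into a sum of [N ^ c] where [c]
    is the number of loops; as [N = -2 mod p], each loop may be given two orientations with
    sign -1. Summing over the matchings first leaves a signed sum over tournaments of
    products of factorials of the scores, which is a Vandermonde determinant.

    The starter sum modulo [p]: a starter is a matching with edges [{a i, a i + s i}], [s]
    running over representatives of the nonzero residues up to sign, and its sign is a
    value of a polynomial in [a]. The sum over all [a] depends only on the part of top
    degree, hence not on [s]; for [s = 1] only the matching {1, 2}, {3, 4}, ... remains. *)

Require Import Defs.
From mathcomp Require Import all_boot all_order all_algebra.
From mathcomp Require Import all_fingroup all_solvable finfield.
From mathcomp Require Import mpoly ring zify.

Set Implicit Arguments.
Unset Strict Implicit.
Unset Printing Implicit Defensive.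

Import Order.TTheory GRing.Theory Num.Theory.
Local Open Scope ring_scope.

(** * Products over pairs and signs of matchings *)

(** A group of order [p] acts trivially on [p - 1] points, so the fixed point argument says nothing
    there and that case needs another route. Labelling the factors by colours costs a factor
    [N! = (p - 2)!], which is 1 modulo [p] by Wilson. In the Vandermonde expansion the scores form a
    permutation [s] of [0, ..., N]; matching the darts at [i] with those at [N - i] forces
    [s i + s (N - i) = N], and all such permutations contribute equally. The fixed point arguments
    use the sign [(-1) ^ (y - x)], with the representative of the residue as exponent. For odd [p]
    it is a tournament, it is invariant under translations, and on matchings of the nonzero residues
    it agrees with the sign of the linear order; so [T_p] itself appears. For [T_p] the top degree
    is [m (p - 1)] in [m] variables, the lowest degree in which a sum over all points of [F_p ^ m]
    can be nonzero. Comparing two systems [s] gives [T_p 2 ^ m = -1], and [2 ^ m] is its own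
    inverse. *)

Lemma enum_rank_ltNgt (T : finType) (x y : T) : x != y ->
  (enum_rank x < enum_rank y)%N = ~~ (enum_rank y < enum_rank x)%N.
Proof.
move=> xy; rewrite -leqNgt ltn_neqAle; case: eqP => //= h.
by rewrite (enum_rank_inj (ord_inj h)) eqxx in xy.
Qed.

Section PairProducts.
Variable R : comNzRingType.
Implicit Types T U : finType.

(** Every unordered pair in [A] occurs once; the enumeration rank serves to pick one of its two
    orientations, and for symmetric [b] any tournament may replace it ([pp_tour]). *)
Definition pp T (A : {set T}) (b : T -> T -> R) : R :=
  \prod_(x in A) \prod_(y in A | (enum_rank x < enum_rank y)%N) b x y.

(* With [s x y = 1] for [x < y] and [s x y = -1] for [x > y], and [x < mu x], [y < mu y], this is
   [-1] exactly when the edges at [x] and [y] cross. *)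
Definition crs T (s : T -> T -> R) (mu : T -> T) (x y : T) : R :=
  s x y * s x (mu y) * s (mu x) y * s (mu x) (mu y).

Definition antisym T (s : T -> T -> R) := forall x y, s x y = - s y x.

(* [A] contains one endpoint of every edge of the matching [mu] of [D]. *)
Definition sect T (mu : T -> T) (A D : {set T}) :=
  A \subset D /\ forall x, x \in D -> (mu x \in D) /\ ((mu x \in A) = (x \notin A)).

(** The pairs on which [r1] and [r2] agree match directly; the others are exchanged by swapping the
    two coordinates, which [b] does not notice. *)
Lemma tour_prod T (A : {set T}) (b : T -> T -> R) (r1 r2 : rel T) :
  {in A &, forall x y, x != y -> r1 x y = ~~ r1 y x} ->
  {in A &, forall x y, x != y -> r2 x y = ~~ r2 y x} ->
  {in A, forall x, ~~ r1 x x} -> {in A, forall x, ~~ r2 x x} ->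
  {in A &, forall x y, b x y = b y x} ->
  \prod_(x in A) \prod_(y in A | r1 x y) b x y
  = \prod_(x in A) \prod_(y in A | r2 x y) b x y.
Proof.
move=> h1 h2 i1 i2 hb; rewrite !pair_big_dep /=.
rewrite (bigID (fun p : T * T => r2 p.1 p.2)) [RHS](bigID (fun p : T * T => r1 p.1 p.2)) /=.
congr (_ * _).
  by apply: eq_bigl => -[x y] /=; rewrite -!andbA; congr [&& _, _ & _]; rewrite andbC.
pose sw (p : T * T) := (p.2, p.1).
have swK : cancel sw sw by case.
rewrite (reindex_inj (can_inj swK)) /=; apply: eq_big => [[x y]|[x y]] /=; last first.
  by case/andP=> /and3P[xA yA _] _; rewrite hb.
case: (boolP (x \in A)) => xA; rewrite ?andbF //=; case: (boolP (y \in A)) => yA //=.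
case: (eqVneq x y) => [<-|xy]; first by rewrite (negbTE (i1 _ xA)) (negbTE (i2 _ xA)).
by rewrite (h1 _ _ xA yA xy) (h2 _ _ xA yA xy) negbK andbC.
Qed.

Lemma pp_tour T (A : {set T}) (b : T -> T -> R) (r : rel T) :
  {in A &, forall x y, x != y -> r x y = ~~ r y x} -> {in A, forall x, ~~ r x x} ->
  {in A &, forall x y, b x y = b y x} ->
  pp A b = \prod_(x in A) \prod_(y in A | r x y) b x y.
Proof.
move=> h i hb; apply: tour_prod => // [x y _ _ xy|x _]; last by rewrite ltnn.
exact: enum_rank_ltNgt.
Qed.

Lemma eq_pp T (A : {set T}) (b c : T -> T -> R) :
  {in A &, forall x y, x != y -> b x y = c x y} -> pp A b = pp A c.
Proof.
move=> h; apply: eq_bigr => x xA; apply: eq_bigr => y /andP[yA xy].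
by apply: h => //; apply: contraTneq xy => ->; rewrite ltnn.
Qed.

Lemma ppM T (A : {set T}) (b c : T -> T -> R) :
  pp A (fun x y => b x y * c x y) = pp A b * pp A c.
Proof.
rewrite /pp -big_split; apply: eq_bigr => x _; rewrite -big_split; exact: eq_bigr.
Qed.

Lemma pp1 T (A : {set T}) : pp A (fun _ _ => 1) = 1.
Proof. by apply: big1 => x _; apply: big1. Qed.

Lemma pp_imset T U (A : {set T}) (h : T -> U) (b : U -> U -> R) :
  {in A &, injective h} -> {in h @: A &, forall x y, b x y = b y x} ->
  pp (h @: A) b = pp A (fun x y => b (h x) (h y)).
Proof.
move=> hi hb.
rewrite [RHS](@pp_tour _ _ _ (fun x y => (enum_rank (h x) < enum_rank (h y))%N)); last first.
- by move=> x y xA yA; rewrite hb ?imset_f.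
- by move=> x _; rewrite ltnn.
- by move=> x y xA yA xy; apply: enum_rank_ltNgt; rewrite (inj_in_eq hi).
rewrite /pp big_imset //=; apply: eq_bigr => x xA.
rewrite (eq_bigl (fun y => y \in h @: [set z in A | (enum_rank (h x) < enum_rank (h z))%N])).
  rewrite big_imset /=; last by move=> y z; rewrite !inE => /andP[yA _] /andP[zA _]; exact: hi.
  by apply: eq_bigl => y; rewrite inE.
move=> y; apply/andP/imsetP => [[/imsetP[z zA ->]] lt|[z]].
  by exists z; rewrite // inE zA.
by rewrite inE => /andP[zA lt] ->; rewrite imset_f.
Qed.

Lemma pp_setU T (A B : {set T}) (b : T -> T -> R) :
  [disjoint A & B] -> {in A :|: B &, forall x y, b x y = b y x} ->
  pp (A :|: B) b = pp A b * pp B b * \prod_(x in A) \prod_(y in B) b x y.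
Proof.
move=> dAB hb.
pose r x y := if x \in A then (y \in B) || (enum_rank x < enum_rank y)%N
              else (y \notin A) && (enum_rank x < enum_rank y)%N.
have nB x : x \in A -> x \in B = false by move=> xA; apply: (disjointFr dAB).
have nA x : x \in B -> x \in A = false by move=> xB; apply: (disjointFl dAB).
rewrite (@pp_tour _ _ _ r) //; first last.
- by move=> x _; rewrite /r ltnn orbF andbF; case: ifP => // /nB->.
- move=> x y; rewrite !inE => /orP[]xA /orP[] yA xy; rewrite /r ?xA ?yA ?(nA _ xA) ?(nA _ yA) ?(nB _ xA) ?(nB _ yA) //=.
    exact: enum_rank_ltNgt.
  exact: enum_rank_ltNgt.
set P := \prod_(x in A) _; have -> : pp A b * pp B b * P = (pp A b * P) * pp B b by ring.
rewrite {}/P (eq_bigl (mem [predU A & B])); last by move=> x; rewrite !inE.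
rewrite bigU //=; congr (_ * _); last first.
  apply: eq_bigr => x xB; apply: eq_bigl => y; rewrite inE /r (nA _ xB).
  by case: (boolP (y \in A)) => yA //=; rewrite (nB _ yA).
rewrite /pp -big_split /=; apply: eq_bigr => x xA.
rewrite (bigID (mem B)) /= mulrC; congr (_ * _); apply: eq_bigl => y; rewrite inE /r xA.
  by case: (boolP (y \in B)) => yB; rewrite ?andbF ?(nA _ yB) //= orbF andbT.
by case: (boolP (y \in B)) => yB; rewrite ?andbF ?orbT.
Qed.

Lemma pp_setU1 T (A : {set T}) a (b : T -> T -> R) : a \notin A ->
  {in a |: A &, forall x y, b x y = b y x} ->
  pp (a |: A) b = (\prod_(y in A) b a y) * pp A b.
Proof.
move=> aA hb; have p1 : pp [set a] b = 1.
  by rewrite /pp big_set1 big_pred0 // => y; rewrite inE; case: eqP => //= ->; rewrite ltnn.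
by rewrite pp_setU ?disjoints1 // p1 mul1r big_set1 mulrC.
Qed.

Lemma prod_sect T (mu : T -> T) (A D : {set T}) (F : T -> R) :
  involutive mu -> sect mu A D ->
  \prod_(x in D) F x = \prod_(x in A) (F x * F (mu x)).
Proof.
move=> muK [AD sA]; rewrite (bigID (mem A)) big_split /=; congr (_ * _).
  apply: eq_bigl => x /=; case: (boolP (x \in A)) => xA; rewrite ?andbF // andbT.
  exact: (subsetP AD).
rewrite (reindex_inj (inv_inj muK)); apply: eq_bigl => x /=.
case: (boolP (x \in D)) => xD; first by have [-> ->] := sA _ xD; rewrite negbK.
have -> : (mu x \in D) = false.
  by apply/negP => /sA[]; rewrite muK => h; rewrite h in xD.
by apply/esym/negP => /(subsetP AD) h; rewrite h in xD.
Qed.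

(** A pair in [D] is either an edge of [mu] or one of the four pairs between two edges; these four
    multiply to [crs]. *)
Lemma pp_sect T (mu : T -> T) (A D : {set T}) (t : T -> T -> R) :
  involutive mu -> sect mu A D -> {in D &, forall x y, t x y = t y x} ->
  pp D t = (\prod_(x in A) t x (mu x)) * pp A (crs t mu).
Proof.
move=> muK sA ht; have [AD sAD] := sA.
pose be x := if x \in A then x else mu x.
(* This tournament runs through [D] edge by edge, in the order of the endpoints in [A], and puts
   that endpoint before its partner. *)
pose r x y := (enum_rank (be x) < enum_rank (be y))%N
  || [&& be x == be y, x \in A & y \notin A].
have beA x : x \in A -> be x = x by rewrite /be => ->.
have beM x : x \in A -> be (mu x) = x.
  move=> xA; have xD := subsetP AD _ xA; have [_ h] := sAD _ xD.
  by rewrite /be h xA /= muK.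
have muA x : x \in A -> (mu x \in A) = false.
  by move=> xA; have [_ ->] := sAD _ (subsetP AD _ xA); rewrite xA.
have beE x y : x \in D -> y \in D -> be x = be y -> x != y -> (x \in A) = (y \notin A).
  rewrite /be; case: (boolP (x \in A)) (boolP (y \in A)) => xA [] yA //= _ _; first by move=> ->; rewrite eqxx.
  by move=> h; rewrite (inv_inj muK h) eqxx.
rewrite (@pp_tour _ _ _ r) //; first last.
- by move=> x _; rewrite /r ltnn eqxx /=; case: (x \in A).
- move=> x y xD yD xy; rewrite /r [be y == be x]eq_sym.
  have [e|ne] := eqVneq (be x) (be y); last first.
    by rewrite /= !orbF; exact: enum_rank_ltNgt.
  rewrite e ltnn /= (beE _ _ xD yD e xy).
  by case: (y \in A).
rewrite (prod_sect _ muK sA) /pp -big_split; apply: eq_bigr => x xA /=.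
have step (z : T) : z \in D -> \prod_(y in D | r z y) t z y =
   \prod_(y in A) ((if r z y then t z y else 1) * (if r z (mu y) then t z (mu y) else 1)).
  move=> zD; rewrite big_mkcondr /= (prod_sect _ muK sA); exact: eq_bigr.
have xD := subsetP AD _ xA; have [mxD mxA] := sAD _ xD.
have r1 : r x x = false by rewrite /r ltnn eqxx /= xA.
have r2 : r (mu x) x = false by rewrite /r beM // beA // ltnn eqxx /= muA.
have r3 : r x (mu x) by rewrite /r beM // beA // ltnn eqxx /= xA muA.
have r4 : r (mu x) (mu x) = false by rewrite /r beM // ltnn eqxx /= muA.
rewrite !step // -big_split /= (bigD1 x) //= r1 r2 r3 r4 !mul1r !mulr1; congr (_ * _).
rewrite big_mkcond [RHS]big_mkcond /=; apply: eq_bigr => y _.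
case: (boolP (y \in A)) => yA //=.
have [->|yx] := eqVneq y x; first by rewrite ltnn.
have rE u v : u \in [:: x; mu x] -> v \in [:: y; mu y] ->
    r u v = (enum_rank x < enum_rank y)%N.
  rewrite /r !inE => /orP[]/eqP-> /orP[]/eqP->; rewrite !(beM _ xA, beA _ xA, beM _ yA, beA _ yA);
  by rewrite [x == y]eq_sym (negbTE yx) orbF.
rewrite !rE ?inE ?eqxx ?orbT // /crs; case: ifP => _; rewrite ?mulr1 // !mulrA //.
Qed.

(** Passing from [A] to [B] replaces some endpoints by their partners, under which [b] is invariant.
    So the sign of a matching depends on the edges alone. *)
Lemma sect_indep T (mu : T -> T) (A B D : {set T}) (b : T -> T -> R) :
  involutive mu -> sect mu A D -> sect mu B D ->
  {in D &, forall x y, b x y = b y x} -> {in D &, forall x y, b (mu x) y = b x y} ->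
  pp A b = pp B b.
Proof.
move=> muK sA sB hb hm; have [AD sAD] := sA; have [BD sBD] := sB.
pose ph x := if x \in B then x else mu x.
have AinD := subsetP AD.
have phi : {in A &, injective ph}.
  move=> x y xA yA; have [_ mx] := sAD _ (AinD _ xA); have [_ my] := sAD _ (AinD _ yA).
  rewrite xA in mx; rewrite yA in my.
  rewrite /ph; case: ifP => xB; case: ifP => yB e //; last exact: (inv_inj muK).
    by rewrite -e xA in my.
  by rewrite e yA in mx.
have -> : B = ph @: A.
  apply/setP => x; apply/idP/imsetP => [xB|[y yA ->]].
    have xD := subsetP BD _ xB; have [mD mB] := sBD _ xD; have [_ mA] := sAD _ xD.
    case: (boolP (x \in A)) => xA; first by exists x; rewrite // /ph xB.
    by exists (mu x); rewrite ?mA // /ph mB xB muK.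
  rewrite /ph; case: ifP => // yB; have [_ ->] := sBD _ (AinD _ yA); by rewrite yB.
have phD : {in A, forall x, ph x \in D}.
  by move=> x xA; rewrite /ph; case: ifP => _; [exact: AinD|case: (sAD _ (AinD _ xA))].
have hbm : {in D &, forall x y, b x (mu y) = b x y}.
  move=> x y xD yD; have [myD _] := sAD _ yD.
  by rewrite hb // hm // hb.
rewrite pp_imset //; last first.
  by move=> _ _ /imsetP[x xA ->] /imsetP[y yA ->]; apply: hb; exact: phD.
apply: eq_pp => x y xA yA _; have xD := AinD _ xA; have yD := AinD _ yA.
have [mxD _] := sAD _ xD.
by rewrite /ph; do 2!case: ifP => _; rewrite ?hbm ?hm.
Qed.

Lemma crsM T (s t : T -> T -> R) mu x y :
  crs (fun x y => s x y * t x y) mu x y = crs s mu x y * crs t mu x y.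
Proof. by rewrite /crs; ring. Qed.

Lemma crs_sym T (s : T -> T -> R) mu : antisym s ->
  forall x y, crs s mu x y = crs s mu y x.
Proof.
move=> hs x y; rewrite /crs (hs x y) (hs x (mu y)) (hs (mu x) y) (hs (mu x) (mu y)); ring.
Qed.

Lemma crs_mu T (s : T -> T -> R) mu : involutive mu ->
  forall x y, crs s mu (mu x) y = crs s mu x y.
Proof. by move=> muK x y; rewrite /crs muK; ring. Qed.

End PairProducts.

(** * Signs of permutations and matchings in a tournament *)

Section Signs.
Variable R : comNzRingType.
Implicit Types T U : finType.

Definition tourn T (s : T -> T -> R) :=
  antisym s /\ forall x y, x != y -> s x y * s x y = 1.

Lemma tourn_symM T (s t : T -> T -> R) : antisym s -> antisym t ->
  forall x y, s x y * t x y = s y x * t y x.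
Proof. by move=> hs ht x y; rewrite hs ht mulrNN. Qed.

Lemma tourn_comp T U (s : T -> T -> R) (g : U -> T) :
  injective g -> tourn s -> tourn (fun x y => s (g x) (g y)).
Proof.
move=> gi [sa s1]; split=> [x y|x y xy]; first exact: sa.
by apply: s1; rewrite (inj_eq gi).
Qed.

(** Counting inversions with respect to a tournament is multiplicative in [g] and gives -1 on
    transpositions, just as for a linear order. *)
Lemma sgn_pp T (s : T -> T -> R) (g : {perm T}) : tourn s ->
  pp [set: T] (fun x y => s x y * s (g x) (g y)) = (-1) ^+ g.
Proof.
move=> ts; have [sa s1] := ts.
pose N (h : {perm T}) := pp [set: T] (fun x y => s x y * s (h x) (h y)).
have sc (h : {perm T}) : tourn (fun x y => s (h x) (h y)) by apply: tourn_comp => //; exact: perm_inj.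
have N1 : N 1%g = 1.
  rewrite -[RHS](pp1 R [set: T]); apply: eq_pp => x y _ _ xy; rewrite !perm1; exact: s1.
have NM h k : N (h * k)%g = N h * N k.
  have -> : N k = pp [set: T] (fun x y => s (h x) (h y) * s (k (h x)) (k (h y))).
    have hT : [set: T] = h @: [set: T].
      by apply/setP => x; rewrite inE; apply/esym/imsetP; exists (h^-1%g x); rewrite ?permKV.
    rewrite /N {1}hT pp_imset //; first by move=> x y _ _; exact: perm_inj.
    by move=> x y _ _; exact: (tourn_symM sa (proj1 (sc k))).
  rewrite -ppM; apply: eq_pp => x y _ _ xy; rewrite !permM.
  have [_ h1] := sc h; rewrite -mulrA [s (h x) _ * (_ * _)]mulrA h1 ?mul1r //.
(* The pair [{a, b}] contributes -1. For any other [y] the pairs [{a, y}] and [{b, y}] are exchanged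
   and together contribute a square. *)
have Nt a b : a != b -> N (tperm a b) = -1.
  move=> ab; pose C := [set: T] :\ a :\ b.
  have -> : N (tperm a b) = pp (a |: (b |: C)) (fun x y => s x y * s (tperm a b x) (tperm a b y)).
    by rewrite /N; congr (pp _ _); rewrite /C !setD1K ?inE //= 1?eq_sym ?ab.
  have hsym x y : s x y * s (tperm a b x) (tperm a b y) = s y x * s (tperm a b y) (tperm a b x).
    exact: (tourn_symM sa (proj1 (sc (tperm a b)))).
  have bC : b \notin C by rewrite !inE eqxx.
  have aC : a \notin C by rewrite !inE eqxx andbF.
  rewrite !pp_setU1 //; try by rewrite !inE (negbTE ab) eqxx andbF.
  rewrite [pp C _](_ : _ = 1) ?mulr1; last first.
    rewrite -[RHS](pp1 R C); apply: eq_pp => x y; rewrite !inE => /and3P[xb xa _] /and3P[yb ya _] xy.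
    by rewrite !tpermD 1?eq_sym //; exact: s1.
  rewrite big_setU1 // tpermL tpermR /= -mulrA -big_split /=.
  rewrite big1 ?mulr1; first by rewrite [s b a]sa mulrN s1.
  move=> y; rewrite !inE => /and3P[yb ya _]; rewrite [tperm _ _ y]tpermD 1?eq_sym //.
  by rewrite [s b y * _]mulrC mulrACA s1 1?eq_sym // s1 1?eq_sym // mulr1.
rewrite -/(N g); have [ts_ -> ] := prod_tpermP g.
elim: ts_ => [|[a b] l IH] /=; first by rewrite big_nil N1 odd_perm1.
rewrite big_cons /= => /andP[ab /IH {}IH]; rewrite NM IH Nt // odd_permM odd_tperm ab.
by rewrite signr_addb.
Qed.

Lemma crs_tourn1 T (s : T -> T -> R) mu (A D : {set T}) : involutive mu -> sect mu A D ->
  tourn s -> {in A &, forall x y, x != y -> crs s mu x y * crs s mu x y = 1}.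
Proof.
move=> muK [AD sA] [sa s1] x y xA yA xy.
have [_ mx] := sA _ (subsetP AD _ xA); have [_ my] := sA _ (subsetP AD _ yA).
rewrite xA in mx; rewrite yA in my.
have e1 : x != mu y by apply: contraFneq my => <-.
have e2 : mu x != y by apply: contraFneq mx => ->.
have e3 : mu x != mu y by rewrite (inj_eq (inv_inj muK)).
rewrite -crsM /crs !s1 //; ring.
Qed.

(** For values 1 and -1: the signs of [mu] in [s] and in [t] differ by the product of [s t] over all
    pairs in [D] that are not edges of [mu]. *)
Lemma eps_change T (s t : T -> T -> R) mu (A D : {set T}) : involutive mu -> sect mu A D ->
  antisym s -> antisym t ->
  pp D (fun x y => s x y * t x y) =
  (\prod_(x in A) (s x (mu x) * t x (mu x))) * (pp A (crs s mu) * pp A (crs t mu)).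
Proof.
move=> muK sA hs ht; rewrite (pp_sect muK sA); last by move=> x y _ _; exact: tourn_symM.
by congr (_ * _); rewrite -ppM; apply: eq_pp => x y _ _ _; rewrite crsM.
Qed.

Lemma eps_conj T U (s : U -> U -> R) (g : T -> U) (mu : T -> T) (nu : U -> U) (A : {set T})
   (B : {set U}) (D : {set U}) :
  injective g -> antisym s -> involutive nu -> (forall x, nu (g x) = g (mu x)) ->
  sect nu (g @: A) D -> sect nu B D ->
  pp B (crs s nu) = pp A (crs (fun x y => s (g x) (g y)) mu).
Proof.
move=> gi sa nuK e sA sB.
have -> : pp B (crs s nu) = pp (g @: A) (crs s nu).
  apply: (sect_indep nuK sB sA) => x y _ _; [exact: crs_sym|exact: crs_mu].
rewrite pp_imset; [|by move=> x y _ _; exact: gi|by move=> x y _ _; exact: crs_sym].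
by apply: eq_pp => x y _ _ _; rewrite /crs !e.
Qed.

End Signs.

(** * Perfect matchings as involutions *)

Section Matchings.
Variable T : finType.
Implicit Types (V : {set T}) (mu : {perm T}).

(* A perfect matching of [V] is encoded as the involution whose set of non-fixed points is [V]. *)
Definition pmatch V mu := [forall x, (mu (mu x) == x) && ((mu x == x) == (x \notin V))].

Lemma pmatchP V mu :
  reflect (involutive mu /\ forall x, (mu x == x) = (x \notin V)) (pmatch V mu).
Proof.
apply: (iffP forallP) => [h|[h1 h2] x]; last by rewrite h1 eqxx h2 eqxx.
by split=> x; have /andP[/eqP ? /eqP ?] := h x.
Qed.

Lemma pmatch_in V mu : pmatch V mu -> forall x, (mu x \in V) = (x \in V).
Proof.
by case/pmatchP => h1 h2 x; apply: negb_inj; rewrite -!h2 h1 eq_sym.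
Qed.

Definition pedges V mu : {set {set T}} := [set [set x; mu x] | x in V].

Lemma pedges_mem V mu x y : pmatch V mu -> x != y ->
  ([set x; y] \in pedges V mu) = (x \in V) && (mu x == y).
Proof.
move=> hm xy; have [muK hV] := pmatchP _ _ hm; apply/imsetP/andP => [[z zV e]|[xV /eqP <-]].
  have : x \in [set z; mu z] by rewrite -e !inE eqxx.
  have : y \in [set z; mu z] by rewrite -e !inE eqxx orbT.
  rewrite !inE => /orP[]/eqP ey /orP[]/eqP ex.
  - by rewrite ex ey eqxx in xy.
  - by rewrite ex muK ey pmatch_in ?eqxx.
  - by rewrite ex ey eqxx.
  - by rewrite ex ey eqxx in xy.
by exists x.
Qed.

Lemma pedges_inj V : {in pmatch V &, injective (pedges V)}.
Proof.
move=> mu nu hm hn e; apply/permP => x.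
have [xV|xV] := boolP (x \in V); last first.
  have [_ h1] := pmatchP _ _ hm; have [_ h2] := pmatchP _ _ hn.
  by have /eqP-> : mu x == x by [rewrite h1]; have /eqP-> : nu x == x by rewrite h2.
have xm : x != mu x by have [_ h1] := pmatchP _ _ hm; rewrite eq_sym h1 xV.
have : [set x; mu x] \in pedges V mu by exact: imset_f.
by rewrite e pedges_mem // => /andP[_ /eqP].
Qed.

End Matchings.

(** * The sign defined by crossings *)

Section OrderSign.
Context {disp : Order.disp_t} {T : finOrderType disp}.

Implicit Types (V : {set T}) (mu : {perm T}).

Lemma perfect_pedges V mu : pmatch V mu -> perfect_matching V (pedges V mu).
Proof.
move=> hm; have [muK hV] := pmatchP _ _ hm; apply/andP; split; last first.
  apply/forallP => e; apply/implyP => /imsetP[x xV ->]; rewrite cards2.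
  by have := hV x; rewrite xV eq_sym => ->.
apply/and3P; split.
- rewrite eqEsubset; apply/andP; split; apply/subsetP => x.
    by move=> /bigcupP[_ /imsetP[y yV ->]]; rewrite !inE => /orP[]/eqP->; rewrite ?pmatch_in.
  by move=> xV; apply/bigcupP; exists [set x; mu x]; [exact: imset_f|exact: set21].
- apply/trivIsetP => _ _ /imsetP[x xV ->] /imsetP[y yV ->] ne.
  rewrite -setI_eq0; apply/eqP/setP => z; rewrite !inE.
  apply/negP => /andP[/orP[]/eqP-> /orP[]/eqP e]; case/eqP: ne.
  + by rewrite e.
  + by rewrite e muK setUC.
  + by rewrite -e muK setUC.
  + by rewrite (inv_inj muK e).
- by apply/imsetP => -[x _ /setP/(_ x)]; rewrite !inE eqxx.
Qed.

Lemma perfect_matchingP V (M : {set {set T}}) :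
  perfect_matching V M -> exists2 mu, pmatch V mu & M = pedges V mu.
Proof.
case/andP => /and3P[/eqP cov triv _] /forallP c2.
have h2 e : e \in M -> #|e| = 2 by move=> eM; apply/eqP; have := c2 e; rewrite eM.
have uniq x e f : e \in M -> f \in M -> x \in e -> x \in f -> e = f.
  move=> eM fM xe xf; apply/eqP; apply: contraT => ne.
  by have := trivIsetP triv _ _ eM fM ne; rewrite -setI_eq0 => /eqP/setP/(_ x); rewrite !inE xe xf.
(* The default makes [f] fix the points outside [V], as [pmatch] demands. *)
pose f x := odflt x [pick y | (y != x) && ([set x; y] \in M)].
have fE x y : y != x -> [set x; y] \in M -> f x = y.
  move=> yx xyM; rewrite /f; case: pickP => [z /andP[zx xzM]|/(_ y)]; last by rewrite yx xyM.
  have /setP/(_ z) := uniq x _ _ xyM xzM (set21 _ _) (set21 _ _).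
  by rewrite !inE eqxx orbT (negbTE zx) => /eqP.
have fK : involutive f.
  move=> x; rewrite {2}/f; case: pickP => [y /andP[yx xyM]|h] /=.
    by apply: fE; rewrite 1?eq_sym // setUC.
  by rewrite /f; case: pickP => // y; rewrite h.
have mem x : x \in V -> f x != x /\ [set x; f x] \in M.
  rewrite -cov => /bigcupP[e eM xe]; have /eqP/cards2P[a [b [ab eE]]] := h2 _ eM.
  have [y yx exy] : exists2 y, y != x & e = [set x; y].
    rewrite eE in xe *; move: xe; rewrite !inE => /orP[]/eqP->.
      by exists b; rewrite // eq_sym.
    by exists a; rewrite // setUC.
  rewrite exy in eM; have fx := fE _ _ yx eM; by split; rewrite fx.
exists (perm (inv_inj fK)).
  apply/pmatchP; split=> x; rewrite !permE ?fK //.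
  have [/mem[/negbTE//]|xV] := boolP (x \in V); apply/eqP.
  rewrite /f; case: pickP => // y /andP[_ xyM]; case/negP: xV.
  by rewrite -cov; apply/bigcupP; exists [set x; y]; rewrite // set21.
apply/setP => e; apply/idP/imsetP => [eM|[x xV ->]]; last by rewrite permE; case: (mem x xV).
have /eqP/cards2P[a [b [ab eE]]] := h2 _ eM; exists a; last first.
  by rewrite permE (fE a b) // 1?eq_sym // -eE.
by rewrite -cov; apply/bigcupP; exists e; rewrite // eE set21.
Qed.

Definition sgo (x y : T) : int := if (x < y)%O then 1 else if (y < x)%O then -1 else 0.

Lemma tourn_sgo : tourn sgo.
Proof.
split=> x y; first by rewrite /sgo; case: (comparable_ltgtP (comparableT x y)) => //; rewrite ?opprK ?oppr0.
by rewrite /sgo; case: (comparable_ltgtP (comparableT x y)).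
Qed.

Definition lows (mu : T -> T) : {set T} := [set x | (x < mu x)%O].

Lemma sect_lows (V : {set T}) (mu : {perm T}) : pmatch V mu -> sect mu (lows mu) V.
Proof.
move=> hm; have [muK hV] := pmatchP _ _ hm; split.
  apply/subsetP => x; rewrite inE -[_ \in _]negbK -hV; apply: contraTneq => ->; by rewrite ltxx.
move=> x xV; rewrite pmatch_in // !inE muK -leNgt le_eqVlt hV xV; split=> //.
Qed.

(** The bridge from the crossing number to products over pairs: represent each edge by its lower
    endpoint; then the pairs with factor -1 are the crossing ones. *)
Lemma eps_lows (V : {set T}) (mu : {perm T}) : pmatch V mu ->
  eps (pedges V mu) = pp (lows mu) (crs sgo mu).
Proof.
move=> hm; have [muK hV] := pmatchP _ _ hm.
(* A crossing is recorded by the lower endpoints of its two edges, the smaller one first, which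
   makes the correspondence [h] injective. *)
pose S := [set q : T * T | [&& (q.1 < q.2)%O, (q.2 < mu q.1)%O & (mu q.1 < mu q.2)%O]].
pose h (q : T * T) : {set {set T}} := [set [set q.1; mu q.1]; [set q.2; mu q.2]].
have inV x : mu x != x -> x \in V by rewrite hV negbK.
have -> : eps (pedges V mu) = (-1) ^+ #|S|.
  rewrite /eps /cr; congr (_ ^+ _); rewrite -(@card_in_imset _ _ h); last first.
    move=> [a b] [c d]; rewrite !inE /= => /and3P[ab bm mm] /and3P[cd dm mm'] /setP e.
    have lows_eq x y : (x < mu x)%O -> (y < mu y)%O -> [set x; mu x] = [set y; mu y] -> x = y.
      move=> lx ly /setP ee; have := ee x; rewrite !inE eqxx /= => /esym/orP[/eqP//|/eqP xy].
      by move: lx; rewrite xy muK => /(lt_trans ly); rewrite ltxx.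
    have la := lt_trans ab bm; have lb := lt_trans bm mm.
    have lc := lt_trans cd dm; have ld := lt_trans dm mm'.
    have := e [set a; mu a]; rewrite !inE eqxx /= => /esym/orP[]/eqP e1.
      have := e [set b; mu b]; rewrite !inE eqxx orbT /= => /esym/orP[]/eqP e2.
        by move: ab; rewrite (lows_eq _ _ la lc e1) (lows_eq _ _ lb lc e2) ltxx.
      by rewrite (lows_eq _ _ la lc e1) (lows_eq _ _ lb ld e2).
    have := e [set b; mu b]; rewrite !inE eqxx orbT /= => /esym/orP[]/eqP e2.
      by move: ab; rewrite (lows_eq _ _ la ld e1) (lows_eq _ _ lb lc e2) => /(lt_trans cd); rewrite ltxx.
    by move: ab; rewrite (lows_eq _ _ la ld e1) (lows_eq _ _ lb ld e2) ltxx.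
  apply: eq_card => P; rewrite inE; apply/andP/imsetP.
    case=> sub /existsP[a /existsP[b /existsP[c /existsP[d /and4P[ab bc cd /eqP e]]]]].
    have ac : a != c by rewrite lt_eqF // (lt_trans ab bc).
    have bd : b != d by rewrite lt_eqF // (lt_trans bc cd).
    have : [set a; c] \in pedges V mu by apply: (subsetP sub); rewrite e set21.
    have : [set b; d] \in pedges V mu by apply: (subsetP sub); rewrite e set22.
    rewrite !pedges_mem // => /andP[_ /eqP mb] /andP[_ /eqP ma].
    by exists (a, b); rewrite ?inE /= ?ma ?mb ?ab ?bc // /h /= ma mb.
  case=> -[a b]; rewrite inE /= => /and3P[ab bm mm] ->.
  split.
    apply/subsetP => e; rewrite !inE => /orP[]/eqP->; rewrite pedges_mem ?eqxx ?andbT ?inV //.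
    - by rewrite gt_eqF // (lt_trans ab bm).
    - by rewrite lt_eqF // (lt_trans ab bm).
    - by rewrite gt_eqF // (lt_trans bm mm).
    - by rewrite lt_eqF // (lt_trans bm mm).
  by apply/existsP; exists a; apply/existsP; exists b; apply/existsP; exists (mu a);
    apply/existsP; exists (mu b); rewrite ab bm mm /h eqxx.
rewrite (@pp_tour _ _ _ _ (fun x y => (x < y)%O)); first last.
- move=> x y _ _; apply: crs_sym; exact: (proj1 tourn_sgo).
- by move=> x _; rewrite ltxx.
- by move=> x y _ _ xy; rewrite -leNgt le_eqVlt (negbTE xy).
rewrite pair_big_dep /= -prodr_const.
rewrite [RHS](bigID (mem S)) /= [X in _ * X]big1 ?mulr1.
  apply: congr_big => // -[a b].
    rewrite !inE /=; case: (boolP (_ < _)%O) => ab; rewrite ?andbF //=.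
    case: (boolP (b < mu a)%O) => bm; rewrite ?andbF //=.
    case: (boolP (mu a < mu b)%O) => mm; rewrite ?andbF //= (lt_trans ab bm) (lt_trans bm mm).
    by [].
  rewrite inE /= => /and3P[ab bm mm]; rewrite /crs /sgo ab (lt_gtF bm) bm mm.
  by rewrite (lt_trans ab (lt_trans bm mm)).
move=> [a b]; rewrite !inE /= => /andP[/andP[am /andP[bm ab]] ns].
rewrite ab /= negb_and in ns; rewrite /crs /sgo ab (lt_trans ab bm).
have bma : b != mu a.
  apply: contraTneq ab => e; by rewrite e muK in bm *; rewrite -leNgt ltW.
have mm : mu a != mu b by rewrite (inj_eq (inv_inj muK)) lt_eqF.
case: (ltgtP (mu a) b) ns bma => // [l1 _ _|l1 /= ns _].
  by rewrite (lt_trans l1 bm).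
by case: (ltgtP (mu a) (mu b)) ns mm => // ->; rewrite eqxx.
Qed.

End OrderSign.

(** * One-factorizations as sets of involutions *)

Section WeightedBurnside.

(** Exchanging the sums gives each [x] the coefficient [w x] times the order of its stabilizer. Over
    an orbit, where [w] is constant, these add up to [w x * #|G|]. *)
Lemma weighted_burnside (gT : finGroupType) (T : finType) (to : {action gT &-> T})
    (G : {group gT}) (X : {set T}) (w : T -> int) :
  [acts G, on X | to] -> {in X & G, forall x g, w (to x g) = w x} ->
  (#|G| %| \sum_(g in G) \sum_(x in X | to x g == x) w x)%Z.
Proof.
move=> actX wG.
rewrite (exchange_big_dep (mem X)) /=; last by move=> g x _ /andP[].
rewrite (set_partition_big _ (orbit_partition actX)) /=.
apply: rpred_sum => O /imsetP[x xX ->].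
have stab y : y \in orbit to G x ->
    \sum_(g in G | (y \in X) && (to y g == y)) w y = w x * #|'C_G[x | to]%g|%:Z.
  case/orbitP => g gG <-; have yX : to x g \in X by rewrite (acts_act actX).
  rewrite wG // sumr_const -mulr_natr natz; congr (_ * Posz _).
  have -> : #|[pred i in G | (to x g \in X) && (to (to x g) i == to x g)]| = #|'C_G[to x g | to]%g|.
    apply: eq_card => h; rewrite !inE yX /= sub1set inE; by [].
  have e : orbit to G (to x g) = orbit to G x by apply/orbit_eqP; rewrite mem_orbit.
  have := card_orbit_stab to G (to x g); rewrite e -(card_orbit_stab to G x).
  by move/eqP; rewrite eqn_pmul2l ?card_gt0; [move/eqP|apply/set0Pn; exists x; exact: orbit_refl].
rewrite (eq_bigr _ stab) sumr_const -mulr_natr natz -mulrA -PoszM mulnC.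
by rewrite card_orbit_stab dvdz_mull.
Qed.

End WeightedBurnside.

Section OneFactorizations.
Variable V : finType.
Implicit Types (F : {set {perm V}}) (s : V -> V -> int) (mu : {perm V}).

(** With factors encoded as involutions, relabelling the vertices becomes conjugation in the
    symmetric group. *)
Definition onef F : bool :=
  [forall mu in F, pmatch [set: V] mu]
  && [forall x, forall y, (x != y) ==> (#|[set mu in F | mu x == y]| == 1%N)].

Lemma onef_pmatch F mu : onef F -> mu \in F -> pmatch [set: V] mu.
Proof. by case/andP => /forall_inP h _; exact: h. Qed.

Lemma onef_neq F mu x : onef F -> mu \in F -> (mu x == x) = false.
Proof. by move=> hF /(onef_pmatch hF)/pmatchP[_ ->]; rewrite inE. Qed.

Lemma onef_card1 F x y : onef F -> x != y -> #|[set mu in F | mu x == y]| = 1%N.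
Proof. by case/andP => _ /forallP/(_ x)/forallP/(_ y)/implyP h /h/eqP. Qed.

Lemma onef_ex F x y : onef F -> x != y -> exists2 mu, mu \in F & mu x = y.
Proof.
move=> hF /(onef_card1 hF)/eqP/cards1P[mu /setP/(_ mu)].
by rewrite !inE eqxx => /andP[muF /eqP]; exists mu.
Qed.

Lemma onef_uniq F x mu nu : onef F -> mu \in F -> nu \in F -> mu x = nu x -> mu = nu.
Proof.
move=> hF hm hn e; have : x != mu x by rewrite eq_sym (onef_neq _ hF).
move/(onef_card1 hF)/eqP/cards1P => [la /setP h].
have := h mu; have := h nu; rewrite !inE hm hn e eqxx /=.
by move=> /esym/eqP-> /esym/eqP->.
Qed.

Lemma onefP F : (forall mu, mu \in F -> pmatch [set: V] mu) ->
  (forall x y, x != y -> exists2 mu, mu \in F & mu x = y) ->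
  (forall x mu nu, mu \in F -> nu \in F -> mu x = nu x -> mu = nu) -> onef F.
Proof.
move=> h1 h2 h3; apply/andP; split; first exact/forall_inP.
apply/forallP => x; apply/forallP => y; apply/implyP => /h2[mu hm e].
apply/cards1P; exists mu; apply/setP => nu; rewrite !inE.
apply/andP/eqP => [[hn /eqP en]|->]; last by rewrite hm e.
by apply: (h3 x); rewrite // e.
Qed.

Lemma card_onef F : onef F -> (0 < #|V|)%N -> #|F| = #|V|.-1.
Proof.
move=> hF /card_gt0P[x _].
rewrite -(@card_in_imset _ _ (fun mu => mu x)) => [|mu nu]; last exact: onef_uniq.
rewrite -(cardsC1 x); apply: eq_card => y; rewrite !inE.
apply/imsetP/idP => [[mu hm ->]|]; first by rewrite (onef_neq _ hF).
by rewrite eq_sym => /(onef_ex hF)[mu hm <-]; exists mu.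
Qed.

Definition esec mu : {set V} := [set x | (enum_rank x < enum_rank (mu x))%N].

Lemma sect_esec (D : {set V}) mu : pmatch D mu -> sect mu (esec mu) D.
Proof.
move=> hm; have [muK hV] := pmatchP _ _ hm; split.
  apply/subsetP => x; rewrite inE -[_ \in _]negbK -hV; apply: contraTneq => ->; by rewrite ltnn.
move=> x xV; rewrite pmatch_in // !inE muK; split=> //; apply: enum_rank_ltNgt.
by rewrite hV xV.
Qed.

Definition epsr s mu := pp (esec mu) (crs s mu).
Definition weight s F := \prod_(mu in F) epsr s mu.

Lemma epsr_sect s mu D A : antisym s -> pmatch D mu -> sect mu A D -> epsr s mu = pp A (crs s mu).
Proof.
move=> sa hm sA; have [muK _] := pmatchP _ _ hm.
apply: (sect_indep muK (sect_esec hm) sA) => x y _ _; [exact: crs_sym|exact: crs_mu].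
Qed.

Lemma epsr_sq s mu : tourn s -> pmatch [set: V] mu -> epsr s mu * epsr s mu = 1.
Proof.
move=> ts hm; have [muK _] := pmatchP _ _ hm; rewrite /epsr -ppM -[RHS](pp1 _ (esec mu)).
by apply: eq_pp => x y xA yA xy; rewrite (crs_tourn1 muK (sect_esec hm)).
Qed.

(* Two tournaments differ by a symmetric sign; every pair of vertices is matched in exactly
   one of the [#|V| - 1] factors, so it contributes to the ratio an even number of times. *)
Lemma weight_indep s t F : onef F -> (0 < #|V|)%N -> ~~ odd #|V| -> tourn s -> tourn t ->
  weight s F = weight t F.
Proof.
move=> hF V0 Vev ts tt; have [sa s1] := ts; have [ta t1] := tt.
pose u x y := s x y * t x y.
have usym : {in [set: V] &, forall x y, u x y = u y x} by move=> x y _ _; exact: tourn_symM.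
have w2 : weight s F * weight s F = 1.
  by rewrite -big_split /= big1 // => mu hm; apply: epsr_sq => //; exact: onef_pmatch hm.
have P2 : pp [set: V] u * pp [set: V] u = 1.
  rewrite -ppM -[RHS](pp1 _ [set: V]); apply: eq_pp => x y _ _ xy.
  by rewrite /u mulrACA s1 // t1 // mulr1.
have e1 : pp [set: V] u ^+ #|F| =
    (\prod_(mu in F) \prod_(x in esec mu) u x (mu x)) * (weight s F * weight t F).
  rewrite -prodr_const -!big_split /=; apply: eq_bigr => mu hm.
  have hp := onef_pmatch hF hm; have [muK _] := pmatchP _ _ hp.
  by rewrite (eps_change muK (sect_esec hp)).
have e2 : \prod_(mu in F) \prod_(x in esec mu) u x (mu x) = pp [set: V] u.
  pose G x y mu := if (enum_rank x < enum_rank y)%N && (mu x == y) then u x y else 1.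
  transitivity (\prod_(mu in F) \prod_x \prod_y G x y mu).
    apply: eq_bigr => mu _; rewrite big_mkcond /=; apply: eq_bigr => x _.
    rewrite (bigD1 (mu x)) //= /G eqxx andbT inE big1 ?mulr1 // => y.
    by rewrite eq_sym => /negbTE->; rewrite andbF.
  rewrite exchange_big /=; apply: eq_big => [x|x _]; first by rewrite inE.
  rewrite exchange_big [RHS]big_mkcond /=; apply: eq_bigr => y _; rewrite inE /=.
  rewrite /G; case: ifP => xy /=; last by apply: big1.
  rewrite -big_mkcondr /= prodr_const.
  have ne : x != y by apply: contraTneq xy => ->; rewrite ltnn.
  rewrite -[RHS]expr1 -(onef_card1 hF ne); congr (_ ^+ _).
  by apply: eq_card => mu; rewrite !inE.
have oF : odd #|F| by rewrite (card_onef hF V0) -[odd _]negbK -oddS prednK.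
(* The number of factors is odd and [pp u] is its own inverse. *)
have e3 : pp [set: V] u ^+ #|F| = pp [set: V] u.
  by rewrite -(odd_double_half #|F|) oF add1n exprS -mul2n exprM expr2 P2 expr1n mulr1.
rewrite e3 e2 in e1.
have {e1} e4 : weight s F * weight t F = 1.
  by rewrite -[LHS]mul1r -P2 -mulrA -e1 P2.
by rewrite -[LHS]mulr1 -e4 mulrA w2 mul1r.
Qed.

Definition cnt s : int := \sum_(F | onef F) weight s F.

Lemma cnt_indep s t : (0 < #|V|)%N -> ~~ odd #|V| -> tourn s -> tourn t -> cnt s = cnt t.
Proof. by move=> *; apply: eq_bigr => F hF; apply: weight_indep. Qed.

End OneFactorizations.

(** * Transport along a bijection of the vertices *)

Section Relabel.
Variables (U V : finType) (phi : U -> V) (psi : V -> U).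
Hypotheses (phiK : cancel phi psi) (psiK : cancel psi phi).

Lemma relabel_inj (mu : {perm U}) : injective (fun x => phi (mu (psi x))).
Proof. by move=> x y /(can_inj phiK)/perm_inj/(can_inj psiK). Qed.

Definition relabel mu : {perm V} := perm (@relabel_inj mu).

Lemma relabelE mu x : relabel mu (phi x) = phi (mu x).
Proof. by rewrite permE phiK. Qed.

Lemma inj_relabel : injective relabel.
Proof. by move=> mu nu e; apply/permP => x; apply: (can_inj phiK); rewrite -!relabelE e. Qed.

Lemma pmatch_relabel mu : pmatch [set: V] (relabel mu) = pmatch [set: U] mu.
Proof.
apply/pmatchP/pmatchP => -[h1 h2]; split=> x.
- by apply: (can_inj phiK); rewrite -!relabelE h1.
- by rewrite inE -(inj_eq (can_inj phiK)) -relabelE h2 inE.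
- by rewrite -(psiK x) !relabelE h1.
- by rewrite -(psiK x) relabelE (inj_eq (can_inj phiK)) h2 !inE.
Qed.

Lemma epsr_relabel (s : V -> V -> int) mu : antisym s -> pmatch [set: U] mu ->
  epsr s (relabel mu) = epsr (fun x y => s (phi x) (phi y)) mu.
Proof.
move=> sa hm; have hr : pmatch [set: V] (relabel mu) by rewrite pmatch_relabel.
have [rK _] := pmatchP _ _ hr; apply: eps_conj (sect_esec hr) => //.
- exact: can_inj phiK.
- exact: relabelE.
split; first by exact: subsetT.
have im x (A : {set U}) : (phi x \in phi @: A) = (x \in A) by rewrite mem_imset //; exact: can_inj phiK.
move=> x _; rewrite -(psiK x) relabelE !im; split; first by rewrite inE.
by have [_ /(_ (psi x) (in_setT _))[]] := sect_esec hm.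
Qed.

Lemma onef_relabel (F : {set {perm U}}) : onef F -> onef (relabel @: F).
Proof.
move=> hF; apply: onefP.
- by move=> _ /imsetP[mu hm ->]; rewrite pmatch_relabel; exact: onef_pmatch hm.
- move=> x y; rewrite -(psiK x) -(psiK y) (inj_eq (can_inj phiK)) => /(onef_ex hF)[mu hm <-].
  by exists (relabel mu); rewrite ?imset_f ?relabelE.
- move=> x _ _ /imsetP[mu hm ->] /imsetP[nu hn ->]; rewrite -(psiK x) !relabelE.
  by move=> /(can_inj phiK)/(onef_uniq hF hm hn) ->.
Qed.

Lemma weight_relabel (s : V -> V -> int) F : antisym s -> onef F ->
  weight s (relabel @: F) = weight (fun x y => s (phi x) (phi y)) F.
Proof.
move=> sa hF; rewrite /weight big_imset /=; last by move=> mu nu _ _; exact: inj_relabel.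
by apply: eq_bigr => mu hm; rewrite epsr_relabel //; exact: onef_pmatch hm.
Qed.

End Relabel.

Lemma cnt_relabel (U V : finType) (phi : U -> V) (psi : V -> U) (s : V -> V -> int) :
  cancel phi psi -> cancel psi phi -> antisym s ->
  cnt s = cnt (fun x y => s (phi x) (phi y)).
Proof.
move=> phiK psiK sa.
pose h (F : {set {perm U}}) := relabel phiK psiK @: F.
pose k (F : {set {perm V}}) := relabel psiK phiK @: F.
have hK : cancel h k.
  move=> F; rewrite /k /h -imset_comp -[RHS]imset_id; apply: eq_imset => mu /=.
  by apply/permP => x; rewrite -(phiK x) relabelE -{1}(psiK (phi x)) relabelE phiK.
have kK : cancel k h.
  move=> F; rewrite /k /h -imset_comp -[RHS]imset_id; apply: eq_imset => mu /=.
  by apply/permP => x; rewrite -(psiK x) relabelE -{1}(phiK (psi x)) relabelE psiK.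
have hE F : onef (h F) = onef F.
  apply/idP/idP => hF; last exact: onef_relabel.
  by rewrite -(hK F); exact: onef_relabel.
rewrite /cnt (reindex h) /=; last by exists k => F _.
by apply: eq_big => F; rewrite hE // => hF; rewrite weight_relabel.
Qed.

Lemma weight_conj (V : finType) (s : V -> V -> int) (g : {perm V}) (F : {set {perm V}}) :
  onef F -> (0 < #|V|)%N -> ~~ odd #|V| -> tourn s ->
  onef (F :^ g)%g /\ weight s (F :^ g)%g = weight s F.
Proof.
move=> hF V0 Vev ts.
have e : (F :^ g)%g = relabel (permK g) (permKV g) @: F.
  apply: eq_imset => mu; apply/permP => x.
  by rewrite -(permKV g x) relabelE permJ.
rewrite e; split; first exact: onef_relabel.
rewrite weight_relabel //; last by case: ts.
apply: weight_indep => //; apply: tourn_comp => //; exact: perm_inj.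
Qed.

Lemma one_factorizationP n (F : {set {set {set 'I_n}}}) : (0 < n)%N ->
  one_factorization F <-> exists2 H : {set {perm 'I_n}}, onef H & F = pedges [set: 'I_n] @: H.
Proof.
move=> n0; split=> [/andP[/and3P[/eqP cov triv _] /forall_inP hM]|[H hH ->]].
  have mem2 x y : x != y -> exists2 mu : {perm 'I_n},
      pmatch setT mu && (pedges setT mu \in F) & mu x = y.
    move=> xy; have : [set x; y] \in edges n by rewrite inE cards2 xy.
    rewrite -cov => /bigcupP[M MF xyM]; have [mu hm eM] := perfect_matchingP (hM _ MF).
    exists mu; first by rewrite hm -eM.
    by move: xyM; rewrite eM pedges_mem // => /andP[_ /eqP].
  exists [set mu | pmatch setT mu && (pedges setT mu \in F)].
    apply: onefP => [mu|x y /mem2[mu h e]|x mu nu]; rewrite ?inE; first by case/andP.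
      by exists mu; rewrite ?inE.
    move=> /andP[hm mF] /andP[hn nF] e; apply: (pedges_inj hm hn).
    apply/eqP; apply: contraT => ne; have := trivIsetP triv _ _ mF nF ne.
    have [_ /(_ x)] := pmatchP _ _ hm; rewrite inE /= eq_sym => /negbT xm.
    rewrite -setI_eq0 => /eqP/setP/(_ [set x; mu x]).
    by rewrite !inE !pedges_mem // ?e // -?e // inE eqxx.
  apply/setP => M; apply/idP/imsetP => [MF|[mu]]; last by rewrite inE => /andP[_ ?] ->.
  have [mu hm eM] := perfect_matchingP (hM _ MF).
  by exists mu; rewrite // inE hm -eM.
apply/andP; split; last first.
  by apply/forall_inP => _ /imsetP[mu hm ->]; apply: perfect_pedges; exact: onef_pmatch hm.
apply/and3P; split.
- rewrite eqEsubset; apply/andP; split; apply/subsetP => e.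
    move=> /bigcupP[_ /imsetP[mu hm ->] /imsetP[x _ ->]].
    by rewrite inE cards2 [x == _]eq_sym (onef_neq _ hH).
  rewrite inE => /cards2P[x [y [xy ->]]]; have [mu hm exy] := onef_ex hH xy.
  apply/bigcupP; exists (pedges setT mu); first exact: imset_f.
  by rewrite pedges_mem ?inE ?exy ?eqxx //; exact: onef_pmatch hm.
- apply/trivIsetP => _ _ /imsetP[mu hm ->] /imsetP[nu hn ->] ne.
  rewrite -setI_eq0; apply/eqP/setP => e; rewrite !inE; apply/negP => /andP[/imsetP[x _ ->]].
  rewrite pedges_mem; [|exact: onef_pmatch hn|by rewrite eq_sym (onef_neq _ hH)].
  rewrite inE /= => /eqP h; case/eqP: ne; congr pedges; exact: (onef_uniq hH hm hn (esym h)).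
- apply/imsetP => -[mu hm /setP/(_ [set Ordinal n0; mu (Ordinal n0)])].
  by rewrite inE => /esym/negbT/negP; apply; apply: imset_f.
Qed.

Lemma signed_countE n : (0 < n)%N -> signed_count n = cnt (@sgo _ 'I_n).
Proof.
move=> n0; rewrite /signed_count /cnt.
pose S := [set H : {set {perm 'I_n}} | onef H].
have inj : {in S &, injective (fun H : {set {perm 'I_n}} => pedges [set: 'I_n] @: H)}.
  move=> H K; rewrite !inE => hH hK e; apply/setP => mu.
  wlog suff sub : H K hH hK e / mu \in H -> mu \in K.
    by apply/idP/idP; apply: sub.
  move=> hm; have : pedges setT mu \in pedges setT @: K by rewrite -e; exact: imset_f.
  case/imsetP => nu hn /pedges_inj -> //; first exact: onef_pmatch hm.
  exact: onef_pmatch hn.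
rewrite (eq_bigl (fun F => F \in (fun H : {set {perm 'I_n}} => pedges [set: 'I_n] @: H) @: S)).
  rewrite big_imset //=; apply: eq_big => [H|H]; rewrite inE // => hH.
  rewrite big_imset /=; last first.
    by move=> mu nu hm hn /pedges_inj; apply; [exact: onef_pmatch hm|exact: onef_pmatch hn].
  apply: eq_bigr => mu hm; have hp := onef_pmatch hH hm; rewrite (eps_lows hp).
  by rewrite (epsr_sect _ hp (sect_lows hp)) //; case: (@tourn_sgo _ 'I_n).
move=> F; apply/idP/imsetP => [/(one_factorizationP _ n0)[H hH ->]|[H]].
  by exists H; rewrite ?inE.
by rewrite inE => hH ->; apply/(one_factorizationP _ n0); exists H.
Qed.

(** Allows any vertex set of the right size with any tournament, in particular one adapted to a
    group action. *)
Lemma signed_count_on n (V : finType) (s : V -> V -> int) :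
  (0 < n)%N -> ~~ odd n -> #|V| = n -> tourn s -> signed_count n = cnt s.
Proof.
move=> n0 nev cV ts; rewrite signed_countE //.
have eI : #|'I_n| = #|V| by rewrite card_ord.
pose phi (i : 'I_n) : V := enum_val (cast_ord (esym cV) i).
pose psi (x : V) : 'I_n := cast_ord cV (enum_rank x).
have phiK : cancel phi psi by move=> i; rewrite /phi /psi enum_valK cast_ordKV.
have psiK : cancel psi phi by move=> x; rewrite /phi /psi cast_ordK enum_rankK.
rewrite (cnt_relabel phiK psiK) //; last by case: ts.
apply: cnt_indep; rewrite ?card_ord //; first exact: tourn_sgo.
by apply: tourn_comp => //; exact: can_inj phiK.
Qed.

(** * Loops of two matchings of the darts *)

Section Darts.
Variable H : finType.
Implicit Types (s t : H -> H -> int) (mu rho tau g : {perm H}) (A B o : {set H}).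

Definition sectT mu A := [forall x, (mu x \in A) == (x \notin A)].

Lemma sectTP mu A : reflect (sect mu A [set: H]) (sectT mu A).
Proof.
apply: (iffP forallP) => [h|[_ h] x]; last by have [] := h x (in_setT _) => _ ->.
by split=> [|x _]; [exact: subsetT|rewrite inE (eqP (h x))].
Qed.

(** For a linear order [s] this is the sign of the permutation that lists the edges one after
    another, each from its endpoint in [A]: the sign with which [mu], oriented by [A], enters a
    Pfaffian. *)
Definition Om mu A s : int := (\prod_(x in A) s x (mu x)) * pp A (crs s mu).

Lemma Om_change mu A s t : involutive mu -> sectT mu A -> antisym s -> antisym t ->
  Om mu A s * Om mu A t = pp [set: H] (fun x y => s x y * t x y).
Proof.
move=> muK /sectTP sA hs ht; rewrite (eps_change muK sA hs ht) big_split /=.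
by rewrite /Om mulrACA.
Qed.

Lemma Om_sq mu A s : involutive mu -> sectT mu A -> tourn s -> Om mu A s * Om mu A s = 1.
Proof.
move=> muK sA [sa s1]; rewrite Om_change // -[RHS](pp1 _ [set: H]).
by apply: eq_pp => x y _ _; exact: s1.
Qed.

(** By [Om_change] a change of tournament multiplies both terms by the same sign, the product of
    [s t] over all pairs. *)
Lemma Om_pair_indep rho tau A B s t : involutive rho -> involutive tau ->
  sectT rho A -> sectT tau B -> tourn s -> tourn t ->
  Om rho A s * Om tau B s = Om rho A t * Om tau B t.
Proof.
move=> rK tK sA sB ts tt; have [sa _] := ts; have [ta _] := tt.
have e : Om rho A s * Om rho A t = Om tau B s * Om tau B t by rewrite !Om_change.
have q1 := Om_sq rK sA tt; have q2 := Om_sq tK sB tt; have q3 := Om_sq tK sB ts.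
transitivity ((Om rho A s * Om rho A t) * (Om tau B s * Om tau B t) * (Om rho A t * Om tau B t)).
  transitivity (Om rho A s * Om tau B s * (Om rho A t * Om rho A t) * (Om tau B t * Om tau B t)).
    by rewrite q1 q2 !mulr1.
  by ring.
rewrite e (_ : _ * _ * (Om tau B s * Om tau B t) =
  (Om tau B s * Om tau B s) * (Om tau B t * Om tau B t)); last by ring.
by rewrite q2 q3 !mul1r.
Qed.

(** [A :\: B] contains one endpoint of every edge that the two sections orient differently, and each
    such edge changes the sign once. *)
Lemma Om_flip mu A B s : involutive mu -> sectT mu A -> sectT mu B -> antisym s ->
  Om mu B s = (-1) ^+ #|A :\: B| * Om mu A s.
Proof.
move=> muK /sectTP sA /sectTP sB sa; rewrite /Om mulrA; congr (_ * _); last first.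
  by apply: (sect_indep muK sB sA) => x y _ _; [exact: crs_sym|exact: crs_mu].
have -> : \prod_(x in B) s x (mu x) = \prod_(x in [set: H]) (if x \in B then s x (mu x) else 1).
  by rewrite big_mkcond; apply: eq_big => x; rewrite ?inE.
rewrite (prod_sect _ muK sA) -prodr_const [X in _ = X * _]big_mkcond.
rewrite [X in _ = _ * X]big_mkcond -big_split /= [LHS]big_mkcond.
apply: eq_bigr => x _; rewrite !inE.
case: (boolP (x \in A)) => xA; last by rewrite andbF mulr1.
have [_ /(_ x (in_setT _))[_ ->]] := sB.
by case: (x \in B); rewrite /= ?mulr1 ?mul1r // muK sa mulN1r.
Qed.

(** Conjugating by [g] amounts to pulling the tournament back along [g], which costs the sign of [g]
    by [sgn_pp]. *)
Lemma Om_conj mu B s g : involutive mu -> sectT mu B -> g @: B = B -> tourn s ->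
  Om (mu ^ g)%g B s = (-1) ^+ g * Om mu B s.
Proof.
move=> muK sB gB ts; have [sa _] := ts.
have tg : tourn (fun x y => s (g x) (g y)) by apply: tourn_comp => //; exact: perm_inj.
have -> : Om (mu ^ g)%g B s = Om mu B (fun x y => s (g x) (g y)).
  rewrite /Om -{1 2}gB big_imset /=; last by move=> x y _ _; exact: perm_inj.
  rewrite pp_imset; [|by move=> x y _ _; exact: perm_inj|by move=> x y _ _; exact: crs_sym].
  congr (_ * _); first by apply: eq_bigr => x _; rewrite permJ.
  by apply: eq_pp => x y _ _ _; rewrite /crs !permJ.
rewrite -(sgn_pp g ts) -(Om_change muK sB sa (proj1 tg)) mulrAC Om_sq // mul1r //.
Qed.

Definition sgr (x y : H) : int :=
  if (enum_rank x < enum_rank y)%N then 1 else if (enum_rank y < enum_rank x)%N then -1 else 0.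

Lemma tourn_sgr : tourn sgr.
Proof.
split=> x y; first by rewrite /sgr; case: ltngtP; rewrite ?opprK ?oppr0.
by move=> /enum_rank_ltNgt; rewrite /sgr; case: ltngtP.
Qed.

Section Loops.
Variables rho tau : {perm H}.
Hypotheses (rhoP : pmatch [set: H] rho) (tauP : pmatch [set: H] tau).

Let rK : involutive rho. Proof. by case/pmatchP: rhoP. Qed.
Let tK : involutive tau. Proof. by case/pmatchP: tauP. Qed.

Lemma loop_inj o : sectT rho o -> sectT tau o ->
  injective (fun x => if x \in o then rho (tau x) else x).
Proof.
move=> /forallP ro /forallP to x y.
have h z : z \in o -> rho (tau z) \in o by rewrite (eqP (ro _)) (eqP (to z)) negbK.
case: ifP => xo; case: ifP => yo // e.
- by have := perm_inj (perm_inj e).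
- by have := h _ xo; rewrite e yo.
- by have := h _ yo; rewrite -e xo.
Qed.

(* The loops of [rho] and [tau], run along in the direction given by the section [o]. *)
Definition loopp o : {perm H} :=
  odflt 1%g [pick g : {perm H} | [forall x, g x == if x \in o then rho (tau x) else x]].

Lemma looppE o : sectT rho o -> sectT tau o ->
  forall x, loopp o x = if x \in o then rho (tau x) else x.
Proof.
move=> r t x; rewrite /loopp; case: pickP => [g /forallP/(_ x)/eqP//|].
by move=> /(_ (perm (loop_inj r t)))/negP[]; apply/forallP => y; rewrite permE.
Qed.

(** Started in [o], the edges of [tau] end in [tau x = rho (loopp o x)]: these are the ends of the
    edges of [rho], permuted by [loopp o]. *)
Lemma sgn_loopp o : sectT rho o -> sectT tau o ->
  forall s, tourn s -> Om rho o s * Om tau o s = (-1) ^+ loopp o.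
Proof.
move=> r t.
(* A tournament adapted to [o]: all of [o] precedes the complement, which is ordered like its image
   under [rho]. By [Om_pair_indep] it may replace the given one. *)
pose s x y := if x \in o then (if y \in o then sgr x y else 1)
              else if y \in o then -1 else sgr (rho x) (rho y).
have [ga g1] := tourn_sgr.
have ts : tourn s.
  split=> x y; rewrite /s; case: (x \in o); case: (y \in o) => //; first exact: g1.
  by move=> xy; apply: g1; rewrite (inj_eq perm_inj).
move=> s' ts'; rewrite (Om_pair_indep rK tK r t ts' ts) -(sgn_pp (loopp o) ts).
have [sa _] := ts.
have ro x : (rho x \in o) = (x \notin o) by have /forallP/(_ x)/eqP := r.
have to x : (tau x \in o) = (x \notin o) by have /forallP/(_ x)/eqP := t.
rewrite (pp_sect rK (sectTP _ _ r)); last first.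
  by move=> x y _ _; exact: (tourn_symM sa (proj1 (tourn_comp (@perm_inj _ (loopp o)) ts))).
rewrite /Om [X in (X * _) * _]big1 ?mul1r; last by move=> x xo; rewrite /s xo ro xo.
rewrite [X in _ * (X * _)]big1 ?mul1r; last by move=> x xo; rewrite /s xo to xo.
rewrite [X in X * pp _ _]big1 ?mul1r; last first.
  by move=> x xo; rewrite !looppE // ro xo /s /= !ro !to xo /= mulr1.
rewrite -ppM; apply: eq_pp => x y xo yo xy.
rewrite /crs !looppE // !ro xo yo /= /s !ro !to xo yo /= !rK.
by ring.
Qed.

Definition invk (N : nat) : {set {ffun H -> 'I_N}} :=
  [set k : {ffun H -> 'I_N} | [forall x, (k (rho x) == k x) && (k (tau x) == k x)]].

(** [invk] consists of the colourings constant along the loops. Every loop meets [o] in one cycle of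
    [loopp o], so one colour is chosen freely for each such cycle. *)
Lemma card_invk o : sectT rho o -> sectT tau o ->
  forall N, #|invk N| = (N ^ #|[set porbit (loopp o) x | x in o]|)%N.
Proof.
move=> r t N; set P := [set _ | _ in _].
have ro x : (rho x \in o) = (x \notin o) by have /forallP/(_ x)/eqP := r.
have to x : (tau x \in o) = (x \notin o) by have /forallP/(_ x)/eqP := t.
(* The endpoint in [o] of the edge of [rho] at [x]. *)
pose bs x := if x \in o then x else rho x.
have bso x : bs x \in o by rewrite /bs; case: ifP => // h; rewrite ro h.
pose cl x := porbit (loopp o) (bs x).
have clP x : cl x \in P by exact: imset_f.
have clo x : x \in o -> cl x = porbit (loopp o) x by rewrite /cl /bs => ->.
have pstep x : x \in o -> porbit (loopp o) (rho (tau x)) = porbit (loopp o) x.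
  by move=> xo; have := porbit_perm (loopp o) 1 x; rewrite expg1 looppE // xo.
have clr x : cl (rho x) = cl x by rewrite /cl /bs ro; case: (boolP (x \in o)); rewrite //= rK.
have clt x : cl (tau x) = cl x.
  rewrite /cl /bs to; case: (boolP (x \in o)) => xo /=; first exact: pstep.
  by rewrite -[LHS]pstep ?tK // to xo.
have exP (q : {A : {set H} | A \in P}) : exists x, cl x == val q.
  by case: q => A /=; case/imsetP => x xo ->; exists x; rewrite clo.
pose clq x : {A : {set H} | A \in P} := exist (fun A => A \in P) (cl x) (clP x).
pose h (g : {ffun {A : {set H} | A \in P} -> 'I_N}) : {ffun H -> 'I_N} := [ffun x => g (clq x)].
have -> : invk N = h @: [set: {ffun {A : {set H} | A \in P} -> 'I_N}].
  apply/setP => k; rewrite inE; apply/forallP/imsetP => [kK|[g _ ->] x]; last first.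
    by rewrite !ffunE; apply/andP; split; apply/eqP; congr (g _); apply: val_inj; rewrite /= ?clr ?clt.
  have kr x : k (rho x) = k x by case/andP: (kK x) => /eqP.
  have kt x : k (tau x) = k x by case/andP: (kK x) => _ /eqP.
  have kb x : k (bs x) = k x by rewrite /bs; case: ifP.
  have kl x : k (loopp o x) = k x by rewrite looppE //; case: ifP => // _; rewrite kr kt.
  have kcl x y : cl x = cl y -> k x = k y.
    rewrite -(kb x) -(kb y) => /eqP; rewrite eq_porbit_mem => /porbitP[i ->].
    by elim: i => [|i IH]; rewrite ?perm1 // expgSr permM kl.
  exists [ffun q => k (xchoose (exP q))]; rewrite ?inE //; apply/ffunP => x; rewrite !ffunE.
  by apply: kcl; rewrite (eqP (xchooseP (exP (clq x)))).
rewrite card_imset.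
  by rewrite cardsT card_ffun card_sig card_ord; congr (_ ^ _)%N; apply: eq_card => A; rewrite !inE.
move=> g1 g2 /ffunP e; apply/ffunP => q; have [x /eqP xq] := exP q.
by have := e x; rewrite !ffunE (_ : clq x = q) //; apply: val_inj.
Qed.

(** Two common sections differ by a function constant along the loops; relative to [o], sections are
    therefore colourings of the loops with two colours. *)
Lemma card_sections o : sectT rho o -> sectT tau o ->
  #|[set o' : {set H} | sectT rho o' && sectT tau o']| = #|invk 2|.
Proof.
move=> r t.
have ro x : (rho x \in o) = (x \notin o) by have /forallP/(_ x)/eqP := r.
have to x : (tau x \in o) = (x \notin o) by have /forallP/(_ x)/eqP := t.
pose b2 (b : bool) : 'I_2 := inord b.
have b2i : injective b2.
  by case; case=> // /(congr1 (@nat_of_ord 2)); rewrite /b2 !inordK.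
pose h (o' : {set H}) : {ffun H -> 'I_2} := [ffun x => b2 ((x \in o') (+) (x \in o))].
have hi : injective h.
  move=> o1 o2 /ffunP e; apply/setP => x; have := e x; rewrite !ffunE => /b2i.
  exact: addIb.
rewrite -(card_imset _ hi); apply: eq_card => k; rewrite [RHS]inE.
apply/imsetP/forallP => [[o']|hk].
  rewrite inE => /andP[/forallP ro' /forallP to'] -> x.
  by rewrite !ffunE (eqP (ro' x)) (eqP (to' x)) ro to addbN addNb negbK eqxx.
exists [set x | (k x == b2 true) (+) (x \in o)].
  rewrite inE; apply/andP; split; apply/forallP => x; rewrite !inE; have /andP[/eqP e1 /eqP e2] := hk x.
    by rewrite e1 ro addbN.
  by rewrite e2 to addbN.
apply/ffunP => x; rewrite ffunE inE addbK; case: eqP => [//|ne].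
apply: val_inj; rewrite /= inordK //; case: (k x) ne => -[|[|//]] // i [].
by apply: val_inj; rewrite /= inordK.
Qed.

(** The loops alternate between [rho] and [tau] and so have even length; a common section takes
    every other point of each loop. *)
Lemma section_ex : exists2 o, sectT rho o & sectT tau o.
Proof.
have rf x : rho x != x by have [_ ->] := pmatchP _ _ rhoP; rewrite inE.
have tf x : tau x != x by have [_ ->] := pmatchP _ _ tauP; rewrite inE.
have [q qE] : exists q : {perm H}, forall x, q x = tau (rho x).
  by exists (rho * tau)%g => x; rewrite permM.
(* Since [rho] conjugates [q] to its inverse, [q ^ (i + 2) x = rho x] would give
   [q ^ i (q x) = rho (q x)]. The descent ends at a fixed point of [rho] or of [tau]. *)
have ne i : forall x, (q ^+ i)%g x != rho x.
  have [k] := ubnP i; elim: k i => // k IH [|[|i]] ik x.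
  - by rewrite perm1 eq_sym.
  - by rewrite expg1 qE tf.
  - apply/negP => /eqP; rewrite expgSr permM expgS permM !qE => e.
    have /eqP[] := IH i (ltnW ik) (tau (rho x)).
    by apply: (inv_inj rK); apply: (inv_inj tK); rewrite rK e.
have ne2 x : porbit q x != porbit q (rho x).
  by rewrite eq_sym eq_porbit_mem; apply/porbitP => -[i /esym/eqP]; apply/negP; exact: ne.
(* Each loop splits into two cycles of [q] exchanged by [rho]; the enumeration selects one of
   them. *)
pose o := [set x | (enum_rank (porbit q x) < enum_rank (porbit q (rho x)))%N].
have ro x : (rho x \in o) = (x \notin o).
  by rewrite !inE rK; apply: enum_rank_ltNgt; rewrite eq_sym ne2.
have qo x : (q x \in o) = (x \in o).
  rewrite !inE; have := porbit_perm q 1 x; rewrite expg1 => ->.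
  have := porbit_perm q 1 (rho (q x)); rewrite expg1 => <-.
  by rewrite (_ : q (rho (q x)) = rho x) // !qE rK tK.
exists o; apply/forallP => x; rewrite ?ro //.
by rewrite -{1}(rK x) -qE qo ro.
Qed.

Lemma card_sectT o : sectT rho o -> #|H| = #|o|.*2.
Proof.
move=> /forallP r; rewrite -(cardsC o) -addnn; congr (_ + _)%N.
rewrite -[RHS](card_imset _ (@perm_inj _ rho)); apply: eq_card => x; rewrite inE.
by rewrite -{2}(rK x) mem_imset ?(eqP (r _)) //; exact: perm_inj.
Qed.

(** The sign of a permutation is the parity of points minus cycles. There are [2 #|o|] points, and
    the [#|o|] points outside [o] are cycles by themselves, which the factor [(-1) ^ #|o|]
    compensates. *)
Lemma sgn_loopp_card o : sectT rho o -> sectT tau o ->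
  (-1) ^+ #|o| * (-1) ^+ loopp o = (-1) ^+ #|[set porbit (loopp o) x | x in o]| :> int.
Proof.
move=> r t; rewrite -[in LHS]signr_odd -signr_addb -[RHS]signr_odd; congr (_ ^+ nat_of_bool _).
have ro x : (rho x \in o) = (x \notin o) by have /forallP/(_ x)/eqP := r.
have to x : (tau x \in o) = (x \notin o) by have /forallP/(_ x)/eqP := t.
have fo x : x \notin o -> porbit (loopp o) x = [set x].
  move=> xo; apply/setP => y; rewrite inE; apply/porbitP/eqP => [[i ->]|->]; last by exists 0%N; rewrite perm1.
  by elim: i => [|i IH]; rewrite ?perm1 // expgSr permM IH looppE // (negbTE xo).
have oo x y : x \in o -> y \in porbit (loopp o) x -> y \in o.
  move=> xo /porbitP[i ->]; elim: i => [|i IH]; rewrite ?perm1 // expgSr permM looppE // IH.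
  by rewrite ro to IH.
rewrite /odd_perm (card_sectT r) odd_double /=.
have -> : #|porbits (loopp o)| = (#|[set porbit (loopp o) x | x in o]| + #|~: o|)%N.
  have -> : porbits (loopp o) = [set porbit (loopp o) x | x in o] :|: [set [set x] | x in ~: o].
    apply/setP => A; rewrite inE; apply/imsetP/orP => [[x _ ->]|[/imsetP[x _ ->]|/imsetP[x xo ->]]].
    - case: (boolP (x \in o)) => xo; first by left; exact: imset_f.
      by right; rewrite fo //; apply: imset_f; rewrite inE.
    - by exists x.
    - by exists x; rewrite // fo // -in_setC.
  rewrite cardsU (_ : _ :&: _ = set0) ?cards0 ?subn0; last first.
    apply/setP => A; rewrite !inE; apply/negP => /andP[/imsetP[x xo ->] /imsetP[y]].
    rewrite inE => yo e; have := porbit_id (loopp o) x; rewrite e inE => /eqP xy.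
    by rewrite -xy xo in yo.
  by congr (_ + _)%N; rewrite card_imset //; exact: set1_inj.
have -> : #|~: o| = #|o|.
  by have := cardsC o; rewrite (card_sectT r) -addnn => /eqP; rewrite eqn_add2l => /eqP.
by rewrite oddD addbCA addbb addbF.
Qed.

Lemma loop_count : exists c, (forall N, #|invk N| = (N ^ c)%N) /\
  \sum_(o | sectT rho o && sectT tau o) (-1) ^+ #|o| * (-1) ^+ loopp o = (-2) ^+ c :> int.
Proof.
have [o r t] := section_ex; exists #|[set porbit (loopp o) x | x in o]|; split.
  exact: card_invk.
have ce o' : sectT rho o' && sectT tau o' ->
    #|[set porbit (loopp o') x | x in o']| = #|[set porbit (loopp o) x | x in o]|.
  case/andP => r' t'; have := card_invk r' t' 2; rewrite (card_invk r t) => /eqP.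
  by rewrite eqn_exp2l // => /eqP.
under eq_bigr => o' ho' do rewrite (sgn_loopp_card (proj1 (andP ho')) (proj2 (andP ho'))) ce //.
rewrite sumr_const -[X in _ *+ X](_ : #|[set o' : {set H} | sectT rho o' && sectT tau o']| = _).
  by rewrite (card_sections r t) (card_invk r t) -[LHS]mulr_natl natrX -exprMn mulrN1.
by apply: eq_card => o'; rewrite inE.
Qed.

End Loops.
End Darts.

(** * Complete graph with p - 1 vertices *)

Lemma pp_fibers (R : comNzRingType) (T I : finType) (k : T -> I) (A : {set T}) (b : T -> T -> R) :
  {in A &, forall x y, k x != k y -> b x y = 1} ->
  pp A b = \prod_i pp [set x in A | k x == i] b.
Proof.
move=> h; rewrite /pp (partition_big k predT) //=; apply: eq_bigr => i _.
apply: eq_big => [x|x /andP[xA /eqP xi]]; first by rewrite inE.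
rewrite (bigID (fun y => k y == i)) /= [X in _ * X]big1 ?mulr1.
  by apply: eq_bigl => y; rewrite inE -!andbA; congr (_ && _); rewrite andbC.
by move=> y /andP[/andP[yA _] yi]; apply: h; rewrite // xi eq_sym.
Qed.

(** * From proper colourings to loops of darts *)

Section Bosonization.
Variable N : nat.
Hypothesis Nodd : odd N.
Local Notation V := 'I_N.+1.

Definition edge := {x : V * V | (x.1 < x.2)%N}.
(** An edge with a direction; [true] starts it at the larger endpoint. *)
Definition dart := (edge * bool)%type.
Implicit Types (h : dart) (t : {perm dart}) (f : {ffun 'I_N -> {perm V}}) (k : {ffun edge -> 'I_N}).

Definition src h : V := if h.2 then (val h.1).2 else (val h.1).1.

Lemma flip_inj : injective (fun h : dart => (h.1, ~~ h.2)).
Proof. by move=> [e b] [e' b'] [-> /negb_inj->]. Qed.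
Definition flip : {perm dart} := perm flip_inj.
Lemma flipE h : flip h = (h.1, ~~ h.2). Proof. by rewrite permE. Qed.
Lemma flipK : involutive flip. Proof. by case=> e b; rewrite !flipE /= negbK. Qed.

Definition dst h := src (flip h).

Lemma src_dst h : src h != dst h.
Proof.
case: h => [[[i j] /= ij] b]; rewrite /dst /src flipE /=.
by case: b => /=; apply: contraTneq ij => ->; rewrite ltnn.
Qed.

Lemma dart_inj h h' : src h = src h' -> dst h = dst h' -> h = h'.
Proof.
case: h => [[[i j] /= ij] b]; case: h' => [[[i' j'] /= ij'] b']; rewrite /dst /src !flipE /=.
case: b; case: b' => /= e1 e2; subst; try by exfalso; move: ij'; rewrite ltnNge (ltnW ij).
- by congr (_, _); apply: val_inj.
- by congr (_, _); apply: val_inj.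
Qed.

Lemma dart_ex i j : i != j -> exists h, src h = i /\ dst h = j.
Proof.
move=> ij; have [lt|gt|e] := ltngtP i j; last by rewrite (val_inj e) eqxx in ij.
- by exists (exist (fun x : V * V => (x.1 < x.2)%N) (i, j) lt, false); rewrite /dst /src !flipE.
- by exists (exist (fun x : V * V => (x.1 < x.2)%N) (j, i) gt, true); rewrite /dst /src !flipE.
Qed.

Lemma pmatch_flip : pmatch [set: dart] flip.
Proof.
apply/pmatchP; split=> [|[e b]]; first exact: flipK.
by rewrite flipE inE /= xpair_eqE eqxx /=; case: b.
Qed.

Definition ups : {set dart} := [set h | ~~ h.2].
Definition lowdarts : {set dart} := [set h | (src h < N.+1./2)%N].

Lemma sect_ups : sectT flip ups.
Proof. by apply/forallP => h; rewrite !inE flipE. Qed.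

Lemma rev_half (i : V) : (rev_ord i < N.+1./2)%N = ~~ (i < N.+1./2)%N.
Proof. by rewrite /=; have := ltn_ord i; have := odd_double_half N.+1; rewrite /= Nodd; lia. Qed.

Lemma rev_neq (i : V) : rev_ord i != i.
Proof. by apply/negP => /eqP e; have := rev_half i; rewrite e; case: (_ < _)%N. Qed.

Definition Trans : {set {perm dart}} :=
  [set t | pmatch [set: dart] t && [forall h, src (t h) == rev_ord (src h)]].

Lemma TransP t : reflect (involutive t /\ forall h, src (t h) = rev_ord (src h)) (t \in Trans).
Proof.
rewrite inE; apply: (iffP andP) => [[/pmatchP[tK _] /forallP h]|[tK h]].
  by split=> // x; apply/eqP.
split; last by apply/forallP => x; rewrite h.
apply/pmatchP; split=> // x; rewrite inE; apply/eqP => e.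
by have /eqP := h x; rewrite e eq_sym (negbTE (rev_neq _)).
Qed.

Lemma sect_half t : t \in Trans -> sectT t lowdarts.
Proof. by case/TransP => _ h; apply/forallP => x; rewrite !inE h rev_half. Qed.

(** The sign of [t] relative to [flip], each with a reference section; by [SgE] the tournament on
    the darts can be chosen at will. *)
Definition Sg t : int := Om flip ups (@sgr dart) * Om t lowdarts (@sgr dart).

Lemma SgE t s : t \in Trans -> tourn s -> Sg t = Om flip ups s * Om t lowdarts s.
Proof.
move=> tT ts; have [tK _] := TransP _ tT.
by apply: Om_pair_indep => //; [exact: flipK|exact: sect_ups|exact: sect_half|exact: tourn_sgr].
Qed.

Definition proper k := [forall h, forall h', (src h == src h') && (k h.1 == k h'.1) ==> (h == h')].
Definition comp k t := [forall h, k (t h).1 == k h.1].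

(** Sign reversal: conjugation by the transposition of two darts with the same source and colour
    preserves [Trans], the compatibility with [k] and the section [lowdarts], but changes [Sg]. *)
Lemma improper0 k : ~~ proper k -> \sum_(t in Trans | comp k t) Sg t = 0.
Proof.
case/forallPn => h1 /forallPn[h2]; rewrite negb_imply => /andP[/andP[/eqP es /eqP ek] ne].
pose g := tperm h1 h2.
have gs h : src (g h) = src h by rewrite /g; case: tpermP => // ->.
have gk h : k (g h).1 = k h.1 by rewrite /g; case: tpermP => // ->.
have gg h : g (g h) = h by rewrite /g tpermK.
have cj t : t \in Trans -> comp k t -> (t ^ g)%g \in Trans /\ comp k (t ^ g)%g.
  move=> /TransP[tK tr] /forallP tk; have e x : (t ^ g)%g x = g (t (g x)) by rewrite -{1}(gg x) permJ.
  split; first by apply/TransP; split=> x; rewrite !e ?gg ?tK ?gg // gs tr gs.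
  by apply/forallP => x; rewrite e gk (eqP (tk _)) gk.
have sgg t : ((t ^ g) ^ g)%g = t by rewrite -conjgM /g tperm2 conjg1.
set S := \sum_(_ in _ | _) _; suff : S = - S by lia.
rewrite {1}/S (reindex_inj (@conjg_inj _ g)) /= -sumrN; apply: eq_big => t.
  apply/andP/andP => [[h3 h4]|[h3 h4]]; last exact: cj.
  by have := cj _ h3 h4; rewrite sgg.
move=> /andP[h3 h4]; have [h5 _] := cj _ h3 h4; rewrite sgg in h5.
have [tK _] := TransP _ h5; have hB := sect_half h5.
rewrite /Sg Om_conj //; last exact: tourn_sgr.
  by rewrite odd_tperm ne /= mulN1r mulrN.
apply/setP => x; rewrite -{1}(gg x) mem_imset; last exact: perm_inj.
by rewrite !inE gs.
Qed.

Definition labelled f := injectiveb f && onef (f @: [set: 'I_N]).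

Lemma labelledP f : labelled f -> [/\ (forall c, pmatch [set: V] (f c)),
  (forall i j, i != j -> exists c, f c i = j) & (forall c c' i, f c i = f c' i -> c = c')].
Proof.
case/andP => /injectiveP fi hF; split=> [c|i j /(onef_ex hF)[_ /imsetP[c _ ->] e]|c c' i e].
- by apply: (onef_pmatch hF); exact: imset_f.
- by exists c.
- by apply: fi; apply: (onef_uniq hF _ _ e); exact: imset_f.
Qed.

Lemma N_gt0 : (0 < N)%N. Proof. by case: N Nodd. Qed.

Definition colour f : {ffun edge -> 'I_N} :=
  [ffun e => odflt (Ordinal N_gt0) [pick c | f c (val e).1 == (val e).2]].

Lemma colourE f c h : labelled f -> (colour f h.1 == c) = (f c (src h) == dst h).
Proof.
move=> /labelledP[fp fe fu].
have E e : f (colour f e) (val e).1 = (val e).2.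
  rewrite ffunE; case: pickP => [c' /eqP//|no].
  have [|c' hc] := fe (val e).1 (val e).2; last by have := no c'; rewrite hc eqxx.
  by case: e {no} => -[i j] /= ij; apply: contraTneq ij => ->; rewrite ltnn.
have E2 : f (colour f h.1) (src h) = dst h.
  case: h => e [|] /=; rewrite /dst flipE /src /=; last exact: E.
  by rewrite -(E e); have [->] := pmatchP _ _ (fp (colour f e)).
by apply/eqP/eqP => [<-//|e]; apply: (fu _ _ (src h)); rewrite E2 e.
Qed.

Lemma colour_proper f : labelled f -> proper (colour f).
Proof.
move=> hf; apply/forallP => h; apply/forallP => h'; apply/implyP => /andP[/eqP es].
rewrite colourE // es => /eqP e; apply/eqP; apply: dart_inj => //.
by rewrite -e; apply/eqP; rewrite -(colourE _ h' hf).
Qed.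

Lemma colour_inj : {in labelled &, injective colour}.
Proof.
move=> f f' hf hf' e; apply/ffunP => c; apply/permP => i.
have [fp _ _] := labelledP hf.
have : i != f c i by have [_ hn] := pmatchP _ _ (fp c); rewrite eq_sym hn inE.
case/dart_ex => h [hs hd]; have : colour f h.1 == c by rewrite colourE // hs hd.
by rewrite e colourE // hs hd => /eqP.
Qed.

(** The [N] darts at [i] have distinct colours, and there are just [N] colours. *)
Lemma proper_dart k i c : proper k -> exists h, src h = i /\ k h.1 = c.
Proof.
move=> kp; pose D := [set h | src h == i].
have cD : #|D| = N.
  rewrite -(@card_in_imset _ _ dst) => [|h h']; last first.
    by rewrite !inE => /eqP e /eqP e'; apply: dart_inj; rewrite e.
  have -> : dst @: D = [set~ i].
    apply/setP => j; rewrite !inE; apply/imsetP/idP => [[h]|].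
      by rewrite inE => /eqP <- ->; rewrite eq_sym src_dst.
    by rewrite eq_sym => /dart_ex[h [hs hd]]; exists h; rewrite // inE hs.
  by rewrite cardsC1 card_ord.
have : (fun h => k h.1) @: D = [set: 'I_N].
  apply/eqP; rewrite eqEcard subsetT cardsT card_ord card_in_imset ?cD ?leqnn // => h h'.
  rewrite !inE => /eqP e /eqP e' ek; apply/eqP.
  by move/forallP/(_ h)/forallP/(_ h')/implyP: kp; apply; rewrite e e' ek !eqxx.
move/setP/(_ c); rewrite inE => /imsetP[h]; rewrite inE => /eqP hs ->; by exists h.
Qed.

Lemma proper_colour k : proper k -> exists2 f, labelled f & k = colour f.
Proof.
move=> kp.
have kpE h h' : src h = src h' -> k h.1 = k h'.1 -> h = h'.
  move=> e e'; apply/eqP; move/forallP/(_ h)/forallP/(_ h')/implyP: kp; apply.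
  by rewrite e e' !eqxx.
have ex i c : exists h, (src h == i) && (k h.1 == c).
  by have [h [e1 e2]] := proper_dart i c kp; exists h; rewrite e1 e2 !eqxx.
pose dd i c := xchoose (ex i c).
have ddE i c : src (dd i c) = i /\ k (dd i c).1 = c.
  by have /andP[/eqP ? /eqP ?] := xchooseP (ex i c).
pose g c i := dst (dd i c).
have gE h : g (k h.1) (src h) = dst h.
  by rewrite /g; congr dst; apply: kpE; case: (ddE (src h) (k h.1)).
have gK c : involutive (g c).
  move=> i; have [e1 e2] := ddE i c.
  have kf : k (flip (dd i c)).1 = c by rewrite flipE.
  by have := gE (flip (dd i c)); rewrite kf /dst flipK e1.
pose f := [ffun c => perm (inv_inj (gK c))].
have fE c i : f c i = g c i by rewrite ffunE permE.
have fu c c' i : f c i = f c' i -> c = c'.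
  rewrite !fE /g => e; have [e1 e2] := ddE i c; have [e3 e4] := ddE i c'.
  by rewrite -e2 -e4; congr (k _.1); apply: dart_inj; rewrite // e1.
have hf : labelled f.
  apply/andP; split.
    apply/injectiveP => c c' e; apply: (fu _ _ ord0); by rewrite e.
  apply: onefP => [_ /imsetP[c _ ->]|i j /dart_ex[h [hs hd]]|i _ _ /imsetP[c _ ->] /imsetP[c' _ ->] /fu-> //].
    apply/pmatchP; split=> i; rewrite !fE ?gK // inE /g; apply/negbTE.
    by have [e1 _] := ddE i c; apply: contraNneq (src_dst (dd i c)) => e; rewrite e1 e.
  by exists (f (k h.1)); [exact: imset_f|rewrite fE -hs gE].
exists f => //; apply/ffunP => e; apply/esym/eqP.
by rewrite -[e]/(e, true).1 colourE // fE gE.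
Qed.

Lemma sum_labelled (s : V -> V -> int) : 
  \sum_(f | labelled f) \prod_c epsr s (f c) = N`!%:Z * cnt s.
Proof.
rewrite /cnt mulr_sumr (partition_big (fun f : {ffun 'I_N -> {perm V}} => f @: [set: 'I_N]) (@onef _)) /=; last first.
  by move=> f /andP[].
apply: eq_bigr => F hF.
have cF : #|F| = N by rewrite (card_onef hF) card_ord.
have sub f : labelled f && (f @: [set: 'I_N] == F) = (f \in [set f in ffun_on (mem F) | injectiveb f]).
  rewrite inE /labelled; apply/andP/andP => [[/andP[fi _] /eqP e]|[/ffun_onP fo fi]].
    by split=> //; apply/ffun_onP => c; rewrite -e imset_f.
  have e : f @: [set: 'I_N] = F.
    apply/eqP; rewrite eqEcard card_imset; last exact/injectiveP.
    rewrite cardsT card_ord cF leqnn andbT; apply/subsetP => _ /imsetP[c _ ->]; exact: fo.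
  by rewrite e eqxx fi hF.
rewrite (eq_bigr (fun _ => weight s F)).
  rewrite sumr_const -mulr_natl; congr (_ * _); rewrite natz; congr Posz.
  transitivity #|[set f in ffun_on (mem F) | injectiveb (f : {ffun 'I_N -> {perm V}})]|.
    by apply: eq_card => f; rewrite -sub.
  by rewrite card_inj_ffuns_on card_ord cF ffactnn.
move=> f /andP[/andP[/injectiveP fi _] /eqP <-].
rewrite /weight big_imset /=; last by move=> c c' _ _; exact: fi.
by apply: eq_bigl => c; rewrite inE.
Qed.

Lemma unique_trans f : labelled f -> exists2 t0, t0 \in Trans &
  forall t, (t \in Trans) && comp (colour f) t = (t == t0).
Proof.
move=> hf; have kp := colour_proper hf; set k := colour f in kp *.
have kpE h h' : src h = src h' -> k h.1 = k h'.1 -> h = h'.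
  move=> e e'; apply/eqP; move/forallP/(_ h)/forallP/(_ h')/implyP: kp; apply.
  by rewrite e e' !eqxx.
have ex h : exists h', (src h' == rev_ord (src h)) && (k h'.1 == k h.1).
  by have [h' [e1 e2]] := proper_dart (rev_ord (src h)) (k h.1) kp; exists h'; rewrite e1 e2 !eqxx.
pose g h := xchoose (ex h).
have gE h : src (g h) = rev_ord (src h) /\ k (g h).1 = k h.1.
  by have /andP[/eqP ? /eqP ?] := xchooseP (ex h).
have gK : involutive g.
  move=> h; have [e1 e2] := gE h; have [e3 e4] := gE (g h).
  by apply: kpE; rewrite ?e3 ?e4 ?e1 ?e2 ?rev_ordK.
pose t0 : {perm dart} := perm (inv_inj gK).
have t0E h : t0 h = g h by rewrite permE.
have t0T : t0 \in Trans.
  by apply/TransP; split=> h; rewrite !t0E ?gK //; case: (gE h).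
exists t0 => // t; apply/andP/eqP => [[/TransP[_ tr] /forallP tk]|->].
  apply/permP => h; rewrite t0E; have [e1 e2] := gE h.
  by apply: kpE; rewrite ?tr ?e1 // e2 (eqP (tk h)).
by split=> //; apply/forallP => h; rewrite t0E; case: (gE h) => _ ->.
Qed.

(** A proper colouring determines its compatible [t]: the dart at [i] goes to the dart of the same
    colour at [N - i]. The sign of this [t] is the product of the signs of the factors. *)
Lemma sum_comp f : labelled f ->
  \sum_(t in Trans | comp (colour f) t) Sg t = \prod_c epsr (@sgo _ V) (f c).
Proof.
move=> hf; have [t t0T ht] := unique_trans hf.
rewrite (eq_bigl _ _ ht) big_pred1_eq.
have : (t \in Trans) && comp (colour f) t by rewrite ht eqxx.
case/andP => _ /forallP tk; have [tK tr] := TransP _ t0T.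
have [fp _ _] := labelledP hf.
have kp := colour_proper hf; set k := colour f in kp tk.
have kpE h h' : src h = src h' -> k h.1 = k h'.1 -> h = h'.
  move=> e e'; apply/eqP; move/forallP/(_ h)/forallP/(_ h')/implyP: kp; apply.
  by rewrite e e' !eqxx.
have fk h : f (k h.1) (src h) = dst h by apply/eqP; rewrite -(colourE _ h hf).
(* Darts are compared by colour first and by source second, so that crossings occur only inside a
   colour. *)
pose s (x y : dart) : int :=
  if (k x.1 < k y.1)%N then 1 else if (k y.1 < k x.1)%N then -1 else sgo (src x) (src y).
have [ga g1] := @tourn_sgo _ V.
have sE x y : k x.1 = k y.1 -> s x y = sgo (src x) (src y) by move=> e; rewrite /s e ltnn.
have ts : tourn s.
  split=> x y; first by rewrite /s; case: ltngtP; rewrite ?opprK.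
  move=> xy; rewrite /s; case: ltngtP => // e; apply: g1.
  by apply: contraNneq xy => e'; apply/eqP; apply: kpE => //; exact: val_inj.
have mono mu (x y : dart) : (forall h, k (mu h).1 = k h.1) -> k x.1 != k y.1 -> crs s mu x y = 1.
  move=> hm xy; rewrite /crs /s !hm; case: ltngtP => //.
  by move=> /ord_inj e; rewrite e eqxx in xy.
have kf h : k (flip h).1 = k h.1 by rewrite flipE.
have kt h : k (t h).1 = k h.1 by apply/eqP.
rewrite (SgE t0T ts) /Om.
have -> : \prod_(x in ups) s x (flip x) = 1.
  apply: big1 => -[[[i j] /= ij] b]; rewrite inE /= => /negbTE ->.
  by rewrite sE ?kf // /src flipE /sgo /= ltEord /= ij.
have -> : \prod_(x in lowdarts) s x (t x) = 1.
  apply: big1 => h; rewrite inE => lt; rewrite sE ?kt // tr /sgo ltEord.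
  have rx := rev_half (src h); rewrite lt in rx.
  by rewrite (_ : (src h < rev_ord (src h))%N) //; move: rx lt; lia.
rewrite !mul1r (pp_fibers (k := fun h => k h.1)); last by move=> x y _ _; exact: mono.
rewrite (pp_fibers (k := fun h => k h.1) (A := lowdarts)); last by move=> x y _ _; exact: mono.
(* Inside one colour [t] joins [i] with [N - i]; such edges are nested and do not cross. *)
rewrite [X in _ * X]big1 ?mulr1; last first.
  move=> c _; rewrite -[RHS](pp1 _ [set x in lowdarts | k x.1 == c]).
  apply: eq_pp => x y; rewrite !inE => /andP[xh /eqP xc] /andP[yh /eqP yc] xy.
  rewrite /crs !sE ?kt ?xc ?yc // !tr.
  have ne : src x != src y by apply: contraNneq xy => e; apply/eqP; apply: kpE; rewrite ?xc ?yc.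
  have rx := rev_half (src x); have ry := rev_half (src y); rewrite xh in rx; rewrite yh in ry.
  have -> : sgo (src x) (rev_ord (src y)) = 1.
    by rewrite /sgo ltEord (_ : (src x < rev_ord (src y))%N) //; move: ry xh; lia.
  have -> : sgo (rev_ord (src x)) (src y) = -1.
    by rewrite ga /sgo ltEord (_ : (src y < rev_ord (src x))%N) //; move: rx yh; lia.
  have -> : sgo (rev_ord (src x)) (rev_ord (src y)) = - sgo (src x) (src y).
    have rlt (a b : V) : (rev_ord a < rev_ord b)%N = (b < a)%N.
      by rewrite /=; have := ltn_ord a; have := ltn_ord b; lia.
    rewrite /sgo !ltEord !rlt; by case: ltngtP.
  transitivity (sgo (src x) (src y) * sgo (src x) (src y)); last exact: g1.
  ring.
apply: eq_bigr => c _; have [fK _] := pmatchP _ _ (fp c).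
rewrite (epsr_sect ga (fp c) (sect_lows (fp c))).
have -> : lows (f c) = src @: [set x in ups | k x.1 == c].
  apply/setP => i; rewrite inE; apply/idP/imsetP => [lt|[h]].
    have /dart_ex[h [hs hd]] : i != f c i by rewrite lt_eqF.
    have hc : k h.1 = c by apply/eqP; rewrite colourE // hs hd.
    exists h => //; rewrite !inE hc eqxx andbT; move: lt; rewrite -hd -hs.
    case: h {hs hd hc} => -[[a b] /= ab] [|] //=; rewrite /dst flipE /src /= ltEord /=.
    by rewrite ltnNge ltnW.
  rewrite !inE => /andP[hu /eqP <-] ->; rewrite fk.
  by case: h hu => -[[a b] /= ab] [|] //= _; rewrite /dst flipE /src /= ltEord.
rewrite pp_imset.
- apply: eq_pp => x y; rewrite !inE => /andP[_ /eqP xc] /andP[_ /eqP yc] _.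
  have fx : f c (src x) = dst x by rewrite -xc fk.
  have fy : f c (src y) = dst y by rewrite -yc fk.
  by rewrite /crs !sE ?kf ?xc ?yc // fx fy.
- move=> x y; rewrite !inE => /andP[_ /eqP xc] /andP[_ /eqP yc] e; apply: kpE => //.
  by rewrite xc yc.
- by move=> x y _ _; exact: crs_sym.
Qed.

(** By [improper0] the sum over proper colourings extends to all colourings; after exchanging the
    sums, the colourings compatible with a fixed [t] are merely counted. *)
Lemma sum_Trans : N`!%:Z * signed_count N.+1 =
  \sum_(t in Trans) Sg t * #|[set k | comp k t]|%:Z.
Proof.
rewrite signed_countE // -sum_labelled.
transitivity (\sum_(k | proper k) \sum_(t in Trans | comp k t) Sg t).
  pose L := [set f | labelled f].
  have -> : \sum_(f | labelled f) \prod_c epsr (@sgo _ V) (f c)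
      = \sum_(f in L) \sum_(t in Trans | comp (colour f) t) Sg t.
    by apply: eq_big => f; [rewrite inE|move=> hf; rewrite sum_comp].
  rewrite -(big_imset (fun k => \sum_(t in Trans | comp k t) Sg t)) /=; last first.
    by move=> f f'; rewrite !inE; exact: colour_inj.
  apply: eq_bigl => k; apply/imsetP/idP => [[f]|/proper_colour[f hf ->]].
    by rewrite inE => /colour_proper h ->.
  by exists f; rewrite ?inE.
transitivity (\sum_k \sum_(t in Trans | comp k t) Sg t).
  rewrite [RHS](bigID proper) /= [X in _ + X]big1 ?addr0 // => k; exact: improper0.
rewrite (exchange_big_dep (mem Trans)) /=; last by move=> k t _ /andP[].
apply: eq_bigr => t tT; rewrite (eq_bigl (mem [set k | comp k t])).
  by rewrite sumr_const -mulr_natr natz.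
by move=> k; rewrite /= tT inE.
Qed.

Lemma card_comp t : t \in Trans -> #|[set k | comp k t]| = #|invk flip t N|.
Proof.
move=> tT.
pose up (k : {ffun edge -> 'I_N}) : {ffun dart -> 'I_N} := [ffun h => k h.1].
have upi : injective up.
  by move=> k k' /ffunP e; apply/ffunP => x; have := e (x, true); rewrite !ffunE.
rewrite -(card_imset _ upi); apply: eq_card => k; rewrite [RHS]inE.
apply/imsetP/forallP => [[k' hk ->] h|hk].
  by rewrite !ffunE flipE eqxx /=; rewrite inE in hk; exact: (forallP hk).
have kf h : k (flip h) = k h by case/andP: (hk h) => /eqP.
have kE h : k (h.1, true) = k h.
  by case: h => e [|] //=; rewrite -[RHS]kf flipE.
exists [ffun e => k (e, true)]; last by apply/ffunP => h; rewrite !ffunE kE.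
rewrite inE; apply/forallP => h; rewrite !ffunE !kE.
by case/andP: (hk h).
Qed.

(* [N] is congruent to [-2], and a sum over [-2] colours of the loops of [flip] and [t] is,
   up to sign, a sum over the orientations of these loops. *)
Lemma bosonization : (N`!%:Z * signed_count N.+1 =
  \sum_(o : {set dart} | sectT flip o) (-1) ^+ (#|o| + #|ups :\: o| + #|lowdarts :\: o|) *
     #|[set t in Trans | sectT t o]|%:Z %[mod N.+2])%Z.
Proof.
rewrite sum_Trans.
have -> : \sum_(o : {set dart} | sectT flip o) (-1) ^+ (#|o| + #|ups :\: o| + #|lowdarts :\: o|) *
     #|[set t in Trans | sectT t o]|%:Z =
  \sum_(t in Trans) Sg t * \sum_(o | sectT flip o && sectT t o) (-1) ^+ #|o| * (-1) ^+ loopp flip t o.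
  under [RHS]eq_bigr => t _ do rewrite mulr_sumr.
  rewrite (exchange_big_dep (sectT flip)) /=; last by move=> t o _ /andP[].
  apply: eq_bigr => o ro; rewrite -natz mulr_natr -sumr_const.
  apply: eq_big => [t|t]; first by rewrite inE ro.
  rewrite inE => /andP[tT to]; have [tK _] := TransP _ tT.
  have tP : pmatch [set: dart] t by move: tT; rewrite inE => /andP[].
  have ts := tourn_sgr dart; have [sa _] := ts.
  (* The sign of the loop permutation is expressed by sections [o] for both matchings; [Om_flip]
     then replaces them by [ups] and [lowdarts]. *)
  rewrite -(sgn_loopp pmatch_flip tP ro to ts).
  rewrite (Om_flip flipK sect_ups ro sa) (Om_flip tK (sect_half tT) to sa).
  rewrite !exprD /Sg; set x := Om flip _ _; set y := Om t _ _.
  have x2 : x * x = 1 := Om_sq flipK sect_ups ts.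
  have y2 : y * y = 1 := Om_sq tK (sect_half tT) ts.
  set a := _ ^+ #|o|; set b := _ ^+ _; set c := _ ^+ _.
  transitivity (a * b * c * (x * x) * (y * y)); first by rewrite x2 y2 !mulr1.
  by clearbody x y a b c; ring.
apply/eqP; rewrite eqz_mod_dvd -sumrB; apply: rpred_sum => t tT.
have tP : pmatch [set: dart] t by move: tT; rewrite inE => /andP[].
have [c [hc ->]] := loop_count pmatch_flip tP.
(* The difference [N ^ c - (-2) ^ c] is divisible by [N + 2]. *)
rewrite -mulrBr dvdz_mull // card_comp // hc -natz natrX natz subrXX dvdz_mulr //.
by rewrite opprK -PoszD addn2.
Qed.

End Bosonization.

(** Such a permutation is a product of independent permutations of the fibres of [q] in [D]; the
    induction splits off one fibre at a time. *)
Lemma card_fiber_perms (T I : finType) (q : T -> I) (D : {set T}) :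
  #|[set a : {perm T} | perm_on D a && [forall x, q (a x) == q x]]|
  = (\prod_i #|[set x in D | q x == i]|`!)%N.
Proof.
pose K (r : seq I) := [set a : {perm T} |
  perm_on [set x in D | q x \in r] a && [forall x, q (a x) == q x]].
suff h r : uniq r -> #|K r| = (\prod_(i <- r) #|[set x in D | q x == i]|`!)%N.
  rewrite -(h _ (index_enum_uniq I)); apply: eq_card => a; rewrite !inE.
  congr (perm_on _ a && _).
  by apply/setP => x; rewrite inE mem_index_enum andbT.
elim: r => [_|i r IH /= /andP[ir ur]].
  rewrite big_nil -[RHS](cards1 (1%g : {perm T})); apply: eq_card => a; rewrite !inE.
  apply/andP/eqP => [[ha _]|->].
    apply: (perm_on_id ha); rewrite (_ : [set _ in _ | _] = set0) ?cards0 //.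
    by apply/setP => x; rewrite !inE andbF.
  split; first exact: perm_on1.
  by apply/forallP => x; rewrite perm1.
rewrite big_cons -(IH ur).
set P := [set x in D | q x == i].
have -> : #|P|`! = #|[set a : {perm T} | perm_on P a]| by rewrite -(card_perm P); apply: eq_card => a; rewrite inE.
rewrite -cardsX.
pose m (u : {perm T} * {perm T}) := (u.1 * u.2)%g.
have notP x : x \in P -> x \notin [set x in D | q x \in r].
  by rewrite !inE => /andP[_ /eqP ->]; rewrite (negbTE ir) andbF.
rewrite -(@card_in_imset _ _ m); last first.
  move=> [a b] [a' b']; rewrite !in_setX /= !inE => /andP[ha /andP[hb _]] /andP[ha' /andP[hb' _]] e.
  have aa : a = a'.
    apply/permP => x; have [xP|xP] := boolP (x \in P); last by rewrite !(out_perm _ xP).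
    have := congr1 (fun g : {perm T} => g x) e; rewrite !permM.
    by rewrite (out_perm hb) ?(out_perm hb') //; apply: notP; rewrite perm_closed.
  by move: e; rewrite aa /m /= => /mulgI ->.
apply: eq_card => c; apply/idP/imsetP => [|[[a b]]]; last first.
  rewrite in_setX !inE /= => /andP[ha /andP[hb /forallP qb]] ->; apply/andP; split.
    apply: perm_onM.
      by apply: subset_trans ha _; apply/subsetP => x; rewrite !inE => /andP[-> ->].
    by apply: subset_trans hb _; apply/subsetP => x; rewrite !inE => /andP[-> ->]; rewrite orbT.
  apply/forallP => x; rewrite permM (eqP (qb _)).
  have [xP|xP] := boolP (x \in P); last by rewrite (out_perm ha).
  have : a x \in P by rewrite perm_closed.
  by move: xP; rewrite !inE => /andP[_ /eqP->] /andP[_ /eqP->].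
rewrite inE => /andP[hc /forallP qc].
have cP x : (c x \in P) = (x \in P).
  rewrite !inE (eqP (qc x)); case: (eqVneq (q x) i) => xi; rewrite ?andbF // !andbT.
  have [h|h] := boolP (x \in [set x in D | q x \in i :: r]); last by rewrite (out_perm hc).
  have h' : c x \in [set x in D | q x \in i :: r] by rewrite perm_closed.
  by move: h h'; rewrite !inE => /andP[-> _] /andP[-> _].
have cN : c \in 'N(P | 'P)%g by apply/astabsP => x; rewrite /= /aperm cP.
pose a := restr_perm P c; have ha : perm_on P a := restr_perm_on P c.
have aE x : x \in P -> a x = c x by move=> xP; rewrite restr_permE.
have haV := perm_onV ha.
exists (a, (a^-1 * c)%g); last by rewrite /m /= mulKVg.
rewrite in_setX !inE /= ha /=.
have bE x : x \in P -> (a^-1 * c)%g x = x.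
  by move=> xP; rewrite permM -aE ?permKV // perm_closed.
have bE' x : x \notin P -> (a^-1 * c)%g x = c x by move=> xP; rewrite permM (out_perm haV xP).
apply/andP; split.
  apply/subsetP => x; rewrite inE; apply: contraR => xr.
  have [xP|xP] := boolP (x \in P); first by rewrite bE.
  rewrite bE' // (out_perm hc) //; apply: contra xr; move: xP; rewrite !inE.
  by case: (x \in D) => //= /negbTE ->.
apply/forallP => x; have [xP|xP] := boolP (x \in P); first by rewrite bE.
by rewrite bE'.
Qed.

(** * Dart matchings compatible with a tournament *)

Section CountTrans.
Variable N : nat.
Hypothesis Nodd : odd N.
Local Notation V := 'I_N.+1.
Implicit Types (h : dart N) (o : {set dart N}).

(** When [o] is a section of [flip], it is a tournament on the vertices and this is the number of
    arcs leaving [i]. *)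
Definition score o (i : V) := #|[set h in o | src h == i]|.

Lemma card_src (i : V) : #|[set h : dart N | src h == i]| = N.
Proof.
rewrite -(@card_in_imset _ _ (@dst N)) => [|h h']; last first.
  by rewrite !inE => /eqP e /eqP e'; apply: dart_inj; rewrite e.
have -> : (@dst N) @: [set h | src h == i] = [set~ i].
  apply/setP => j; rewrite !inE; apply/imsetP/idP => [[h]|].
    by rewrite inE => /eqP <- ->; rewrite eq_sym src_dst.
  by rewrite eq_sym => /dart_ex[h [hs hd]]; exists h; rewrite // inE hs.
by rewrite cardsC1 card_ord.
Qed.

Lemma card_cosrc o (i : V) : (score o i + #|[set h in ~: o | src h == i]|)%N = N.
Proof.
rewrite -[RHS](card_src i) -[RHS](cardsID o); congr (_ + _)%N; apply: eq_card => h.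
  by rewrite !inE andbC.
by rewrite !inE.
Qed.

(** [t] carries the darts of [o] at [i] onto the darts outside [o] at [N - i], of which there are
    [N - score o (N - i)]. *)
Lemma score_trans o t : t \in Trans N -> sectT t o ->
  forall i, (score o i + score o (rev_ord i))%N = N.
Proof.
move=> /(TransP Nodd)[tK tr] /forallP to i; rewrite -[RHS](card_cosrc o (rev_ord i)) addnC.
congr (_ + _)%N; rewrite -[LHS](card_imset _ (@perm_inj _ t)); apply: eq_card => h.
rewrite -{1}(tK h) mem_imset; last exact: perm_inj.
by rewrite !inE (eqP (to h)) tr (can2_eq (@rev_ordK _) (@rev_ordK _)).
Qed.

Lemma trans_ex o : (forall i, (score o i + score o (rev_ord i))%N = N) ->
  exists2 t, t \in Trans N & sectT t o.
Proof.
move=> sc.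
pose cl h := [set h' | ((h' \in o) == (h \in o)) && (src h' == src h)].
pose op h := [set h' | ((h' \in o) != (h \in o)) && (src h' == rev_ord (src h))].
have co h : #|cl h| = #|op h|.
  have e1 (i : V) : #|[set h' | (h' \in o) && (src h' == i)]| = score o i.
    by apply: eq_card => h'; rewrite !inE.
  have e2 (i : V) : #|[set h' | (h' \notin o) && (src h' == i)]| = (N - score o i)%N.
    have <- : #|[set h in ~: o | src h == i]| = #|[set h' | (h' \notin o) && (src h' == i)]|.
      by apply: eq_card => h'; rewrite !inE.
    by have := card_cosrc o i; lia.
  have := sc (src h); rewrite /cl /op; case: (h \in o) => e.
    transitivity (score o (src h)); first by rewrite -e1; apply: eq_card => h'; rewrite !inE eqb_id.
    transitivity (N - score o (rev_ord (src h)))%N; first by move: e; lia.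
    by rewrite -e2; apply: eq_card => h'; rewrite !inE eqb_id.
  transitivity (N - score o (src h))%N; first by rewrite -e2; apply: eq_card => h'; rewrite !inE eqbF_neg.
  transitivity (score o (rev_ord (src h))); first by move: e; lia.
  by rewrite -e1; apply: eq_card => h'; rewrite !inE eqbF_neg negbK.
(* The k-th dart of the class [cl h] is matched with the k-th dart of the opposite class [op h]. The
   classes trade roles at [g h], so [g] is an involution. *)
pose g h := nth h (enum (op h)) (index h (enum (cl h))).
have inc h : h \in cl h by rewrite inE !eqxx.
have il h : (index h (enum (cl h)) < size (enum (op h)))%N.
  by rewrite -cardE -co cardE index_mem mem_enum.
have go h : g h \in op h by rewrite -mem_enum; apply: mem_nth.
have g1 h : (g h \in o) = (h \notin o).
  by have := go h; rewrite inE => /andP[+ _]; case: (_ \in _); case: (_ \in _).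
have g2 h : src (g h) = rev_ord (src h) by have := go h; rewrite inE => /andP[_ /eqP].
have clg h : cl (g h) = op h.
  apply/setP => h'; rewrite !inE g1 g2; congr (_ && _).
  by case: (_ \in _); case: (_ \in _).
have opg h : op (g h) = cl h.
  apply/setP => h'; rewrite !inE g1 g2 rev_ordK; congr (_ && _).
  by case: (_ \in _); case: (_ \in _).
have gK : involutive g.
  move=> h; rewrite {1}/g clg opg {2}/g index_uniq ?enum_uniq //.
  by rewrite (set_nth_default h) ?nth_index ?mem_enum // index_mem mem_enum.
exists (perm (inv_inj gK)); last by apply/forallP => h; rewrite permE g1.
by apply/(TransP Nodd); split=> h; rewrite !permE ?gK.
Qed.

(** Relative to one solution [t0], the permutation [loopp t0 t o] determines [t] and runs through
    all permutations of [o] preserving sources. *)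
Lemma card_trans o : #|[set t in Trans N | sectT t o]| =
  if [forall i, score o i + score o (rev_ord i) == N] then (\prod_i (score o i)`!)%N else 0%N.
Proof.
case: ifP => [/forallP sc|/negP sc]; last first.
  apply/eqP; rewrite cards_eq0; apply/eqP/setP => t; rewrite in_set0; apply/negP; rewrite in_set => /andP[tT to].
  by apply: sc; apply/forallP => i; apply/eqP; exact: score_trans tT to i.
have [t0 t0T t0o] := trans_ex (fun i => eqP (sc i)).
have [t0K t0r] := TransP Nodd _ t0T.
have t0E h : (t0 h \in o) = (h \notin o) by have /forallP/(_ h)/eqP := t0o.
transitivity #|[set a : {perm dart N} | perm_on o a && [forall h, src (a h) == src h]]|; last first.
  exact: card_fiber_perms.
rewrite -[LHS](@card_in_imset _ _ (fun t => loopp t0 t o)); last first.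
  move=> t t'; rewrite in_set => /andP[h1 to]; rewrite in_set => /andP[h2 to'] e.
  have [tK tr] := TransP Nodd _ h1; have [tK' tr'] := TransP Nodd _ h2.
  have eo h : h \in o -> t h = t' h.
    move=> ho; have e1 : loopp t0 t o h = loopp t0 t' o h by rewrite e.
    have e2 := looppE t0o to h; have e3 := looppE t0o to' h; rewrite ho in e2 e3.
    by apply: (@perm_inj _ t0); exact: etrans (esym e2) (etrans e1 e3).
  apply/permP => h; have [/eo//|ho] := boolP (h \in o).
  have tho : t h \in o by rewrite (eqP (forallP to h)).
  by apply: (@perm_inj _ t'); rewrite tK' -eo.
apply: eq_card => a; apply/imsetP/idP => [[t]|].
  move=> /setIdP[tT to] ->; have [tK tr] := TransP Nodd _ tT.
  rewrite inE; apply/andP; split.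
    by apply/subsetP => h; rewrite inE (looppE t0o to); case: ifP => //; rewrite eqxx.
  by apply/forallP => h; rewrite (looppE t0o to); case: ifP => // _; rewrite t0r tr rev_ordK.
rewrite inE => /andP[ao /forallP as_].
have asV h : src (a^-1%g h) = src h by rewrite -(eqP (as_ _)) permKV.
have aoV := perm_onV ao.
pose g h := if h \in o then t0 (a h) else a^-1%g (t0 h).
have go h : (g h \in o) = (h \notin o).
  rewrite /g; case: ifP => ho; first by rewrite t0E (perm_closed h ao) ho.
  by rewrite (perm_closed (t0 h) aoV) t0E ho.
have gK : involutive g.
  move=> h; rewrite {1}/g go /g; case: (boolP (h \in o)) => ho /=; first by rewrite t0K permK.
  by rewrite permKV t0K.
have gs h : src (g h) = rev_ord (src h).
  by rewrite /g; case: ifP => _; rewrite ?asV t0r // (eqP (as_ _)).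
have gT : perm (inv_inj gK) \in Trans N by apply/(TransP Nodd); split=> h; rewrite !permE.
have gso : sectT (perm (inv_inj gK)) o by apply/forallP => h; rewrite permE go.
exists (perm (inv_inj gK)); first by rewrite in_set gT.
apply/permP => h; rewrite (looppE t0o gso h); case: (boolP (h \in o)) => ho.
  by rewrite permE /g ho t0K.
by rewrite (out_perm ao ho).
Qed.

End CountTrans.

Lemma perm_rev_section (T : finType) (mu : {perm T}) (A B : {set T}) (phi : T -> int) :
  involutive mu -> sectT mu A -> sectT mu B -> (forall x, phi (mu x) = phi x) ->
  \prod_(x in A) phi x = \prod_(x in B) phi x.
Proof.
move=> muK sA sB hp.
have e (C : {set T}) : \prod_(x in C) phi x = \prod_(x in [set: T]) (if x \in C then phi x else 1).
  by rewrite big_mkcond; apply: eq_bigl => x; rewrite inE.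
rewrite (e B) (prod_sect _ muK (sectTP _ _ sA)); apply: eq_bigr => x _.
by rewrite (eqP (forallP sB x)) hp; case: (x \in B); rewrite ?mulr1 ?mul1r.
Qed.

(** * Signed sums over tournaments *)

Section TournamentSum.
Variable N : nat.
Local Notation V := 'I_N.+1.

Lemma prod_edge (R : comNzRingType) (F : V -> V -> R) :
  \prod_(e : edge N) F (val e).1 (val e).2 = \prod_(i : V) \prod_(j : V | (i < j)%N) F i j.
Proof.
rewrite pair_big_dep /= (eq_bigl (fun x => x \in val @: [set: edge N])).
  rewrite big_imset /=; last by move=> e e' _ _; exact: val_inj.
  by apply: eq_bigl => e; rewrite inE.
move=> x; apply/idP/imsetP => [xx|[[y yy] _ ->] //].
by exists (exist (fun x : V * V => (x.1 < x.2)%N) x xx); rewrite ?inE.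
Qed.

Definition osec (f : {ffun edge N -> bool}) : {set dart N} := [set h | f h.1 == h.2].

Lemma osecE f : osec f = [set (e, f e) | e : edge N].
Proof.
apply/setP => -[e b]; rewrite inE /=; apply/eqP/imsetP => [<-|[e' _ [-> ->]] //].
by exists e.
Qed.

Lemma score_osec (f : {ffun edge N -> bool}) i : (\sum_(e : edge N) U_(src (e, f e)))%MM i = score (osec f) i.
Proof.
have gi : injective (fun e : edge N => (e, f e)) by move=> e e' [].
rewrite mnm_sumE /score.
have -> : [set h in osec f | src h == i] = [set (e, f e) | e in [set e | src (e, f e) == i]].
  apply/setP => h; rewrite inE osecE; apply/andP/imsetP => [[/imsetP[e _ ->] he]|[e]].
    by exists e; rewrite ?inE.
  by rewrite inE => he ->; split=> //; apply: imset_f.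
rewrite card_imset // -sum1_card [RHS]big_mkcond; apply: eq_bigr => e _.
by rewrite mnm1E inE; case: (_ == i).
Qed.

Lemma score_le (o : {set dart N}) i : (score o i <= N)%N.
Proof. by have := card_cosrc o i; lia. Qed.

(** The product of all [X_i - X_j] with [i < j] is expanded twice: over tournaments, whose monomials
    carry the scores as exponents, and as a Vandermonde determinant, where only permutations of
    [0, ..., N] survive. *)
Lemma tournament_sum (G : 'X_{1..N.+1} -> int) :
  \sum_(f : {ffun edge N -> bool})
     (-1) ^+ #|[set e | f e]| * G (\sum_(e : edge N) U_(src (e, f e)))%MM
  = (-1) ^+ #|{: edge N}| * \sum_(s : {perm V}) (-1) ^+ s * G [multinom (s i : nat) | i < N.+1].
Proof.
pose M (q : {ffun V -> V}) : 'X_{1..N.+1} := [multinom (q i : nat) | i < N.+1].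
have Mi : injective M.
  move=> q q' /mnmP e; apply/ffunP => i; apply: val_inj; have := e i; by rewrite !mnmE.
(* Linear functional sending the monomial with exponents [m] to [G m], for exponents at most [N];
   scores satisfy this bound. *)
pose L (p : {mpoly int[N.+1]}) := \sum_q p@_(M q) * G (M q).
have LX c (m : 'X_{1..N.+1}) : (forall i, m i <= N)%N -> L (c *: 'X_[m]) = c * G m.
  move=> hm; have [q eq_] : exists q, m = M q.
    exists [ffun i => inord (m i)]; apply/mnmP => i; rewrite mnmE ffunE inordK //.
    by rewrite ltnS.
  rewrite /L (bigD1 q) //= big1 ?addr0; first by rewrite mcoeffZ mcoeffX eq_ eqxx mulr1.
  move=> q' ne; rewrite mcoeffZ mcoeffX eq_ (inj_eq Mi) eq_sym (negbTE ne) mulr0 mul0r //.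
have Ls I (r : seq I) P (F : I -> {mpoly int[N.+1]}) :
    L (\sum_(i <- r | P i) F i) = \sum_(i <- r | P i) L (F i).
  rewrite /L exchange_big; apply: eq_bigr => q _.
  by rewrite -mulr_suml; congr (_ * _); rewrite raddf_sum.
pose p : {mpoly int[N.+1]} := \prod_(e : edge N) ('X_((val e).1) - 'X_((val e).2)).
have e1 : p = \sum_(f : {ffun edge N -> bool})
     ((-1) ^+ #|[set e | f e]|) *: 'X_[\sum_(e : edge N) U_(src (e, f e))].
  pose F (e : edge N) (b : bool) : {mpoly int[N.+1]} := (-1) ^+ b *: 'X_(src (e, b)).
  rewrite /p (eq_bigr (fun e => \sum_b F e b)) => [|e _]; last first.
    by rewrite big_bool /F /src /= scale1r scaleN1r addrC.
  rewrite bigA_distr_bigA /=; apply: eq_bigr => f _.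
  rewrite scaler_prod -mprodXE; congr (_ *: _).
  rewrite -prodr_const [RHS]big_mkcond /=; apply: eq_bigr => e _.
  by rewrite inE; case: (f e).
pose S (s : {perm V}) : 'X_{1..N.+1} := [multinom (s i : nat) | i < N.+1].
have e2 : p = \sum_(s : {perm V}) ((-1) ^+ #|{: edge N}| * (-1) ^+ s) *: 'X_[S s].
  pose a : 'rV[{mpoly int[N.+1]}]_N.+1 := \row_i 'X_i.
  have -> : p = (-1) ^+ #|{: edge N}| * \det (Vandermonde N.+1 a).
    rewrite det_Vandermonde -(prod_edge (fun i j => a 0 j - a 0 i)).
    have -> : (-1) ^+ #|{: edge N}| = \prod_(e : edge N) (-1) :> {mpoly int[N.+1]}.
      by rewrite prodr_const.
    rewrite /p -big_split /=.
    by apply: eq_bigr => e _; rewrite !mxE mulN1r opprB.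
  rewrite /determinant mulr_sumr (reindex_inj invg_inj) /=; apply: eq_bigr => s _.
  have -> : \prod_i Vandermonde N.+1 a i (s^-1%g i) = 'X_[S s].
    rewrite (mpolyXE _ (s^-1)%g); apply: eq_bigr => i _.
    by rewrite !mxE mnmE permKV.
  rewrite -scalerA odd_permV scaler_sign -[in RHS]signr_odd scaler_sign -[in LHS]signr_odd.
  by rewrite !mulr_sign.
have := congr1 L (etrans (esym e1) e2); rewrite !Ls mulr_sumr => e3.
transitivity (\sum_(f : {ffun edge N -> bool}) L ((-1) ^+ #|[set e | f e]| *: 'X_[\sum_(e : edge N) U_(src (e, f e))])).
  by apply: eq_bigr => f _; rewrite LX // => i; rewrite score_osec score_le.
rewrite e3; apply: eq_bigr => s _; rewrite LX ?mulrA // => i.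
by rewrite mnmE -ltnS.
Qed.

Lemma sum_osec (F : {set dart N} -> int) :
  \sum_(o | sectT (flip N) o) F o = \sum_(f : {ffun edge N -> bool}) F (osec f).
Proof.
rewrite (reindex osec); last first.
  exists (fun o : {set dart N} => [ffun e : edge N => (e, true) \in o]) => [f _|o].
    by apply/ffunP => e; rewrite ffunE inE /= eqb_id.
  move=> /forallP so; apply/setP => -[e b]; rewrite inE ffunE /=.
  case: b; first by case: (_ \in o).
  by have := so (e, true); rewrite flipE /= => /eqP ->; case: ((e, true) \in o).
apply: eq_bigl => f; apply/forallP => h; rewrite !inE flipE /=.
by case: h.2; case: (f _).
Qed.

Lemma card_osec (f : {ffun edge N -> bool}) : #|osec f| = #|{: edge N}|.
Proof. by rewrite osecE card_imset // => e e' []. Qed.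

Lemma card_ups_osec (f : {ffun edge N -> bool}) : #|ups N :\: osec f| = #|[set e | f e]|.
Proof.
have gi : injective (fun e : edge N => (e, false)) by move=> e e' [].
rewrite -[RHS](card_imset _ gi); apply: eq_card => -[e b].
rewrite !inE /=; apply/andP/imsetP => [[fe /negbTE bf]|[e' fe' [-> ->]]].
  by rewrite bf in fe *; exists e; rewrite // inE; case: (f e) fe.
by rewrite inE in fe'; rewrite fe'.
Qed.

Hypothesis Nodd : odd N.

Lemma card_half_osec (o : {set dart N}) : (forall i, score o i + score o (rev_ord i) = N)%N ->
  #|lowdarts N :\: o| = (\sum_(i : V | (i < N.+1./2)%N) score o (rev_ord i))%N.
Proof.
move=> sc; rewrite -sum1_card (partition_big (@src N) (fun i => (i < N.+1./2)%N)) /=; last first.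
  by move=> h; rewrite !inE => /andP[].
apply: eq_bigr => i ih; transitivity #|[set h in ~: o | src h == i]|; last first.
  by have := card_cosrc o i; have := sc i; lia.
rewrite sum1_card; apply: eq_card => h.
rewrite -[LHS]/((h \in lowdarts N :\: o) && (src h == i)) !inE.
by case: (eqVneq (src h) i) => [->|]; rewrite ?andbF // ih !andbT.
Qed.

End TournamentSum.

Section Hyperoctahedral.
Variables (T : finType) (mu : {perm T}) (A : {set T}).
Hypotheses (muK : involutive mu) (sA : sectT mu A).
Implicit Type s : {perm T}.

Definition hyper : {set {perm T}} := [set s : {perm T} | [forall x, s (mu x) == mu (s x)]].

Lemma hyperP s : reflect (forall x, s (mu x) = mu (s x)) (s \in hyper).
Proof. by rewrite inE; apply: (iffP forallP) => h x; apply/eqP. Qed.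

Let mA x : (mu x \in A) = (x \notin A). Proof. exact: (eqP (forallP sA x)). Qed.

Let bs x := if x \in A then x else mu x.
Let bsA x : bs x \in A. Proof. by rewrite /bs; case: ifP => // h; rewrite mA h. Qed.

(** The centralizer of [mu] is the hyperoctahedral group of its edges: an element is a permutation
    of the edges, recorded on [A], together with the set of edges whose direction it reverses. *)
Lemma card_hyper : #|hyper| = (2 ^ #|A| * #|A|`!)%N.
Proof.
have bi s : s \in hyper -> injective (fun x => if x \in A then bs (s x) else x).
  move/hyperP => hs x y.
  case: (boolP (x \in A)) => xA; case: (boolP (y \in A)) => yA // e; last first.
  - by move: xA; rewrite e bsA.
  - by move: yA; rewrite -e bsA.
  have h : s x = s y \/ s x = mu (s y).
    move: e; rewrite /bs; case: ifP => _; case: ifP => _ e; [by left|by right| |left].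
      by right; rewrite -e muK.
    exact: (perm_inj e).
  case: h => [/perm_inj//|]; rewrite -hs => /perm_inj xy.
  by move: xA; rewrite xy mA yA.
pose al s : {perm T} := odflt 1%g [pick a : {perm T} | [forall x, a x == if x \in A then bs (s x) else x]].
have alE s x : s \in hyper -> al s x = if x \in A then bs (s x) else x.
  move=> hs; rewrite /al; case: pickP => [a /forallP/(_ x)/eqP//|].
  by move=> /(_ (perm (bi s hs)))/negP[]; apply/forallP => y; rewrite permE.
pose f s := (al s, [set x in A | s x \notin A]).
have fi : {in hyper &, injective f}.
  move=> s t hs ht [e1 /setP e2].
  have hA x : x \in A -> s x = t x.
    move=> xA; have e3 : al s x = al t x by rewrite e1.
    move: e3 (e2 x); rewrite !alE // !inE xA /= /bs.
    by case: ifP => _; case: ifP => _ //= /perm_inj.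
  apply/permP => x; have [/hA//|xA] := boolP (x \in A).
  by apply: (@perm_inj _ mu); rewrite -(hyperP _ hs) -(hyperP _ ht) hA // mA.
rewrite -(card_in_imset fi) mulnC -card_perm -card_powerset.
have -> : #|perm_on A| = #|[set a : {perm T} | perm_on A a]| by apply: eq_card => a; rewrite inE.
rewrite -cardsX; apply: eq_card => -[a B]; apply/imsetP/idP => [[s hs [-> ->]]|].
  rewrite in_setX /= powersetE inE; apply/andP; split; apply/subsetP => x; rewrite !inE.
    by rewrite alE //; case: ifP => //; rewrite eqxx.
  by case/andP.
rewrite in_setX /= powersetE inE => /andP[aA /subsetP BA].
pose g0 x := if x \in B then mu (a x) else a x.
pose g x := if x \in A then g0 x else mu (g0 (mu x)).
have g0A x : x \in A -> (g0 x \in A) = (x \notin B).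
  move=> xA; have aAx : a x \in A by rewrite (perm_closed _ aA).
  by rewrite /g0; case: ifP => xB; rewrite ?mA aAx.
have bg0 x : x \in A -> bs (g0 x) = a x.
  move=> xA; rewrite /bs g0A // /g0; have aAx : a x \in A by rewrite (perm_closed _ aA).
  by case: (x \in B); rewrite /= ?muK.
have bg x : bs (g x) = a (bs x).
  rewrite /g {2}/bs; case: ifP => xA; first exact: bg0.
  have mxA : mu x \in A by rewrite mA xA.
  by rewrite -(bg0 _ mxA) {1}/bs mA /bs; case: (g0 (mu x) \in A); rewrite /= ?muK.
have gm x : g (mu x) = mu (g x).
  by rewrite /g mA; case: (boolP (x \in A)) => //= xA; rewrite muK.
have gi : injective g.
  move=> x y e; have : bs x = bs y by apply: (@perm_inj _ a); rewrite -!bg e.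
  have no z : g (mu z) <> g z.
    by rewrite gm => h; have := mA (g z); rewrite h; case: (_ \in _).
  rewrite /bs; case: ifP => _; case: ifP => _ // h.
  - by case: (no y); rewrite -h e.
  - by case: (no x); rewrite h e.
  - exact: (perm_inj h).
pose s := perm gi.
have hs : s \in hyper by apply/hyperP => x; rewrite !permE gm.
exists s => //; congr (_, _).
  apply/permP => x; rewrite alE //; case: ifP => xA; last by rewrite (out_perm aA) ?xA.
  by rewrite permE bg /bs xA.
apply/setP => x; rewrite inE permE; case: (boolP (x \in A)) => xA /=; last first.
  by apply/negbTE; apply: contra xA; exact: BA.
by rewrite /g xA g0A // negbK.
Qed.

End Hyperoctahedral.

(** * Evaluation of the Vandermonde sum *)

Section Evaluation.
Variable N : nat.
Hypothesis Nodd : odd N.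
Local Notation V := 'I_N.+1.

(** The contribution in [bosonization] of a tournament with scores [m]: the number of dart matchings
    from [card_trans], with the sign of [lowdarts] from [card_half_osec]. *)
Definition Gval (m : 'X_{1..N.+1}) : int :=
  if [forall i : V, m i + m (rev_ord i) == N] then
    (-1) ^+ (\sum_(i : V | i < N.+1./2) m (rev_ord i))%N * (\prod_i (m i)`!)%N%:Z
  else 0.

Lemma signed_count_perms : (N`!%:Z * signed_count N.+1 =
  \sum_(s : {perm V}) (-1) ^+ s * Gval [multinom (s i : nat) | i < N.+1] %[mod N.+2])%Z.
Proof.
rewrite (bosonization Nodd) sum_osec; congr (_ %% _)%Z.
transitivity ((-1) ^+ #|{: edge N}| * \sum_(f : {ffun edge N -> bool})
     (-1) ^+ #|[set e | f e]| * Gval (\sum_(e : edge N) U_(src (e, f e)))%MM).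
  rewrite mulr_sumr; apply: eq_bigr => f _.
  rewrite card_osec card_ups_osec (card_trans Nodd) /Gval.
  have -> : [forall i : V, (\sum_(e : edge N) U_(src (e, f e)))%MM i +
     (\sum_(e : edge N) U_(src (e, f e)))%MM (rev_ord i) == N] =
     [forall i : V, score (osec f) i + score (osec f) (rev_ord i) == N].
    by apply: eq_forallb => i; rewrite !score_osec.
  case: ifP => [/forallP sc|_]; last by rewrite !mulr0.
  rewrite (card_half_osec Nodd (fun i => eqP (sc i))) !exprD -!mulrA; do 3!congr (_ * _).
    by congr (_ ^+ _); apply: eq_bigr => i _; rewrite score_osec.
  by congr Posz; apply: eq_bigr => i _; rewrite score_osec.
(* The parity of the number of edges enters twice, as that of [#|o|] and as the sign of the
   Vandermonde product, and cancels. *)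
rewrite tournament_sum mulrA -expr2 sqrr_sign mul1r //.
Qed.

Definition rev_perm : {perm V} := perm (@rev_ord_inj N.+1).

Definition lowhalf : {set V} := [set i : V | (i < N.+1./2)%N].

Lemma rev_permK : involutive rev_perm.
Proof. by move=> i; rewrite !permE rev_ordK. Qed.

Lemma sect_lowhalf : sectT rev_perm lowhalf.
Proof. by apply/forallP => i; rewrite !inE permE rev_half. Qed.

Lemma pmatch_rev : pmatch [set: V] rev_perm.
Proof.
apply/pmatchP; split=> [|i]; first exact: rev_permK.
by rewrite permE inE (negbTE (rev_neq Nodd i)).
Qed.

Lemma card_lowhalf : #|lowhalf| = N.+1./2.
Proof. by have := card_sectT pmatch_rev sect_lowhalf; rewrite card_ord; lia. Qed.

(** Makes all terms equal: the sign of [s] is -1 to the number of low [i] with [s i] high, and the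
    second factor turns this into a product of values that [k] and [N - k] share. *)
Lemma hyper_sign (s : {perm V}) : s \in hyper rev_perm ->
  (-1) ^+ s * (-1) ^+ (\sum_(i : V | i < N.+1./2) s (rev_ord i))%N
  = (-1) ^+ (\sum_(i : V | i < N.+1./2) rev_ord i)%N :> int.
Proof.
move/hyperP => hs.
have hs' i : s (rev_ord i) = rev_ord (s i) by have := hs i; rewrite !permE.
have [sa s1] := @tourn_sgo _ V.
have ts := @tourn_sgo _ V.
have srev (x y : V) : sgo (rev_ord x) (rev_ord y) = - sgo x y.
  have rlt (a b : V) : (rev_ord a < rev_ord b)%N = (b < a)%N.
    by rewrite /=; have := ltn_ord a; have := ltn_ord b; lia.
  by rewrite sa /sgo !ltEord !rlt.
rewrite -(sgn_pp s ts) (pp_sect rev_permK (sectTP _ _ sect_lowhalf)); last first.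
  by move=> x y _ _; exact: (tourn_symM sa (proj1 (tourn_comp (@perm_inj _ s) ts))).
pose t x y := sgo x y * sgo (s x) (s y).
have t1 x y : x != y -> t x y * t x y = 1.
  by move=> xy; rewrite /t mulrACA !s1 ?mulr1 // (inj_eq perm_inj).
have trev x y : t (rev_ord x) (rev_ord y) = t x y by rewrite /t !hs' !srev mulrNN.
(* Between two edges the four factors are equal in pairs, because [s] commutes with the reversal. *)
rewrite [pp lowhalf _](_ : _ = 1) ?mulr1; last first.
  rewrite -[RHS](pp1 _ lowhalf); apply: eq_pp => x y; rewrite !inE => xl yl xy.
  rewrite /crs -/(t _ _) !permE -/(t x (rev_ord y)) -/(t (rev_ord x) y) -/(t (rev_ord x) (rev_ord y)) trev.
  have -> : t (rev_ord x) y = t x (rev_ord y) by rewrite -trev rev_ordK.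
  have xry : x != rev_ord y by apply: contraTneq xl => ->; rewrite (rev_half Nodd) yl.
  transitivity ((t x y * t x y) * (t x (rev_ord y) * t x (rev_ord y))); first by ring.
  by rewrite !t1.
have bigE (F : V -> int) : \prod_(i in lowhalf) F i = \prod_(i : V | (i < N.+1./2)%N) F i.
  by apply: eq_bigl => i; rewrite inE.
(* Since [N] is odd, replacing [k] by [N - k] changes both factors; so [phi] is invariant and its
   product is the same over every section of the reversal. *)
pose phi (k : V) : int := (-1) ^+ (rev_ord k) * (if (k < N.+1./2)%N then 1 else -1).
have phir k : phi (rev_perm k) = phi k.
  rewrite /phi permE rev_half // rev_ordK.
  have -> : (-1) ^+ rev_ord k = - (-1) ^+ k :> int.
    have e : (-1) ^+ rev_ord k * (-1) ^+ k = -1 :> int.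
      rewrite -exprD -signr_odd (_ : (rev_ord k + k)%N = N) ?Nodd //.
      by rewrite /= subSS subnK // -ltnS.
    by rewrite -[LHS]mulr1 -[X in _ * X](sqrr_sign _ k) expr2 mulrA e mulN1r.
  by case: (_ < _)%N => /=; rewrite ?mulr1 ?mulrN1 ?opprK.
have ss : sectT rev_perm (s @^-1: lowhalf).
  by apply/forallP => i; rewrite !inE hs permE rev_half.
have e1 : \prod_(x in lowhalf) (sgo x (rev_perm x) * sgo (s x) (s (rev_perm x))) =
   \prod_(x in lowhalf) (if (s x < N.+1./2)%N then 1 else -1).
  apply: eq_bigr => x; rewrite inE permE hs' => xl.
  have rx := rev_half Nodd x; rewrite xl in rx.
  have -> : sgo x (rev_ord x) = 1 by rewrite /sgo ltEord (_ : (x < rev_ord x)%N) //; move: rx xl; lia.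
  rewrite mul1r; have rs := rev_half Nodd (s x).
  case: ifP => sl; rewrite sl in rs.
    by rewrite /sgo ltEord (_ : (s x < rev_ord (s x))%N) //; move: rs sl; lia.
  by rewrite sa /sgo ltEord (_ : (rev_ord (s x) < s x)%N) //; move: rs sl; lia.
rewrite e1 -!prodrXr -!bigE -big_split /=.
have -> : \prod_(i in lowhalf) ((if (s i < N.+1./2)%N then 1 else -1) * (-1) ^+ s (rev_ord i)) =
   \prod_(i in lowhalf) phi (s i) by apply: eq_bigr => i _; rewrite /phi mulrC hs'.
have hV : s^-1%g \in hyper rev_perm.
  by apply/hyperP => x; apply: (@perm_inj _ s); rewrite hs !permKV.
transitivity (\prod_(i in lowhalf) phi i); last first.
  by apply: eq_bigr => i; rewrite /phi inE => ->; rewrite mulr1.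
rewrite -(big_imset phi) /=; last by move=> x y _ _; exact: perm_inj.
apply: (perm_rev_section rev_permK) => //; last exact: sect_lowhalf.
apply/forallP => i; rewrite -(permKV s i) -hs !mem_imset; try exact: perm_inj.
exact: (forallP sect_lowhalf).
Qed.

Lemma signed_count_eval : (N`!%:Z * signed_count N.+1 =
  (2 ^ N.+1./2 * N.+1./2`!)%N%:Z *
  ((-1) ^+ (\sum_(i : V | i < N.+1./2) rev_ord i)%N * (\prod_(i : V) i`!)%N%:Z) %[mod N.+2])%Z.
Proof.
rewrite signed_count_perms; congr (_ %% _)%Z.
rewrite (bigID (mem (hyper rev_perm))) /= [X in _ + X]big1 ?addr0; last first.
  move=> s /hyperP nh; rewrite /Gval ifF ?mulr0 //; apply/negP => /forallP h; case: nh => x.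
  apply: val_inj; have /eqP := h x; rewrite !mnmE !permE /=; have := ltn_ord (s x).
  by rewrite -/(rev_ord x); lia.
rewrite (eq_bigr (fun _ => (-1) ^+ (\sum_(i : V | (i < N.+1./2)%N) rev_ord i)%N * (\prod_(i : V) i`!)%N%:Z)).
  rewrite sumr_const (card_hyper rev_permK sect_lowhalf) card_lowhalf -mulr_natl natz //.
move=> s hs; rewrite /Gval ifT; last first.
  apply/forallP => x; rewrite !mnmE; have /hyperP/(_ x) := hs; rewrite !permE => ->.
  by rewrite /=; apply/eqP; have := ltn_ord (s x); lia.
rewrite mulrA -(hyper_sign hs); congr (_ * _ * _).
  by congr (_ ^+ _); apply: eq_bigr => i _; rewrite mnmE.
congr Posz; rewrite [RHS](reindex_inj (@perm_inj _ s)); apply: eq_bigr => i _; by rewrite mnmE.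
Qed.

End Evaluation.

(** * Reduction modulo p for p - 1 vertices *)

Section PrimeField.
Variable p : nat.
Hypotheses (p_prime : prime p) (p_odd : odd p).
Local Notation m := ((p - 1) %/ 2)%N.

Lemma pcharFp : p \in [pchar 'F_p].
Proof. exact: pchar_Fp. Qed.

Lemma intFp_eq0 (z : int) : (z%:~R == 0 :> 'F_p) = (p %| z)%Z.
Proof.
case: z => n; first by rewrite -pmulrn -(dvdn_pcharf pcharFp).
by rewrite NegzE mulrNz oppr_eq0 -pmulrn -(dvdn_pcharf pcharFp) dvdzE abszN.
Qed.

Lemma eqFp (a b : int) : (a = b %[mod p])%Z <-> a%:~R = b%:~R :> 'F_p.
Proof.
rewrite (rwP eqP) eqz_mod_dvd -intFp_eq0 mulrzBr subr_eq0 -(rwP eqP).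
by split.
Qed.

Lemma p_gt2 : (2 < p)%N.
Proof. by have := odd_prime_gt2 p_odd p_prime. Qed.

Lemma half_p : p = m.*2.+1.
Proof. by have := odd_double_half p; rewrite p_odd -divn2; have := p_gt2; lia. Qed.

Lemma pr0 : p%:R = 0 :> 'F_p. Proof. exact: pchar_Fp_0. Qed.

Lemma wilsonFp : (p.-1)`!%:R = -1 :> 'F_p.
Proof.
have := Wilson (prime_gt1 p_prime); rewrite p_prime => /esym.
by rewrite (dvdn_pcharf pcharFp) -natr1 addr_eq0 => /eqP.
Qed.

Lemma natFp_neq0 k : (0 < k < p)%N -> k%:R != 0 :> 'F_p.
Proof. by case/andP => k0 kp; rewrite -(dvdn_pcharf pcharFp) gtnNdvd. Qed.

Lemma fact_p2 : (p - 2)`!%:R = 1 :> 'F_p.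
Proof.
have := wilsonFp; have -> : p.-1 = (p - 2).+1 by have := p_gt2; lia.
rewrite factS natrM.
have -> : (p - 2).+1%:R = -1 :> 'F_p.
  apply/eqP; rewrite -addr_eq0 natr1 (_ : (p - 2).+2 = p) ?pr0 //.
  by have := p_gt2; lia.
by rewrite mulN1r => /oppr_inj.
Qed.

(** A form of Wilson's theorem: it starts from [(p - 2)! = 1], and a step to [k + 1] trades the
    factor [p - 2 - k], which is [-(k + 2)], for [k + 2]. *)
Lemma fact_compl k : (k <= p - 2)%N -> k`!%:R * (p - 2 - k)`!%:R * k.+1%:R = (-1) ^+ k :> 'F_p.
Proof.
elim: k => [|k IH] kp; first by rewrite subn0 fact_p2 !mulr1.
have e : (p - 2 - k = (p - 2 - k.+1).+1)%N by lia.
have := IH (ltnW kp); rewrite e factS natrM exprS => <-.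
have -> : (p - 2 - k.+1).+1%:R = - k.+2%:R :> 'F_p.
  apply/eqP; rewrite -addr_eq0 -natrD (_ : (_ + _ = p)%N) ?pr0 //.
  by have := p_gt2; lia.
by rewrite factS natrM; ring.
Qed.

Lemma signed_count_pred : (signed_count (p - 1) = (-2) ^+ m %[mod p])%Z.
Proof.
have Nodd : odd (p - 2) by rewrite oddB ?p_odd //; exact: ltnW p_gt2.
have eN : (p - 1 = (p - 2).+1)%N by have := p_gt2; lia.
have em : m = (p - 2).+1./2 by rewrite -eN divn2.
have := signed_count_eval Nodd; rewrite -eN.
have ep : (p - 1).+1 = p by have := p_gt2; lia.
rewrite ep.
move/eqFp; rewrite !intrM -!pmulrn fact_p2 mul1r => e; apply/eqFp; rewrite e {e}.
pose F (i : 'I_(p - 2).+1) : 'F_p := i`!%:R.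
have eF : ((\prod_(i : 'I_(p - 2).+1) i`!)%N)%:R = \prod_(i in [set: 'I_(p - 2).+1]) F i :> 'F_p.
  by rewrite natr_prod; apply: eq_bigl => i; rewrite inE.
have [rK sl] := (@rev_permK (p - 2), sectTP _ _ (sect_lowhalf Nodd)).
have bigE (G : 'I_(p - 2).+1 -> 'F_p) :
    \prod_(i : 'I_(p - 2).+1 | (i < (p - 2).+1./2)%N) G i = \prod_(i in lowhalf (p - 2)) G i.
  by apply: eq_bigl => i; rewrite inE.
rewrite eN eF (prod_sect _ rK sl) rmorphXn /= rmorphN1 -prodrXr bigE -big_split /=.
(* The factorial of [m] is spread over the lower half as [i + 1], just the factor that [fact_compl]
   wants for the pair [i], [N - i]. *)
have -> : (2 ^ (p - 2).+1./2 * (p - 2).+1./2`!)%N%:R =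
     2%:R ^+ m * \prod_(i in lowhalf (p - 2)) i.+1%:R :> 'F_p.
  rewrite natrM natrX -em; congr (_ * _).
  have le : (m <= (p - 2).+1)%N by rewrite em; lia.
  rewrite fact_prod big_add1 /= big_mkord natr_prod (big_ord_widen _ (fun i => i.+1%:R) le) em.
  by apply: eq_bigl => i; rewrite inE.
rewrite -mulrA -big_split /= (eq_bigr (fun _ => -1)).
  rewrite prodr_const (card_lowhalf Nodd) -em -exprMn mulrN1.
  by rewrite -eN rmorphXn /= mulrNz -pmulrn.
move=> i _; rewrite permE /F; have iN : (i <= p - 2)%N by rewrite -ltnS.
have ei : nat_of_ord (rev_ord i) = (p - 2 - i)%N by rewrite /= subSS.
rewrite ei.
transitivity ((-1) ^+ (p - 2 - i) * (i`!%:R * (p - 2 - i)`!%:R * i.+1%:R) : 'F_p); first by ring.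
(* Each pair contributes [(-1) ^ (N - i) (-1) ^ i], which is -1 as [N] is odd. *)
rewrite fact_compl // -exprD subnK // -signr_odd Nodd //.
Qed.

End PrimeField.

(** * Starter sum modulo p *)

Section LeadingForms.
Variables (n : nat) (F : fieldType).
Implicit Types P Q : {mpoly F[n]}.

(* [P] and [Q] have degree at most [k] and the same homogeneous part of degree [k]. *)
Definition samelead (k : nat) P Q :=
  [/\ (msize P <= k.+1)%N, (msize Q <= k.+1)%N & (msize (P - Q) <= k)%N].

Lemma msizeM_leq P Q j k : (msize P <= j.+1)%N -> (msize Q <= k)%N -> (msize (P * Q) <= j + k)%N.
Proof.
have [->|P0] := eqVneq P 0; first by rewrite mul0r msize0.
have [->|Q0] := eqVneq Q 0; first by rewrite mulr0 msize0.
by move=> hP hQ; rewrite msizeM // -subn1 leq_subLR add1n -addSn leq_add.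
Qed.

Lemma msizeD_leq P Q k : (msize P <= k)%N -> (msize Q <= k)%N -> (msize (P + Q) <= k)%N.
Proof. by move=> hP hQ; apply: leq_trans (msizeD_le _ _) _; rewrite geq_max hP. Qed.

Lemma msizeC_leq c : (msize (c%:MP : {mpoly F[n]}) <= 1)%N.
Proof. by rewrite -[c%:MP]mulr1 mul_mpolyC (leq_trans (msizeZ_le _ _)) // msize1. Qed.

Lemma samelead1 : samelead 0 1 1.
Proof. by split; rewrite ?msize1 // subrr msize0. Qed.

Lemma sameleadM j k P P' Q Q' :
  samelead j P P' -> samelead k Q Q' -> samelead (j + k) (P * Q) (P' * Q').
Proof.
move=> [h1 h2 h3] [h4 h5 h6]; split; try by rewrite -addnS; exact: msizeM_leq.
rewrite (_ : _ - _ = P * (Q - Q') + Q' * (P - P')); last by ring.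
apply: msizeD_leq; first exact: msizeM_leq.
by rewrite addnC; exact: msizeM_leq.
Qed.

Lemma samelead_prod I (r : seq I) (p : pred I) (k : I -> nat) (P Q : I -> {mpoly F[n]}) :
  (forall i, p i -> samelead (k i) (P i) (Q i)) ->
  samelead (\sum_(i <- r | p i) k i) (\prod_(i <- r | p i) P i) (\prod_(i <- r | p i) Q i).
Proof.
move=> h; elim: r => [|i r IH]; first by rewrite !big_nil; exact: samelead1.
by rewrite !big_cons; case: ifP => // pi; apply: sameleadM => //; exact: h.
Qed.

Lemma samelead_add P Q c d : (msize (P - Q) <= 1)%N -> (msize P <= 2)%N -> (msize Q <= 2)%N ->
  samelead 1 (P + c%:MP) (Q + d%:MP).
Proof.
move=> h hP hQ; split; try by apply: msizeD_leq => //; apply: leq_trans (msizeC_leq _) _.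
rewrite opprD addrACA -mpolyCB; apply: msizeD_leq => //; exact: msizeC_leq.
Qed.

End LeadingForms.

Section PolynomialSums.
Variable p : nat.
Hypothesis p_prime : prime p.

Lemma sum_powFp k : (k < p.-1)%N -> \sum_(x : 'F_p) x ^+ k = 0.
Proof.
case: k => [_|k kp].
  by under eq_bigr do rewrite expr0; rewrite sumr_const card_Fp // pchar_Fp_0.
have [g g0 gk] : exists2 g : 'F_p, g != 0 & g ^+ k.+1 != 1.
  case: (pickP (fun g : 'F_p => (g != 0) && (g ^+ k.+1 != 1))) => [g /andP[]|h]; first by exists g.
  have := @max_unity_roots _ k.+1 (enum [set x : 'F_p | x != 0]) isT.
  rewrite -cardE (_ : [set x : 'F_p | x != 0] = [set~ 0]); last by apply/setP => x; rewrite !inE.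
  rewrite cardsC1 card_Fp // enum_uniq => le; suff : (p.-1 <= k.+1)%N by lia.
  apply: le => //; apply/allP => x; rewrite mem_enum !inE => x0.
  by have := h x; rewrite x0 /= unity_rootE => /negbFE.
set S := \sum_x _; have e : S = g ^+ k.+1 * S.
  rewrite {1}/S (reindex_inj (mulfI g0)) mulr_sumr; apply: eq_bigr => x _; exact: exprMn.
apply/eqP; have /eqP : (1 - g ^+ k.+1) * S = 0 by rewrite mulrBl mul1r -e subrr.
by rewrite mulf_eq0 subr_eq0 eq_sym (negbTE gk).
Qed.

(** As in the Chevalley-Warning theorem: in degree below [n (p - 1)] every monomial has an exponent
    below [p - 1], and the sum over that variable vanishes. *)
Lemma sum_meval n (P : {mpoly 'F_p[n]}) : (msize P <= n * p.-1)%N ->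
  \sum_(a : {ffun 'I_n -> 'F_p}) P.@[a] = 0.
Proof.
move=> hP; under eq_bigr => a _ do rewrite mevalE.
rewrite exchange_big /= big_seq big1 // => mm mP.
rewrite -mulr_sumr -(bigA_distr_bigA (fun i x => x ^+ mm i)) /=.
have [i lt] : exists i, (mm i < p.-1)%N.
  apply/existsP; apply: contraTT (leq_trans (msize_mdeg_lt mP) hP).
  rewrite negb_exists -leqNgt mdegE => /forallP h.
  rewrite -[X in (X * _)%N](card_ord n) -sum_nat_const leq_sum // => i _.
  by rewrite leqNgt h.
by rewrite (bigD1 i) //= sum_powFp // mul0r mulr0.
Qed.

End PolynomialSums.

Section ShiftedProducts.
Variables (R : comNzRingType) (n : nat).

(* The product of the differences of the points [0], [y i false], [y i true], except for the
   differences [y i true - y i false]. *)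
Definition shiftprod (y : 'I_n -> bool -> R) : R :=
  (\prod_i (y i false * y i true)) *
  pp [set: 'I_n] (fun i j => (y j false - y i false) * (y j true - y i false)
                           * (y j false - y i true) * (y j true - y i true)).
End ShiftedProducts.

Lemma sum_lt_enum_rank (T : finType) :
  (\sum_(x : T) \sum_(y : T | enum_rank x < enum_rank y) 2 = #|T| * #|T|.-1)%N.
Proof.
pose K := (\sum_(x : T) \sum_(y : T | (enum_rank x < enum_rank y)%N) 1)%N.
have K2 : K = (\sum_(x : T) \sum_(y : T | (enum_rank y < enum_rank x)%N) 1)%N.
  rewrite /K (exchange_big_dep predT) //=; apply: eq_bigr => y _; exact: eq_bigl.
transitivity (K + K)%N.
  by rewrite {1 2}/K -big_split /=; apply: eq_bigr => x _; rewrite -big_split.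
rewrite {2}K2 /K -big_split /= -sum_nat_const; apply: eq_bigr => x _.
transitivity #|predC1 x|; last exact: cardC1.
rewrite -[RHS]sum1_card [RHS](bigID (fun y => (enum_rank x < enum_rank y)%N)) /=.
congr (_ + _)%N; apply: eq_bigl => y; rewrite inE; have [->|xy] := eqVneq y x; rewrite ?ltnn //.
by rewrite /= enum_rank_ltNgt.
Qed.

Section ShiftIndependence.
Variables (p n : nat).
Hypotheses (p_prime : prime p) (pn : p.-1 = n.*2).
Implicit Types (s : 'I_n -> 'F_p) (a : {ffun 'I_n -> 'F_p}).

Definition point s a i (b : bool) : 'F_p := a i + (if b then s i else 0).

Definition ppoint s i (b : bool) : {mpoly 'F_p[n]} := 'X_i + (if b then s i else 0)%:MP.

Lemma meval_shiftprod s a : (shiftprod (ppoint s)).@[a] = shiftprod (point s a).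
Proof.
have e i b : (ppoint s i b).@[a] = point s a i b.
  by rewrite /ppoint mevalD mevalXU mevalC.
rewrite /shiftprod mevalM /pp !rmorph_prod; congr (_ * _).
  by apply: eq_bigr => i _; rewrite /= mevalM !e.
apply: eq_bigr => i _; rewrite /= rmorph_prod; apply: eq_bigr => j _.
by rewrite /= !mevalM !mevalB !e.
Qed.

Lemma samelead_shiftprod s t :
  samelead (n * n.*2) (shiftprod (ppoint s)) (shiftprod (ppoint t)).
Proof.
have hX i : (msize ('X_i : {mpoly 'F_p[n]}) <= 2)%N by rewrite msizeX mdeg1.
have h1 i b : samelead 1 (ppoint s i b) (ppoint t i b).
  by apply: samelead_add; rewrite ?subrr ?msize0.
have hB i j b c : samelead 1 (ppoint s j c - ppoint s i b) (ppoint t j c - ppoint t i b).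
  have e (P Q : {mpoly 'F_p[n]}) u v : P + u%:MP - (Q + v%:MP) = P - Q + (u - v)%:MP.
    by rewrite mpolyCB; ring.
  rewrite /ppoint !e; apply: samelead_add; rewrite ?subrr ?msize0 //.
    by apply: msizeD_leq; rewrite ?msizeN.
  by apply: msizeD_leq; rewrite ?msizeN.
(* The degree: two linear factors for each index and four for each of the [n (n - 1) / 2] pairs. *)
have -> : (n * n.*2 = \sum_(i < n) 2 + \sum_(i in [set: 'I_n])
     \sum_(j in [set: 'I_n] | (enum_rank i < enum_rank j)%N) 4)%N.
  have -> : (\sum_(i in [set: 'I_n]) \sum_(j in [set: 'I_n] | (enum_rank i < enum_rank j)%N) 4 =
     2 * \sum_(i : 'I_n) \sum_(j : 'I_n | enum_rank i < enum_rank j) 2)%N.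
    rewrite big_distrr /=; apply: eq_big => i; rewrite ?inE // => _.
    by rewrite big_distrr /=; apply: eq_bigl => j; rewrite ?inE.
  rewrite sum_lt_enum_rank sum_nat_const card_ord; case: (n) => //= k; rewrite -!mul2n; ring.
apply: sameleadM; first by apply: samelead_prod => i _; exact: (sameleadM (h1 i false) (h1 i true)).
apply: samelead_prod => i _; apply: samelead_prod => j _.
exact: (sameleadM (sameleadM (sameleadM (hB i j _ _) (hB i j _ _)) (hB i j _ _)) (hB i j _ _)).
Qed.

(** With [p - 1 = 2 n] the degree [n * 2 n] is exactly the threshold of [sum_meval]; the difference
    of the two polynomials lies below it. *)
Lemma sum_shiftprod s t : \sum_a shiftprod (point s a) = \sum_a shiftprod (point t a).
Proof.
apply/eqP; rewrite -subr_eq0 -sumrB.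
rewrite (eq_bigr (fun a : {ffun 'I_n -> 'F_p} => (shiftprod (ppoint s) - shiftprod (ppoint t)).@[a])).
  rewrite sum_meval // pn; by case: (samelead_shiftprod s t).
by move=> a _; rewrite mevalB !meval_shiftprod.
Qed.

End ShiftIndependence.

(** * Starters as values of a polynomial *)

Section Starters.
Variable p : nat.
Hypotheses (p_prime : prime p) (p_odd : odd p).
Local Notation m := ((p - 1) %/ 2)%N.
Implicit Types (x y d : 'F_p) (al be : {perm 'F_p}) (s : 'I_m -> 'F_p) (a : {ffun 'I_m -> 'F_p}).

Definition units : {set 'F_p} := [set x | x != 0].

Definition startp al := pmatch units al && [forall d, (d != 0) ==> [exists x, x - al x == d]].

Lemma starter_sumE : starter_sum p = \sum_(al | startp al) epsr (@sgo _ 'F_p) al.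
Proof.
rewrite /starter_sum.
have inj : {in [set al | startp al] &, injective (@pedges 'F_p units)}.
  by move=> al be; rewrite !inE => /andP[h _] /andP[h' _]; exact: pedges_inj.
rewrite (eq_bigl (fun A => A \in @pedges 'F_p units @: [set al | startp al])).
  rewrite big_imset //=; apply: eq_big => [al|al]; rewrite inE // => /andP[h _].
  by rewrite (eps_lows h) (epsr_sect _ h (sect_lows h)) //; case: (@tourn_sgo _ 'F_p).
have key al : pmatch units al ->
    [forall (x : 'F_p | x != 0), exists a, exists b, ([set a; b] \in pedges units al) && (a - b == x)]
    = [forall d, (d != 0) ==> [exists x, x - al x == d]].
  move=> h; apply: eq_forallb => d; case: (eqVneq d 0) => //= d0.
  apply/existsP/existsP => [[x /existsP[y /andP[xy /eqP e]]]|[x /eqP e]].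
    have ne : x != y by apply: contraNneq d0 => xy'; rewrite -e xy' subrr.
    by move: xy; rewrite pedges_mem // => /andP[_ /eqP xy]; exists x; rewrite xy e.
  exists x; apply/existsP; exists (al x); rewrite e eqxx andbT.
  have ne : x != al x by apply: contraNneq d0 => xy; rewrite -e -xy subrr.
  rewrite pedges_mem // eqxx andbT.
  by have [_ hx] := pmatchP _ _ h; rewrite -[_ \in _]negbK -hx eq_sym.
move=> A; apply/andP/imsetP => [[/perfect_matchingP[al hal ->]]|[al]].
  by rewrite key // => h; exists al; rewrite // inE /startp hal.
by rewrite inE => /andP[h1 h2] ->; rewrite key //; split=> //; exact: perfect_pedges.
Qed.

(** As [p] is odd, [d] and [- d] have representatives of opposite parity. So [eta (y - x)] is a
    tournament on the residues, and unlike the linear order it is invariant under translations. *)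
Definition eta d : int := if d == 0 then 0 else (-1) ^+ (d : nat).

Lemma valFp x : ((x : nat) < p)%N.
Proof. by rewrite -[X in (_ < X)%N](Fp_cast p_prime). Qed.

Lemma natFp x : (x : nat)%:R = x.
Proof. exact: natr_Zp. Qed.

Lemma nat_valFp k : (k < p)%N -> (k%:R : 'F_p) = k :> nat.
Proof. by move=> kp; rewrite val_Fp_nat // modn_small. Qed.

Lemma subFp_val x y : (x < y)%N -> (y - x : 'F_p) = (y - x)%N :> nat.
Proof.
move=> xy; rewrite -{1}(natFp x) -{1}(natFp y) -natrB ?(ltnW xy) // nat_valFp //.
by apply: leq_ltn_trans (leq_subr _ _) _; exact: valFp.
Qed.

Lemma oppFp_val x : x != 0 -> (- x : 'F_p) = (p - x)%N :> nat.
Proof.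
move=> x0; have -> : - x = (p - x)%:R.
  by rewrite natrB ?natFp ?pr0 ?sub0r // ltnW // valFp.
rewrite nat_valFp //; have : (0 < x)%N by rewrite lt0n; apply: contraNneq x0 => e; apply/eqP; apply: val_inj.
have := prime_gt0 p_prime; lia.
Qed.

Lemma etaN d : eta (- d) = - eta d.
Proof.
rewrite /eta oppr_eq0; case: eqVneq => [|d0]; first by rewrite oppr0.
rewrite oppFp_val // -signr_odd oddB ?p_odd; last by rewrite ltnW // valFp.
by rewrite /= signrN signr_odd.
Qed.

Lemma eta_sq d : d != 0 -> eta d * eta d = 1.
Proof. by rewrite /eta => /negbTE->; rewrite -expr2 sqrr_sign. Qed.

Lemma tourn_eta : tourn (fun x y => eta (y - x)).
Proof.
split=> x y; first by rewrite -etaN opprB.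
by move=> xy; rewrite eta_sq // subr_eq0 eq_sym.
Qed.

(* The absolute value of [d], for the sign [eta]. *)
Definition ab d : 'F_p := (eta d)%:~R * d.

Lemma abN d : ab (- d) = ab d.
Proof. by rewrite /ab etaN mulrNz mulrNN. Qed.

Lemma ab_eta d : (eta d)%:~R * ab d = d.
Proof.
rewrite /ab mulrA -intrM; case: (eqVneq d 0) => [->|d0]; first by rewrite mulr0.
by rewrite eta_sq // mul1r.
Qed.

Lemma ab_neq0 d : d != 0 -> ab d != 0.
Proof. by move=> d0; apply: contraNneq d0 => e; rewrite -(ab_eta d) e mulr0. Qed.

Lemma sgo_eta x y : x != y -> sgo x y * eta (y - x) = (-1) ^+ (x : nat) * (-1) ^+ (y : nat).
Proof.
have key (u v : 'F_p) : (u < v)%N -> sgo u v * eta (v - u) = (-1) ^+ (u : nat) * (-1) ^+ (v : nat).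
  move=> uv; rewrite /sgo ltEord uv mul1r /eta subr_eq0 ifF; last first.
    by apply/negP => /eqP e; rewrite e ltnn in uv.
  rewrite subFp_val // -[in RHS](subnK (ltnW uv)) exprD mulrCA -expr2 sqrr_sign mulr1 //.
have [sa _] := @tourn_sgo _ 'F_p.
move=> xy; case: (ltngtP x y) => [/key//|lt|e].
  by rewrite sa -opprB etaN mulrNN key // mulrC.
by rewrite (ord_inj e) eqxx in xy.
Qed.

(** By [sgo_eta] the two tournaments differ by a product of signs of the two vertices, and in [crs]
    every vertex occurs twice. *)
Lemma epsr_eta al : pmatch units al -> epsr (fun x y => eta (y - x)) al = epsr (@sgo _ 'F_p) al.
Proof.
move=> h; have [aK _] := pmatchP _ _ h; have sec := sect_esec h.
apply: eq_pp => x y xA yA xy.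
have [sa s1] := @tourn_sgo _ 'F_p.
have c1 := crs_tourn1 aK sec (@tourn_sgo _ 'F_p) xA yA xy.
rewrite -[LHS]mul1r -c1 -mulrA -crsM.
have [AD sD] := sec; have [_ mx] := sD _ (subsetP AD _ xA); have [_ my] := sD _ (subsetP AD _ yA).
rewrite xA in mx; rewrite yA in my.
have e1 : x != al y by apply: contraFneq my => <-.
have e2 : al x != y by apply: contraFneq mx => ->.
have e3 : al x != al y by rewrite (inj_eq perm_inj).
rewrite {2}/crs !sgo_eta //.
transitivity (crs (@sgo _ 'F_p) al x y * (((-1) ^+ (x : nat)) ^+ 2 * ((-1) ^+ (y : nat)) ^+ 2 *
   ((-1) ^+ (al x : nat)) ^+ 2 * ((-1) ^+ (al y : nat)) ^+ 2)); first by ring.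
by rewrite !sqrr_sign !mulr1.
Qed.

Definition prodU : 'F_p := \prod_(x in units) x.
Definition ppU : 'F_p := pp units (fun x y => ab (y - x)).

Lemma prodU_neq0 : prodU != 0.
Proof. by apply/prodf_neq0 => x; rewrite inE. Qed.

Lemma ppU_neq0 : ppU != 0.
Proof.
apply/prodf_neq0 => x _; apply/prodf_neq0 => y /andP[_ xy]; apply: ab_neq0.
by rewrite subr_eq0; apply: contraTneq xy => ->; rewrite ltnn.
Qed.

(* [al] is the matching with edges [{a i, a i + s i}]. *)
Definition rep s a al :=
  [&& pmatch units al, injectiveb a, a @: [set: 'I_m] \subset units,
      [forall x in units, (al x \in a @: [set: 'I_m]) == (x \notin a @: [set: 'I_m])]
    & [forall i, al (a i) == a i + s i]].

Lemma repP s a al : rep s a al -> [/\ pmatch units al, injective a,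
  sect al (a @: [set: 'I_m]) units & forall i, al (a i) = a i + s i].
Proof.
case/and5P => h1 /injectiveP h2 h3 /forall_inP h4 /forallP h5; split=> //; last by move=> i; apply/eqP.
by split=> // x xu; rewrite pmatch_in // xu (eqP (h4 _ xu)).
Qed.

(** Each difference is [eta] times [ab]. The signs [eta] multiply to the sign of [al]; the values
    [ab], completed by those of the edges [s i], give the product [ppU] over all pairs, whatever the
    matching. *)
Lemma shiftprod_rep s a al : rep s a al ->
  shiftprod (point s a) * \prod_i ab (s i) = prodU * ppU * (epsr (@sgo _ 'F_p) al)%:~R.
Proof.
case/repP => h ai sec ha; have [aK _] := pmatchP _ _ h.
have ain : {in [set: 'I_m] &, injective a} by move=> i j _ _; exact: ai.
have pt0 i : point s a i false = a i by rewrite /point addr0.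
have pt1 i : point s a i true = al (a i) by rewrite /point ha.
pose sF x y : 'F_p := y - x.
have sFa : antisym sF by move=> x y; rewrite /sF opprB.
have e1 : \prod_i (point s a i false * point s a i true) = prodU.
  rewrite /prodU (prod_sect _ aK sec) big_imset //=.
  by apply: eq_big => i; rewrite ?inE // pt0 pt1.
have e2 : shiftprod (point s a) = prodU * pp (a @: [set: 'I_m]) (crs sF al).
  rewrite /shiftprod e1 pp_imset //; last by move=> x y _ _; exact: crs_sym.
  by congr (_ * _); apply: eq_pp => i j _ _ _; rewrite /crs /sF !pt0 !pt1.
have e3 : pp (a @: [set: 'I_m]) (crs sF al) =
    (epsr (@sgo _ 'F_p) al)%:~R * pp (a @: [set: 'I_m]) (crs (fun x y => ab (y - x)) al).
  rewrite -epsr_eta // (epsr_sect _ h sec); last by case: tourn_eta.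
  rewrite {2}/pp rmorph_prod.
  have -> : \prod_(x in a @: [set: 'I_m]) (\prod_(y in a @: [set: 'I_m] | (enum_rank x < enum_rank y)%N)
     crs (fun x y => eta (y - x)) al x y)%:~R = pp (a @: [set: 'I_m]) (crs (fun x y => (eta (y - x))%:~R : 'F_p) al).
    apply: eq_bigr => x _; rewrite rmorph_prod; apply: eq_bigr => y _.
    by rewrite /crs !rmorphM.
  rewrite -ppM; apply: eq_pp => x y _ _ _; rewrite -crsM /crs /sF !ab_eta //.
have e4 : ppU = \prod_i ab (s i) * pp (a @: [set: 'I_m]) (crs (fun x y => ab (y - x)) al).
  rewrite /ppU (pp_sect aK sec); last by move=> x y _ _; rewrite -opprB abN.
  rewrite big_imset //=; congr (_ * _); apply: eq_big => i; rewrite ?inE // => _.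
  by rewrite ha addrAC subrr add0r.
rewrite e2 e3 e4; ring.
Qed.

Lemma rep_inj s a al be : rep s a al -> rep s a be -> al = be.
Proof.
case/repP => h ai [AD sec] ha /repP[h' _ _ hb].
have [aK aV] := pmatchP _ _ h; have [bK bV] := pmatchP _ _ h'.
have eA x : x \in a @: [set: 'I_m] -> al x = be x by case/imsetP => i _ ->; rewrite ha hb.
apply/permP => x; have [xu|xu] := boolP (x \in units); last first.
  by have := aV x; have := bV x; rewrite xu => /eqP-> /eqP->.
have [/eA//|xA] := boolP (x \in a @: [set: 'I_m]).
have [_ hx] := sec _ xu; rewrite xA in hx.
by have := eA _ hx; rewrite aK => e; apply: (@perm_inj _ be); rewrite bK -e.
Qed.

Lemma card_units : #|units| = m.*2.
Proof.
have -> : units = [set~ 0] by apply/setP => x; rewrite !inE.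
by rewrite cardsC1 card_Fp //; have := half_p p_prime p_odd; lia.
Qed.

(** A nonzero value makes the [2 m] points [a i], [a i + s i] nonzero and distinct, so they exhaust
    the units; the two points with the same [i] are separated by [s i != 0]. *)
Lemma rep_ex s a : (forall i, s i != 0) -> shiftprod (point s a) != 0 -> exists al, rep s a al.
Proof.
move=> s0; rewrite mulf_eq0 negb_or => /andP[/prodf_neq0 h1 /prodf_neq0 h2].
pose P (ib : 'I_m * bool) := point s a ib.1 ib.2.
have P0 ib : P ib != 0.
  by case: ib => i b; have := h1 i isT; rewrite mulf_eq0 negb_or => /andP[]; case: b.
have dif i j b c : (enum_rank i < enum_rank j)%N -> point s a i b != point s a j c.
  move=> ij; have := h2 i (in_setT _) => /prodf_neq0/(_ j); rewrite inE ij => /(_ isT).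
  rewrite !mulf_eq0 !negb_or !subr_eq0 ![_ == point s a i _]eq_sym => /andP[/andP[/andP[]]].
  by case: b; case: c.
have Pi : injective P.
  move=> [i b] [j c] e; have ij : i = j.
    apply/eqP; apply: contraT => ne; have := enum_rank_ltNgt ne.
    case: (ltnP (enum_rank i) (enum_rank j)) => [lt _|_ /esym/negbFE lt].
      by have := dif _ _ b c lt; rewrite -[_ == _]/(P (i, b) == P (j, c)) e eqxx.
    by have := dif _ _ c b lt; rewrite -[_ == _]/(P (j, c) == P (i, b)) e eqxx.
  rewrite -{j}ij in e *; congr (_, _); move: e; rewrite /P /point /= => /addrI.
  by case: b; case: c => // /eqP; rewrite ?[0 == _]eq_sym (negbTE (s0 i)).
have Pim : P @: [set: 'I_m * bool] = units.
  apply/eqP; rewrite eqEcard (card_imset _ Pi) cardsT card_prod card_ord card_bool card_units muln2 leqnn andbT.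
  by apply/subsetP => _ /imsetP[ib _ ->]; rewrite inE P0.
pose g x := if [pick ib | P ib == x] is Some ib then P (ib.1, ~~ ib.2) else x.
have gP i b : g (P (i, b)) = P (i, ~~ b).
  rewrite /g; case: pickP => [ib /eqP/Pi ->//|/(_ (i, b))]; by rewrite eqxx.
have g0 x : x \notin units -> g x = x.
  move=> xu; rewrite /g; case: pickP => // ib /eqP e; by rewrite inE -e P0 in xu.
have gK : involutive g.
  move=> x; have [xu|xu] := boolP (x \in units); last by rewrite !g0.
  by move: xu; rewrite -Pim => /imsetP[[i b] _ ->]; rewrite !gP negbK.
have hA ib : (P ib \in a @: [set: 'I_m]) = ~~ ib.2.
  case: ib => i b /=; apply/imsetP/idP => [[j _ e]|bf].
    have : P (i, b) = P (j, false) by rewrite e /P /point addr0.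
    by move/Pi => [_ ->].
  by exists i; [rewrite inE|rewrite /P /point /= (negbTE bf) addr0].
exists (perm (inv_inj gK)); apply/and5P; split.
- apply/pmatchP; split=> x; rewrite !permE ?gK //.
  have [xu|xu] := boolP (x \in units); last by rewrite g0 ?eqxx.
  move: xu; rewrite -Pim => /imsetP[[i b] _ ->]; rewrite gP (inj_eq Pi).
  by rewrite xpair_eqE eqxx; case: b.
- apply/injectiveP => i j e.
  have : P (i, false) = P (j, false) by rewrite /P /point /= e.
  by move/Pi => [].
- apply/subsetP => _ /imsetP[i _ ->]; rewrite inE.
  by have := P0 (i, false); rewrite /P /point addr0.
- apply/forall_inP => x; rewrite -Pim => /imsetP[[i b] _ ->].
  by rewrite permE gP !hA.
- apply/forallP => i; rewrite permE; apply/eqP.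
  have := gP i false; rewrite /P /point /= addr0 => -> //.
Qed.

(** A vector [a] with nonzero value represents exactly one matching, so the sum counts each matching
    with its sign and the number of its representations. *)
Lemma sum_rep s : (forall i, s i != 0) ->
  (\sum_a shiftprod (point s a)) * \prod_i ab (s i) =
  prodU * ppU * \sum_al (epsr (@sgo _ 'F_p) al)%:~R * #|[set a | rep s a al]|%:R.
Proof.
move=> s0; rewrite mulr_suml.
transitivity (\sum_a \sum_(al | rep s a al) prodU * ppU * (epsr (@sgo _ 'F_p) al)%:~R).
  apply: eq_bigr => a _; have [e|ne] := eqVneq (shiftprod (point s a)) 0.
    rewrite e mul0r big1 // => al h; apply/eqP; rewrite -(shiftprod_rep h) e mul0r //.
  have [al h] := rep_ex s0 ne.
  rewrite (bigD1 al) //= [X in _ + X]big1 ?addr0 ?(shiftprod_rep h) //.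
  by move=> be /andP[h']; rewrite (rep_inj h' h) eqxx.
rewrite (exchange_big_dep predT) //= mulr_sumr; apply: eq_bigr => al _.
rewrite sumr_const -[LHS]mulr_natr -[LHS]mulrA; congr (_ * (_ * _)); congr (_%:R).
by apply: eq_card => a; rewrite !inE.
Qed.

End Starters.

(** * Comparison of the even differences with the differences 1 *)

Section StarterSum.
Variable p : nat.
Hypotheses (p_prime : prime p) (p_odd : odd p).
Local Notation m := ((p - 1) %/ 2)%N.
Implicit Types (x y d : 'F_p) (al be : {perm 'F_p}) (a : {ffun 'I_m -> 'F_p}).

Let pE : p = m.*2.+1. Proof. exact: half_p. Qed.

(** The residues [2, 4, ..., p - 1]: representatives up to sign on which [eta] is 1, so that [ab]
    fixes them. *)
Definition evenres (i : 'I_m) : 'F_p := (i.+1.*2)%:R.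

Lemma evenres_val i : evenres i = (i.+1.*2)%N :> nat.
Proof. by rewrite nat_valFp // [X in (_ < X)%N]pE ltnS leq_double. Qed.

Lemma evenres_neq0 i : evenres i != 0.
Proof. by apply/eqP => /(congr1 (@nat_of_ord _)); rewrite evenres_val. Qed.

Lemma evenres_inj : injective evenres.
Proof.
move=> i j /(congr1 (@nat_of_ord _)); rewrite !evenres_val => e.
by apply: val_inj => /=; have := congr1 half e; rewrite !doubleK => -[].
Qed.

Lemma even_evenres d : d != 0 -> ~~ odd d -> exists i, d = evenres i.
Proof.
move=> d0 de; have dp := valFp p_prime d.
have dpos : (0 < d)%N by rewrite lt0n; apply: contraNneq d0 => e; apply/eqP; apply: val_inj.
have hd : (d./2.*2 = d)%N by have := odd_double_half d; rewrite (negbTE de).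
have lt : (d./2.-1 < m)%N by rewrite [X in (_ < X)%N]pE in dp; lia.
exists (Ordinal lt); apply: ord_inj; rewrite evenres_val /=; lia.
Qed.

Lemma odd_oppFp d : d != 0 -> odd (- d : 'F_p) = ~~ odd d.
Proof. by move=> d0; rewrite oppFp_val // oddB ?p_odd // ltnW // valFp. Qed.

Lemma ab_evenres i : ab (evenres i) = evenres i.
Proof.
rewrite /ab /eta (negbTE (evenres_neq0 i)) evenres_val -signr_odd odd_double.
by rewrite expr0 mul1r.
Qed.

Lemma rep_startp a al : rep evenres a al -> startp al.
Proof.
case/repP => h ai sec ha; have [aK _] := pmatchP _ _ h.
rewrite /startp h; apply/forallP => d; apply/implyP => d0; apply/existsP.
case: (boolP (odd d)) => od.
  have [i e] : exists i, - d = evenres i.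
    by apply: even_evenres; rewrite ?oppr_eq0 // odd_oppFp // od.
  by exists (a i); rewrite ha -e opprB addrCA subrr addr0.
have [i e] := even_evenres d0 od.
by exists (al (a i)); rewrite aK ha e addrAC subrr add0r.
Qed.

(** For a starter the map sending [x] to [x - al x] is onto, hence bijective; so
    [al x - x = evenres i] has a single solution, and this is [a i]. *)
Lemma startp_rep al : startp al -> exists2 a, rep evenres a al & forall b, rep evenres b al -> b = a.
Proof.
case/andP => h /forallP hs; have [aK aV] := pmatchP _ _ h.
have al0 : al 0 = 0 by have := aV 0; rewrite inE eqxx => /eqP.
pose df x := x - al x.
have sur d : exists x, df x == d.
  have [->|d0] := eqVneq d 0; first by exists 0; rewrite /df al0 subrr.
  by have := hs d; rewrite d0 => /existsP.
pose g d := xchoose (sur d).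
have gK : cancel g df by move=> d; apply/eqP; exact: (xchooseP (sur d)).
have [k kg gk] := injF_bij (can_inj gK).
have dfi : injective df.
  have e x : df x = k x by rewrite -{1}(gk x) gK.
  by move=> x y; rewrite !e; exact: (can_inj gk).
pose a : {ffun 'I_m -> 'F_p} := [ffun i => g (- evenres i)].
have aE i : al (a i) = a i + evenres i.
  have e := gK (- evenres i); rewrite /df in e.
  rewrite ffunE; set x := g _ in e *.
  by rewrite -[evenres i]opprK -e opprB addrCA subrr addr0.
have aD x : (x \in a @: [set: 'I_m]) = (x != 0) && ~~ odd (al x - x : 'F_p)%R.
  apply/imsetP/andP => [[i _ ->]|[x0 ev]].
    rewrite aE addrAC subrr add0r evenres_val odd_double; split=> //.
    apply: contraNneq (evenres_neq0 i) => e; have := aE i; rewrite e al0 add0r => <- //.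
  have ne : al x - x != 0 by rewrite subr_eq0 aV inE x0.
  have [i e] := even_evenres ne ev; exists i => //; apply: dfi.
  by rewrite ffunE gK /df -e opprB.
exists a; last first.
  move=> b /repP[_ _ _ hb]; apply/ffunP => i; apply: dfi.
  by rewrite /df hb aE !opprD !addrA !subrr.
apply/and5P; split=> //.
- apply/injectiveP => i j e; apply: evenres_inj; apply: (@addrI _ (a i)).
  by rewrite -aE e aE.
- by apply/subsetP => x; rewrite aD inE => /andP[].
- apply/forall_inP => x xu; rewrite !aD aK; move: (xu); rewrite inE => x0.
  have ax0 : al x != 0 by have := pmatch_in h x; rewrite xu inE.
  by rewrite x0 ax0 !andTb -[x - al x]opprB odd_oppFp // subr_eq0 aV inE x0.
- by apply/forallP => i; rewrite aE.
Qed.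

Lemma card_rep_even al : #|[set a | rep evenres a al]| = startp al.
Proof.
case: (boolP (startp al)) => [/startp_rep[a h u]|h].
  transitivity #|[set a]|; last exact: cards1.
  apply: eq_card => b; rewrite !inE.
  by apply/idP/eqP => [/u|->].
by apply/eqP; rewrite cards_eq0; apply/eqP/setP => a; rewrite !inE; apply: contraNF h => /rep_startp.
Qed.

Definition oddres : {set 'F_p} := [set x : 'F_p | odd x].

Lemma oddres_unit x : x \in oddres -> x != 0.
Proof. by rewrite inE => ox; apply: contraTneq ox => ->. Qed.

Lemma succ_val x : x \in oddres -> (x + 1 : 'F_p)%R = x.+1 :> nat.
Proof.
rewrite inE => ox; have := valFp p_prime x => xp.
rewrite -{1}(natFp x) natr1 nat_valFp // ltn_neqAle xp andbT.
by apply: contraTneq p_odd => <-; rewrite /= ox.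
Qed.

Lemma pred_val x : x != 0 -> (x - 1 : 'F_p)%R = x.-1 :> nat.
Proof.
move=> x0; have xpos : (0 < x)%N by rewrite lt0n; apply: contraNneq x0 => e; apply/eqP; apply: val_inj.
rewrite -{1}(natFp x) -(prednK xpos) -natr1 addrK nat_valFp //.
by apply: leq_ltn_trans (leq_pred _) _; exact: valFp.
Qed.

Lemma oddres_succ x : x \in oddres -> x + 1 \notin oddres /\ x + 1 != 0.
Proof.
move=> xo; have e := succ_val xo; split; first by rewrite inE e; move: xo; rewrite inE /= => ->.
by apply: contraTneq isT => e0; rewrite e0 in e.
Qed.

Lemma oddres_pred x : x != 0 -> x \notin oddres -> x - 1 \in oddres.
Proof.
move=> x0; rewrite !inE pred_val //.
have xpos : (0 < x)%N by rewrite lt0n; apply: contraNneq x0 => e; apply/eqP; apply: val_inj.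
by rewrite -{1}(prednK xpos) /= negbK.
Qed.

Definition consecf x := if x \in oddres then x + 1 else if x == 0 then 0 else x - 1.

Lemma consecfK : involutive consecf.
Proof.
move=> x; rewrite {2}/consecf; case: ifP => xo.
  have [/negbTE n1 /negbTE n2] := oddres_succ xo.
  by rewrite /consecf n1 n2 addrK.
case: eqVneq => [->|x0]; first by rewrite /consecf eqxx inE.
by rewrite /consecf oddres_pred ?xo // subrK.
Qed.

(* The starter-like matching {1, 2}, {3, 4}, ..., {p - 2, p - 1}. *)
Definition consec : {perm 'F_p} := perm (inv_inj consecfK).

Lemma consec_odd x : x \in oddres -> consec x = x + 1.
Proof. by rewrite permE /consecf => ->. Qed.

Lemma pmatch_consec : pmatch (units p) consec.
Proof.
apply/pmatchP; split=> x; first by rewrite !permE consecfK.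
rewrite permE inE negbK /consecf; case: ifP => xo.
  by rewrite (negbTE (oddres_unit xo)) -subr_eq0 addrAC subrr add0r oner_eq0.
case: (eqVneq x 0) => [->|x0]; first by rewrite eqxx.
by rewrite -subr_eq0 addrAC subrr add0r oppr_eq0 oner_eq0.
Qed.

Lemma sect_consec : sect consec oddres (units p).
Proof.
split; first by apply/subsetP => x /oddres_unit; rewrite inE.
move=> x xu; rewrite pmatch_in ?pmatch_consec //; split=> //.
move: xu; rewrite inE => x0; rewrite permE /consecf (negbTE x0).
case: ifP => xo; first by have [/negbTE] := oddres_succ xo.
by rewrite oddres_pred ?xo.
Qed.

Lemma card_oddres : #|oddres| = m.
Proof.
have [cK _] := pmatchP _ _ pmatch_consec.
have [_ sO] := sect_consec.
apply/eqP; rewrite -(eqn_pmul2l (isT : 0 < 2)%N) !mul2n -(card_units p_prime p_odd) -addnn; apply/eqP.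
rewrite -[RHS](cardsID oddres) (setIidPr (proj1 sect_consec)); congr (_ + _)%N.
rewrite -(card_imset _ (@perm_inj _ consec)); apply: eq_card => x.
rewrite -{1}(cK x) mem_imset; last exact: perm_inj.
rewrite in_setD; have [xu|xu] := boolP (x \in units p); first by have [_ ->] := sO _ xu; rewrite andbT.
rewrite andbF; apply/negbTE; apply: contra xu => /oddres_unit.
by rewrite -(pmatch_in pmatch_consec) inE.
Qed.

Lemma epsr_consec : epsr (@sgo _ 'F_p) consec = 1.
Proof.
rewrite (epsr_sect _ pmatch_consec sect_consec); last by case: (@tourn_sgo _ 'F_p).
rewrite -[RHS](pp1 _ oddres); apply: eq_pp => x y xo yo xy.
have key (u v : 'F_p) : u \in oddres -> v \in oddres -> (u < v)%N -> crs (@sgo _ 'F_p) consec u v = 1.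
  move=> uo vo uv; have uv' : (u.+1 < v)%N.
    rewrite ltn_neqAle uv andbT; move: uo vo; rewrite !inE => ou ov.
    by apply: contraTneq ov => <-; rewrite /= ou.
  rewrite /crs /sgo !consec_odd // !ltEord !succ_val // uv uv' !ltnS uv (ltnW uv) //.
case: (ltngtP x y) => [lt|lt|e]; first exact: key.
  by rewrite crs_sym ?key //; case: (@tourn_sgo _ 'F_p).
by rewrite (ord_inj e) eqxx in xy.
Qed.

(** Induction in steps of 2: the residue 1 begins its edge, since otherwise its partner would be 0;
    and if [k] begins an edge, then [k + 1] is taken and [k + 2] has to begin one. *)
Lemma rep1_odd a al : rep (fun _ => 1) a al -> a @: [set: 'I_m] = oddres.
Proof.
case/repP => h ai [AD sec] ha; have [aK aV] := pmatchP _ _ h.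
have succ x : x \in a @: [set: 'I_m] -> al x = x + 1 by case/imsetP => i _ ->; rewrite ha.
apply/esym/eqP; rewrite eqEcard card_oddres (card_imset _ ai) cardsT card_ord leqnn andbT.
apply/subsetP => x; rewrite inE; rewrite -{2}(natFp x); have := valFp p_prime x.
move: (nat_of_ord x) => k {x}; have [j] := ubnP k; elim: j k => // j IH [|[|k]] kj kp //= ok.
  have u1 : 1 \in units p by rewrite inE oner_eq0.
  apply: contraT => n1; have [mu1 m1] := sec _ u1; rewrite n1 in m1.
  have /eqP := succ _ m1; rewrite aK -subr_eq0 opprD addrCA subrr addr0 oppr_eq0.
  by move: mu1; rewrite inE => /negbTE ->.
have {IH}ik : k%:R \in a @: [set: 'I_m].
  by apply: IH; [exact: ltnW|exact: ltnW (ltnW kp)|move: ok; rewrite negbK].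
have u2 : k.+2%:R \in units p by rewrite inE natFp_neq0.
apply: contraT => n2; have [mu2 m2] := sec _ u2; rewrite n2 in m2.
have e := succ _ m2; rewrite aK in e.
have e2 : k.+2%:R = k%:R + 1 + 1 :> 'F_p by rewrite !natr1.
have e3 : al k.+2%:R = al k%:R by apply: (addIr 1); rewrite -e (succ _ ik) e2.
have /perm_inj/eqP := e3; rewrite e2 -subr_eq0 -[k%:R + 1 + 1]addrA [k%:R + _]addrC addrK.
by rewrite -(natrD _ 1 1) (negbTE (natFp_neq0 p_prime _)) // p_gt2.
Qed.

Lemma card_rep1 al : #|[set a | rep (fun _ => 1) a al]| = ((al == consec) * m`!)%N.
Proof.
have r1 a : rep (fun _ => 1) a consec = (a \in [set f in ffun_on (mem oddres) | injectiveb f]).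
  rewrite inE; apply/idP/andP => [h|[/ffun_onP fo fi]].
    have e := rep1_odd h; have [_ ai _ _] := repP h; split; last exact/injectiveP.
    by apply/ffun_onP => i; rewrite -e imset_f.
  have e : a @: [set: 'I_m] = oddres.
    apply/eqP; rewrite eqEcard card_imset; last exact/injectiveP.
    by rewrite cardsT card_ord card_oddres leqnn andbT; apply/subsetP => _ /imsetP[i _ ->]; exact: fo.
  have [OD sO] := sect_consec.
  apply/and5P; split=> //; rewrite ?e //; first exact: pmatch_consec.
    by apply/forall_inP => x xu; have [_ ->] := sO _ xu.
  by apply/forallP => i; rewrite consec_odd // -e imset_f.
have [->|ne] := eqVneq al consec.
  have := @card_inj_ffuns_on 'I_m 'F_p (mem oddres); rewrite card_oddres card_ord ffactnn mul1n => <-.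
  by apply: eq_card => a; rewrite [LHS]inE r1.
rewrite mul0n; apply/eqP; rewrite cards_eq0; apply/eqP/setP => a; rewrite !inE.
apply: contraNF ne => h; have e := rep1_odd h; have [_ ai _ _] := repP h.
apply/eqP; apply: (rep_inj h); rewrite r1 inE; apply/andP; split; last exact/injectiveP.
by apply/ffun_onP => i; rewrite -e imset_f.
Qed.

Lemma prodUE : prodU p = -1.
Proof.
rewrite -(wilsonFp p_prime) fact_prod natr_prod /prodU.
have e1 : p.-1.+1 = p by rewrite prednK // prime_gt0.
rewrite e1 big_mkcond /=.
have -> : \prod_(i : 'F_p) (if i \in units p then i else 1) =
   \prod_(i < (Zp_trunc (pdiv p)).+2) (fun k => if k == 0%N then 1 else k%:R : 'F_p) i.
  apply: eq_bigr => i _; rewrite inE -[i == 0](inj_eq val_inj) /= natFp.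
  by case: eqP.
have cast (M : nat) (F : nat -> 'F_p) : M = p -> \prod_(i < M) F i = \prod_(0 <= i < p) F i.
  by move=> ->; rewrite big_mkord.
rewrite (cast _ (fun k => if k == 0%N then 1 else k%:R) (Fp_cast p_prime)).
rewrite big_ltn ?prime_gt0 //= mul1r; rewrite big_nat [RHS]big_nat.
by apply: eq_bigr => k /andP[k0 _]; rewrite eqn0Ngt k0.
Qed.

Lemma prod_evenres : \prod_i evenres i = 2%:R ^+ m * m`!%:R.
Proof.
have -> : 2%:R ^+ m = \prod_(i < m) 2%:R :> 'F_p by rewrite prodr_const card_ord.
rewrite fact_prod big_add1 /= big_mkord natr_prod -big_split /=.
by apply: eq_bigr => i _; rewrite /evenres -mul2n natrM.
Qed.

(** The units are the even representatives and their negatives, so the left side is the product of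
    all units. *)
Lemma prod_evenres_sq : (-1) ^+ m * (\prod_i evenres i) ^+ 2 = -1.
Proof.
rewrite -[RHS]prodUE /prodU.
pose E := evenres @: [set: 'I_m].
have sE : sect (fun x : 'F_p => - x) E (units p).
  have EE x : (x \in E) = (x != 0) && ~~ odd x.
    apply/imsetP/andP => [[i _ ->]|[x0 ev]]; last by have [i ->] := even_evenres x0 ev; exists i.
    by rewrite evenres_neq0 evenres_val odd_double.
  split; first by apply/subsetP => x; rewrite EE inE => /andP[].
  by move=> x; rewrite !EE !inE oppr_eq0 => x0; rewrite x0 odd_oppFp.
rewrite (prod_sect _ (@opprK _) sE) big_imset /=; last by move=> i j _ _; exact: evenres_inj.
have -> : (-1) ^+ m = \prod_(i < m) (-1) :> 'F_p by rewrite prodr_const card_ord.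
rewrite expr2 -!big_split /=.
by apply: eq_big => i; rewrite ?inE // => _; rewrite mulN1r mulrN.
Qed.

(** For [evenres] every starter is represented once; for [s = 1] the matching [consec] is
    represented [m!] times. The sums of [shiftprod] agree, which gives [T = (-1) ^ m m! de], where
    [de = 2 ^ m m!]. *)
Lemma starter_sum_modp : (starter_sum p)%:~R = - 2%:R ^+ m :> 'F_p.
Proof.
have pm : p.-1 = m.*2 by rewrite {1}pE.
set T : 'F_p := _%:~R.
have s1 := sum_rep p_prime p_odd evenres_neq0.
have s2 := sum_rep p_prime p_odd (fun _ : 'I_m => oner_neq0 'F_p).
rewrite (sum_shiftprod p_prime pm _ (fun _ => 1)) in s1.
have t1 : \sum_al (epsr (@sgo _ 'F_p) al)%:~R * #|[set a | rep evenres a al]|%:R = T.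
  rewrite /T starter_sumE rmorph_sum [RHS]big_mkcond /=; apply: eq_bigr => al _.
  by rewrite card_rep_even; case: (startp al); rewrite ?mulr1 ?mulr0.
have t2 : \sum_al (epsr (@sgo _ 'F_p) al)%:~R * #|[set a | rep (fun _ => 1) a al]|%:R = m`!%:R :> 'F_p.
  rewrite (bigD1 consec) //= big1 ?addr0; first by rewrite card_rep1 eqxx mul1n epsr_consec mul1r.
  by move=> al /negbTE ne; rewrite card_rep1 ne mulr0.
rewrite t1 in s1; rewrite t2 in s2.
(* The representative 1 is odd, so [ab 1 = -1]. *)
have a1 : \prod_(i < m) ab (1 : 'F_p) = (-1) ^+ m.
  rewrite prodr_const card_ord; congr (_ ^+ _); rewrite /ab /eta oner_eq0 mulr1.
  by rewrite -[1]/(1%:R) nat_valFp // prime_gt1.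
rewrite a1 in s2; rewrite (eq_bigr _ (fun i _ => ab_evenres i)) in s1.
set S := \sum_a _ in s1 s2; set de := \prod_i evenres i in s1.
have QP : prodU p * ppU p != 0 by rewrite mulf_neq0 ?prodU_neq0 ?ppU_neq0.
have sS : S = (-1) ^+ m * (prodU p * ppU p * m`!%:R).
  by rewrite -s2 mulrCA -expr2 sqrr_sign mulr1.
have eT : T = (-1) ^+ m * m`!%:R * de.
  apply: (mulfI QP); rewrite -s1 sS; ring.
have two2 : 2%:R ^+ m * 2%:R ^+ m = 1 :> 'F_p.
  have n2 : 2%:R != 0 :> 'F_p by rewrite natFp_neq0 // p_gt2.
  apply: (mulfI n2); rewrite mulr1 -exprD addnn -exprS -pE.
  by have := expf_card (2%:R : 'F_p); rewrite card_Fp.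
have eT2 : T * 2%:R ^+ m = -1.
  transitivity ((-1) ^+ m * (de * (2%:R ^+ m * m`!%:R))); first by rewrite eT; ring.
  by rewrite -prod_evenres -expr2; exact: prod_evenres_sq.
transitivity (T * (2%:R ^+ m * 2%:R ^+ m)); first by rewrite two2 mulr1.
by rewrite mulrA eT2 mulN1r.
Qed.

End StarterSum.

(** * Complete graph with p + 1 vertices *)

Section MoreOneFactorizations.
Variable V : finType.
Implicit Types (F : {set {perm V}}) (s : V -> V -> int) (mu g : {perm V}).

(** The matchings already cover all edges at [x]; with at most [#|V| - 1] of them, none is covered
    twice. *)
Lemma onef_count F : (forall mu, mu \in F -> pmatch [set: V] mu) ->
  (forall x y, x != y -> exists2 mu, mu \in F & mu x = y) ->
  (#|F| <= #|V|.-1)%N -> onef F.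
Proof.
move=> h1 h2 cF; apply: onefP => // x.
have le : (#|F| <= #|(fun mu : {perm V} => mu x) @: F|)%N.
  apply: leq_trans cF _; rewrite -(cardsC1 x); apply: subset_leq_card.
  apply/subsetP => y; rewrite !inE eq_sym => /h2[mu hm <-]; exact: imset_f.
have /imset_injP inj : #|(fun mu : {perm V} => mu x) @: F| == #|F|.
  by rewrite eqn_leq leq_imset_card.
by move=> mu nu hm hn e; apply: inj.
Qed.

Lemma pmatch_conj mu g : pmatch [set: V] (mu ^ g)%g = pmatch [set: V] mu.
Proof.
have e x : (mu ^ g)%g x = g (mu (g^-1%g x)) by rewrite -{1}(permKV g x) permJ.
apply/pmatchP/pmatchP => -[h1 h2]; split=> x.
- by have := h1 (g x); rewrite !permJ => /perm_inj.
- by have := h2 (g x); rewrite permJ (inj_eq perm_inj) !inE.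
- by rewrite !e permK h1 permKV.
- by rewrite e -{2}(permKV g x) (inj_eq perm_inj) h2 !inE.
Qed.

Lemma epsr_conj s mu g : antisym s -> pmatch [set: V] mu ->
  epsr s (mu ^ g)%g = epsr (fun x y => s (g x) (g y)) mu.
Proof.
move=> sa hm; have e : (mu ^ g)%g = relabel (permK g) (permKV g) mu.
  by apply/permP => x; rewrite -(permKV g x) relabelE permJ.
by rewrite e epsr_relabel.
Qed.

Lemma epsr_invar s mu g : antisym s -> pmatch [set: V] mu -> (forall x y, s (g x) (g y) = s x y) ->
  epsr s (mu ^ g)%g = epsr s mu.
Proof.
move=> sa hm inv; rewrite epsr_conj //; apply: eq_pp => x y _ _ _.
by rewrite /crs !inv.
Qed.

Lemma epsr_odd s mu n : tourn s -> pmatch [set: V] mu -> odd n -> epsr s mu ^+ n = epsr s mu.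
Proof.
move=> ts hm on; rewrite -(odd_double_half n) on add1n exprS -mul2n exprM expr2.
by rewrite epsr_sq // expr1n mulr1.
Qed.

Lemma burnside_onef (G : {group {perm V}}) s : (0 < #|V|)%N -> ~~ odd #|V| -> tourn s ->
  (#|G| %| \sum_(g in G) \sum_(F | onef F && (F :^ g == F)%g) weight s F)%Z.
Proof.
move=> V0 Vev ts; pose X := [set F : {set {perm V}} | onef F].
have := @weighted_burnside _ _ 'Js%act G X (weight s).
have -> : \sum_(g in G) \sum_(F | onef F && (F :^ g == F)%g) weight s F =
    \sum_(g in G) \sum_(F in X | ('Js%act F g == F)) weight s F.
  by apply: eq_bigr => g _; apply: eq_bigl => F; rewrite inE.
apply.
  apply/subsetP => g _; rewrite !inE /=; apply/subsetP => F; rewrite !inE => hF.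
  by have [] := weight_conj g hF V0 Vev ts.
by move=> F g; rewrite inE => hF _; have [_] := weight_conj g hF V0 Vev ts.
Qed.

Lemma fix_conj s (g u : {perm V}) : (0 < #|V|)%N -> ~~ odd #|V| -> tourn s ->
  \sum_(F | onef F && (F :^ (g ^ u) == F)%g) weight s F
  = \sum_(F | onef F && (F :^ g == F)%g) weight s F.
Proof.
move=> V0 Vev ts; rewrite (reindex_inj (@conjsg_inj _ u)) /=; apply: eq_big => F.
  have -> : onef (F :^ u)%g = onef F.
    apply/idP/idP => hF; last by have [] := weight_conj u hF V0 Vev ts.
    by have [] := weight_conj u^-1%g hF V0 Vev ts; rewrite conjsgK.
  by rewrite -conjsgM -conjgC conjsgM (inj_eq (@conjsg_inj _ u)).
case/andP => hF _; have hF' : onef F.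
  by have [] := weight_conj u^-1%g hF V0 Vev ts; rewrite conjsgK.
by have [] := weight_conj u hF' V0 Vev ts.
Qed.

End MoreOneFactorizations.

Section EtaProduct.
Variable p : nat.
Hypotheses (p_prime : prime p) (p_odd : odd p).
Local Notation m := ((p - 1) %/ 2)%N.

Lemma prod_eta : \prod_(x in units p) eta x = (-1) ^+ m.
Proof.
pose E := [set x : 'F_p | (x != 0) && ~~ odd x].
have sE : sect (fun x : 'F_p => - x) E (units p).
  split; first by apply/subsetP => x; rewrite !inE => /andP[].
  by move=> x; rewrite !inE oppr_eq0 => x0; rewrite x0 odd_oppFp.
rewrite (prod_sect _ (@opprK _) sE) (eq_bigr (fun _ => -1)).
  rewrite prodr_const; congr (_ ^+ _).
  have -> : E = @evenres p @: [set: 'I_m].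
    apply/setP => x; rewrite inE; apply/andP/imsetP => [[x0 ev]|[i _ ->]].
      by have [i ->] := even_evenres p_prime p_odd x0 ev; exists i.
    by rewrite evenres_neq0 // evenres_val // odd_double.
  by rewrite card_imset ?cardsT ?card_ord //; exact: evenres_inj.
by move=> x; rewrite inE => /andP[x0 _]; rewrite etaN // mulrN eta_sq.
Qed.

Lemma startp_pmatch (al : {perm 'F_p}) : startp al -> pmatch (units p) al.
Proof. by case/andP. Qed.

Lemma startp0 (al : {perm 'F_p}) : startp al -> al 0 = 0.
Proof. by case/startp_pmatch/pmatchP => _ h; apply/eqP; rewrite h inE eqxx. Qed.

Lemma startp_eq0 (al : {perm 'F_p}) x : startp al -> (al x == 0) = (x == 0).
Proof. by move=> h; rewrite -{1}(startp0 h) (inj_eq perm_inj). Qed.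

Lemma startp_ex (al : {perm 'F_p}) d : startp al -> d != 0 -> exists x, x - al x = d.
Proof. by case/andP => _ /forallP/(_ d) h d0; rewrite d0 in h; have /existsP[x /eqP] := h; exists x. Qed.

Lemma starter_of_copy (V : finType) (j : 'F_p -> V) (T : 'F_p -> {perm V}) (nu : {perm V}) :
  injective j -> (forall h x, T h (j x) = j (x + h)) -> pmatch [set: V] nu ->
  (forall y, nu (j 0) != j y) -> (forall x, x != 0 -> exists y, nu (j x) = j y) ->
  (forall d, d != 0 -> exists h, (nu ^ T h)%g (j 0) = j d) ->
  exists2 al, startp al & forall x, x != 0 -> nu (j x) = j (al x).
Proof.
move=> ji Tj /pmatchP[nK nV] nu0 nuj nuT.
pose f x := odflt 0 [pick y | nu (j x) == j y].
have f0 : f 0 = 0 by rewrite /f; case: pickP => // y; rewrite (negbTE (nu0 y)).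
have fE x : x != 0 -> nu (j x) = j (f x).
  move=> /nuj[y e]; rewrite /f; case: pickP => [z /eqP //|/(_ y)].
  by rewrite e eqxx.
have fn x : x != 0 -> f x != 0.
  by move=> x0; apply/eqP => e; have := nu0 x; rewrite -e -fE // nK eqxx.
have fK : involutive f.
  move=> x; have [->|x0] := eqVneq x 0; first by rewrite !f0.
  by apply: ji; rewrite -fE ?fn // -fE.
exists (perm (inv_inj fK)) => [|x x0]; last by rewrite permE fE.
apply/andP; split.
  apply/pmatchP; split=> x; rewrite !permE ?fK // inE negbK.
  have [->|x0] := eqVneq x 0; first by rewrite f0 eqxx.
  by rewrite -(inj_eq ji) -fE // nV inE.
apply/forallP => d; apply/implyP => d0; apply/existsP.
(* A translate by [h] joining [j 0] and [j (- d)] means that [nu] joins [j (- h)] and [j (- d - h)],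
   points with difference [d]. *)
have [|h] := nuT (- d); first by rewrite oppr_eq0.
have -> : j 0 = T h (j (- h)) by rewrite Tj addNr.
have [h0|h0] := eqVneq (- h) 0.
  have Th x : T h (j x) = j x by rewrite Tj -[h]opprK h0 subr0.
  by rewrite h0 permJ -[X in _ = X]Th => /perm_inj /eqP; rewrite (negbTE (nu0 _)).
rewrite permJ fE // Tj => /ji e; exists (- h); rewrite permE.
by apply/eqP; rewrite -[d]opprK -e; ring.
Qed.

End EtaProduct.

(** Reads off the congruence from Burnside sums in which the identity gives [a] and each of the
    other [q - 1] elements gives [b]. *)
Lemma dvdz_add_pred (q : nat) (a b : int) : (0 < q)%N ->
  (q %| a + b *+ q.-1)%Z -> (a = b %[mod q])%Z.
Proof.
case: q => // q _ hd; apply/eqP; rewrite eqz_mod_dvd.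
have -> : a - b = a + b *+ q - b *+ q.+1 by rewrite mulrSr; ring.
by rewrite rpredB // -mulr_natr natz dvdz_mull.
Qed.

Section PlusOne.
Variable p : nat.
Hypotheses (p_prime : prime p) (p_odd : odd p).
Local Notation m := ((p - 1) %/ 2)%N.
Local Notation V := (option 'F_p).
Implicit Types (h k : 'F_p) (al : {perm 'F_p}) (mu : {perm V}) (F : {set {perm V}}).

Definition tr h : {perm V} := perm (inj_omap (@addIr _ h)).

Lemma trS h x : tr h (Some x) = Some (x + h). Proof. by rewrite permE. Qed.
Lemma trN h : tr h None = None. Proof. by rewrite permE. Qed.

Lemma trD h k : (tr h * tr k)%g = tr (h + k).
Proof. by apply/permP => -[x|]; rewrite permM ?trS ?trN ?addrA. Qed.

Lemma tr0 : tr 0 = 1%g.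
Proof. by apply/permP => -[x|]; rewrite perm1 ?trS ?trN ?addr0. Qed.

Lemma trX h j : (tr h ^+ j)%g = tr (h *+ j).
Proof. by elim: j => [|j IH]; rewrite ?mulr0n ?tr0 // expgSr IH trD mulrSr. Qed.

Lemma tr_group_set : group_set [set tr h | h : 'F_p].
Proof.
apply/group_setP; split; first by apply/imsetP; exists 0; rewrite ?tr0.
move=> _ _ /imsetP[h _ ->] /imsetP[k _ ->]; rewrite trD; exact: imset_f.
Qed.
Definition trG : {group {perm V}} := Group tr_group_set.

Lemma trGP g : g \in trG -> exists h, g = tr h.
Proof. by rewrite -[_ \in _]/(g \in [set tr h | h : 'F_p]) => /imsetP[h _ ->]; exists h. Qed.

Lemma inj_tr : injective tr.
Proof. by move=> h k e; have := trS h 0; rewrite e trS !add0r => -[]. Qed.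

Lemma card_trG : #|trG| = p.
Proof. by rewrite card_imset ?card_Fp //; exact: inj_tr. Qed.

(* This sign is invariant under translations, and the vertex [None] is above all others. *)
Definition sgO (x y : V) : int :=
  match x, y with
  | Some x, Some y => eta (y - x)
  | Some _, None => 1
  | None, Some _ => -1
  | None, None => 0
  end.

Lemma tourn_sgO : tourn sgO.
Proof.
have [sa s1] := tourn_eta p_prime p_odd.
split=> [[x|] [y|]|[x|] [y|]] //; first exact: sa.
by move=> xy; apply: s1; apply: contraNneq xy => ->.
Qed.

Lemma sgO_tr h x y : sgO (tr h x) (tr h y) = sgO x y.
Proof. by case: x y => [x|] [y|]; rewrite ?trS ?trN //= opprD addrACA subrr addr0. Qed.

Lemma card_optFp : #|{: V}| = p.+1.
Proof. by rewrite card_option card_Fp. Qed.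

Definition tr_stable F := [forall h, (F :^ tr h == F)%g].

(** Every nonzero translation generates the whole group, as [p] is prime. *)
Lemma tr_stable_fix h F : h != 0 -> (F :^ tr h == F)%g = tr_stable F.
Proof.
move=> h0; apply/idP/forallP => [hF k|/(_ h)//].
have -> : tr k = (tr h ^+ (k / h : 'F_p)%R)%g.
  by rewrite trX -mulr_natr natFp mulrC divfK.
apply/eqP/normP; apply: groupX; apply/normP; exact/eqP.
Qed.

Lemma signed_count_tr_stable : (signed_count (p + 1) = \sum_(F | onef F && tr_stable F) weight sgO F %[mod p])%Z.
Proof.
have V0 : (0 < #|{: V}|)%N by rewrite card_optFp.
have Vev : ~~ odd #|{: V}| by rewrite card_optFp /= p_odd.
rewrite (signed_count_on (V := V) (s := sgO)) ?addn1 ?card_optFp //; last exact: tourn_sgO.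
  have := burnside_onef trG V0 Vev tourn_sgO; rewrite card_trG (bigD1 1%g) ?group1 //=.
  set I := \sum_(F | onef F && tr_stable F) _.
  rewrite [X in _ + X](eq_bigr (fun _ => I)); last first.
    move=> g /andP[/trGP[h ->] h1]; apply: eq_bigl => F; congr (_ && _).
    by apply: tr_stable_fix; apply: contraNneq h1 => ->; rewrite tr0.
  rewrite sumr_const (_ : #|_| = p.-1); last first.
    have e := cardD1 1%g trG; rewrite card_trG group1 in e.
    transitivity #|[predD1 trG & 1%g]|; last exact: esym (congr1 predn e).
    by apply: eq_card => g; rewrite !inE andbC.
  rewrite (eq_bigl (@onef V)); last by move=> F; rewrite conjsg1 eqxx andbT.
  by rewrite -/(cnt sgO); apply: dvdz_add_pred; exact: prime_gt0.
by rewrite /= p_odd.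
Qed.

Section Cone.
Variable al : {perm 'F_p}.

Definition optp : {perm V} := perm (inj_omap (@perm_inj _ al)).

Lemma optpS x : optp (Some x) = Some (al x). Proof. by rewrite permE. Qed.
Lemma optpN : optp None = None. Proof. by rewrite permE. Qed.

(** For a starter [al], which fixes 0, this is [al] on the units together with the edge joining
    [None] and [Some 0]. *)
Definition cone : {perm V} := (optp * tperm None (Some 0))%g.

Definition rotations : {set {perm V}} := [set (cone ^ tr h)%g | h : 'F_p].

Lemma mem_cone : cone \in rotations.
Proof. by apply/imsetP; exists 0; rewrite // tr0 conjg1. Qed.

Hypothesis hal : startp al.

Lemma coneN : cone None = Some 0. Proof. by rewrite permM optpN tpermL. Qed.

Lemma cone0 : cone (Some 0) = None.
Proof. by rewrite permM optpS (startp0 hal) tpermR. Qed.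

Lemma coneS x : x != 0 -> cone (Some x) = Some (al x).
Proof.
move=> x0; rewrite permM optpS tpermD // eq_sym (inj_eq (@Some_inj _)).
by rewrite (startp_eq0 _ hal).
Qed.

Lemma pmatch_cone : pmatch [set: V] cone.
Proof.
have [aK aV] := pmatchP _ _ (startp_pmatch hal).
apply/pmatchP; split=> -[x|]; rewrite ?inE ?coneN ?cone0 //.
  have [->|x0] := eqVneq x 0; first by rewrite cone0 coneN.
  by rewrite !coneS ?(startp_eq0 _ hal) // aK.
have [->|x0] := eqVneq x 0; first by rewrite cone0.
by rewrite coneS // (inj_eq (@Some_inj _)) aV inE x0.
Qed.

(** Against the edges of [al], the edge from [None] to [Some 0] contributes the product of [eta x]
    over all units, and [x], [- x] together give -1. *)
Lemma epsr_cone : epsr sgO cone = (-1) ^+ m * epsr (@sgo _ 'F_p) al.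
Proof.
have hp := startp_pmatch hal; have [aK aV] := pmatchP _ _ hp.
pose A := esec al; have [AU sA] := sect_esec hp; rewrite -/A in AU sA.
have A0 x : x \in A -> x != 0 by move/(subsetP AU); rewrite inE.
have iS x : (Some x \in Some @: A) = (x \in A) by rewrite mem_imset //; exact: Some_inj.
have iN : (None \in Some @: A) = false by apply/negP => /imsetP[].
have sB : sect cone (None |: Some @: A) [set: V].
  split; first exact: subsetT.
  case=> [x|] _; rewrite inE; split=> //; last by rewrite coneN !inE eqxx /= iS; apply/negbTE/negP => /A0; rewrite eqxx.
  rewrite !inE /= iS; case: (eqVneq x 0) => [->|x0].
    by rewrite cone0 eqxx /=; apply/esym/negP => /A0; rewrite eqxx.
  rewrite coneS //= iS; have xu : x \in units p by rewrite inE.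
  by have [_ ->] := sA _ xu.
have [sa _] := tourn_sgO.
rewrite (epsr_sect sa pmatch_cone sB) pp_setU1 ?iN //; last by move=> x y _ _; exact: crs_sym.
rewrite -(epsr_eta p_prime p_odd hp) -(prod_eta p_prime p_odd); congr (_ * _).
  rewrite (prod_sect _ aK (sect_esec hp)) big_imset /=; last by move=> x y _ _ [].
  apply: eq_bigr => x /A0 x0; rewrite /crs coneN coneS //= !subr0; ring.
rewrite pp_imset; [|by move=> x y _ _ []|by move=> x y _ _; exact: crs_sym].
by apply: eq_pp => x y /A0 x0 /A0 y0 _; rewrite /crs !coneS.
Qed.

Lemma rotations_N h : (cone ^ tr h)%g None = Some h.
Proof. by rewrite -{1}(trN h) permJ coneN trS add0r. Qed.

Lemma rotations_S h x : (cone ^ tr h)%g (Some (x + h)) = tr h (cone (Some x)).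
Proof. by rewrite -trS permJ. Qed.

Lemma rotation_inj : injective (fun h => (cone ^ tr h)%g).
Proof. by move=> h k e; have := rotations_N h; rewrite e rotations_N => -[]. Qed.

Lemma pmatch_rotations mu : mu \in rotations -> pmatch [set: V] mu.
Proof. by case/imsetP => h _ ->; rewrite pmatch_conj pmatch_cone. Qed.

Lemma onef_rotations : onef rotations.
Proof.
apply: onef_count; first exact: pmatch_rotations.
  have half h : exists2 mu, mu \in rotations & mu None = Some h.
    by exists (cone ^ tr h)%g; [exact: imset_f|exact: rotations_N].
  move=> [x|] [y|] //= xy.
    have [z e] : exists z, z - al z = x - y.
      by apply: startp_ex => //; rewrite subr_eq0; apply: contraNneq xy => ->.
    have z0 : z != 0.
      apply: contraNneq xy => z0; move: e; rewrite z0 (startp0 hal) subrr => /esym/eqP.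
      by rewrite subr_eq0 => /eqP ->.
    exists (cone ^ tr (x - z))%g; first exact: imset_f.
    have -> : Some x = Some (z + (x - z)) by rewrite addrCA subrr addr0.
    rewrite rotations_S coneS // trS; congr Some.
    by rewrite -[al z](subKr z) e; ring.
  have [mu hm e] := half x; exists mu => //.
  by have [mK _] := pmatchP _ _ (pmatch_rotations hm); rewrite -e mK.
by rewrite card_optFp /=; apply: leq_trans (leq_imset_card _ _) _; rewrite card_Fp.
Qed.

Lemma tr_stable_rotations : tr_stable rotations.
Proof.
apply/forallP => k; rewrite eqEcard cardJg leqnn andbT; apply/subsetP => _ /imsetP[_ /imsetP[h _ ->] ->].
by rewrite -conjgM trD; exact: imset_f.
Qed.

Lemma weight_rotations : weight sgO rotations = (-1) ^+ m * epsr (@sgo _ 'F_p) al.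
Proof.
have [sa _] := tourn_sgO.
rewrite /weight big_imset /=; last by move=> h k _ _; exact: rotation_inj.
rewrite (eq_bigr (fun _ => epsr sgO cone)) => [|h _]; last first.
  by apply: epsr_invar => //; [exact: pmatch_cone|exact: sgO_tr].
rewrite prodr_const card_Fp // (epsr_odd tourn_sgO pmatch_cone p_odd).
exact: epsr_cone.
Qed.

End Cone.

Lemma rotations_inj : {in [set al | startp al] &, injective rotations}.
Proof.
move=> al be; rewrite !inE => ha hb e.
have el : cone al = cone be.
  by apply: (onef_uniq (onef_rotations hb) _ (mem_cone be) (x := None)); rewrite -?e ?mem_cone ?coneN.
apply/permP => x; have [->|x0] := eqVneq x 0; first by rewrite !startp0.
by apply: Some_inj; rewrite -(coneS ha x0) -(coneS hb x0) el.
Qed.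

(** The factor joining [None] and [Some 0] determines [F]: its [p] translates are distinct and there
    are [p] factors. *)
Lemma tr_stable_ex F : onef F -> tr_stable F -> exists2 al, startp al & F = rotations al.
Proof.
move=> hF /forallP iF.
have [mu hm muN] : exists2 mu, mu \in F & mu None = Some 0 by exact: onef_ex.
have pm := onef_pmatch hF hm; have [mK mV] := pmatchP _ _ pm.
have mu0 : mu (Some 0) = None by rewrite -muN mK.
have hfam h : (mu ^ tr h)%g \in F by rewrite -{1}(eqP (iF h)) memJ_conjg.
have [|x x0|d d0|al ha muS] := @starter_of_copy _ _ (@Some 'F_p) tr mu (@Some_inj _) trS pm.
- by move=> y; rewrite mu0.
- case e : (mu (Some x)) => [y|]; first by exists y.
  by case/eqP: x0; apply: Some_inj; rewrite -[Some x]mK e muN.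
- have [nu hn nu0] : exists2 nu, nu \in F & nu (Some 0) = Some d.
    by apply: onef_ex => //; rewrite (inj_eq (@Some_inj _)) eq_sym.
  have [_ nV] := pmatchP _ _ (onef_pmatch hF hn).
  case eN : (nu None) => [h|]; last by have := nV None; rewrite eN eqxx inE.
  exists h; suff -> : (mu ^ tr h)%g = nu by [].
  apply: (onef_uniq hF (hfam h) hn (x := None)).
  by rewrite eN -{1}(trN h) permJ muN trS add0r.
exists al => //.
have el : cone al = mu.
  apply/permP => -[x|]; last by rewrite coneN.
  have [->|x0] := eqVneq x 0; first by rewrite cone0.
  by rewrite coneS // muS.
apply/esym/eqP; rewrite eqEcard; apply/andP; split.
  by apply/subsetP => _ /imsetP[h _ ->]; rewrite el.
by rewrite !card_onef ?card_optFp ?onef_rotations.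
Qed.

Lemma signed_count_succ :
  (signed_count (p + 1) = (-1) ^+ m * starter_sum p %[mod p])%Z.
Proof.
rewrite signed_count_tr_stable starter_sumE mulr_sumr; congr (_ %% _)%Z.
rewrite (eq_bigl (fun F => F \in rotations @: [set al | startp al])).
  rewrite big_imset /=; last exact: rotations_inj.
  apply: eq_big => al; rewrite inE // => ha.
  by rewrite weight_rotations.
move=> F; apply/andP/imsetP => [[hF iF]|[al]].
  by have [al ha ->] := tr_stable_ex hF iF; exists al; rewrite ?inE.
by rewrite inE => ha ->; rewrite (onef_rotations ha) tr_stable_rotations.
Qed.

End PlusOne.

(** * Complete graph with 2p vertices *)

Lemma conj_fix_mod (gT : finGroupType) q (g : gT) (F : {set gT}) :
  prime q -> (g ^+ q = 1)%g -> (F :^ g = F)%g -> #|F| = #|[set x in F | (x ^ g == x)%g]| %[mod q].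
Proof.
move=> q_prime gX gF.
have pg : (q.-group <[g]>)%g.
  by apply: (@pnat_dvd _ q); rewrite ?pnat_id // order_dvdn gX.
have ac : [acts <[g]>%g, on F | 'J].
  by rewrite cycle_subG !inE /=; apply/subsetP => x xF; rewrite inE /= -gF memJ_conjg.
rewrite (pgroup_fix_mod pg ac) afix_cycle; congr (_ %% _)%N; apply: eq_card => x.
by rewrite !inE sub1set inE.
Qed.

Lemma pred_double n : (0 < n)%N -> (n.-1 + n = (2 * n).-1)%N.
Proof. lia. Qed.

(** * Translations of two copies and their fixed one-factorizations *)

Section TwoCopies.
Variable p : nat.
Hypotheses (p_prime : prime p) (p_odd : odd p).
Local Notation m := ((p - 1) %/ 2)%N.
Local Notation V := ('F_p + 'F_p)%type.
Implicit Types (h k t : 'F_p) (al be : {perm 'F_p}) (mu nu : {perm V}) (F : {set {perm V}}).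

Definition summap (f g : 'F_p -> 'F_p) (x : V) : V :=
  match x with inl x => inl (f x) | inr y => inr (g y) end.

Lemma summap_inj f g : injective f -> injective g -> injective (summap f g).
Proof. by move=> fi gi [x|x] [y|y] //= [] => [/fi|/gi] ->. Qed.

Definition sump al be : {perm V} := perm (summap_inj (@perm_inj _ al) (@perm_inj _ be)).

Lemma sumpL al be x : sump al be (inl x) = inl (al x). Proof. by rewrite permE. Qed.
Lemma sumpR al be y : sump al be (inr y) = inr (be y). Proof. by rewrite permE. Qed.

Definition shift h : {perm 'F_p} := perm (addIr h).

Lemma shiftE h x : shift h x = x + h. Proof. by rewrite permE. Qed.

Definition dtr h k := sump (shift h) (shift k).
#[global] Arguments dtr (h k)%_R.

Lemma dtrL h k x : dtr h k (inl x) = inl (x + h). Proof. by rewrite sumpL shiftE. Qed.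
Lemma dtrR h k y : dtr h k (inr y) = inr (y + k). Proof. by rewrite sumpR shiftE. Qed.

Lemma dtrL0 h k : dtr h k (inl 0) = inl h. Proof. by rewrite dtrL add0r. Qed.

Lemma dtrD h k h' k' : (dtr h k * dtr h' k')%g = dtr (h + h') (k + k').
Proof. by apply/permP => -[x|x]; rewrite permM ?dtrL ?dtrR addrA. Qed.

Lemma dtr0 : dtr 0 0 = 1%g.
Proof. by apply/permP => -[x|x]; rewrite perm1 ?dtrL ?dtrR addr0. Qed.

Lemma dtrX h k j : (dtr h k ^+ j)%g = dtr (h *+ j) (k *+ j).
Proof. by elim: j => [|j IH]; rewrite ?mulr0n ?dtr0 // expgSr IH dtrD !mulrSr. Qed.

Lemma dtr_group_set : group_set [set dtr q.1 q.2 | q : 'F_p * 'F_p].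
Proof.
apply/group_setP; split; first by apply/imsetP; exists (0, 0); rewrite ?dtr0.
move=> _ _ /imsetP[[h k] _ ->] /imsetP[[h' k'] _ ->]; rewrite dtrD.
by apply/imsetP; exists (h + h', k + k').
Qed.
Definition dtrG : {group {perm V}} := Group dtr_group_set.

Lemma inj_dtr : injective (fun q : 'F_p * 'F_p => dtr q.1 q.2).
Proof.
move=> [h k] [h' k'] /= e.
have := dtrL h k 0; have := dtrR h k 0; rewrite e dtrL dtrR !add0r.
by move=> -[->] [->].
Qed.

Lemma card_dtrG : #|dtrG| = (p ^ 2)%N.
Proof. by rewrite card_imset ?card_prod ?card_Fp ?mulnn //; exact: inj_dtr. Qed.

Lemma card_V2 : #|{: V}| = (2 * p)%N.
Proof. by rewrite card_sum card_Fp // mul2n addnn. Qed.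

Lemma V2_gt0 : (0 < #|{: V}|)%N.
Proof. rewrite card_V2 muln_gt0; exact: prime_gt0. Qed.

Lemma V2_even : ~~ odd #|{: V}|.
Proof. by rewrite card_V2 mul2n odd_double. Qed.

(** Invariant under independent translations of the two copies; the first copy lies below the
    second. *)
Definition sgD (x y : V) : int :=
  match x, y with
  | inl x, inl y => eta (y - x)
  | inr x, inr y => eta (y - x)
  | inl _, inr _ => 1
  | inr _, inl _ => -1
  end.

Lemma tourn_sgD : tourn sgD.
Proof.
have [sa s1] := tourn_eta p_prime p_odd.
split=> [[x|x] [y|y]|[x|x] [y|y]] //; first [exact: sa | move=> xy; apply: s1].
  by apply: contraNneq xy => ->.
by apply: contraNneq xy => ->.
Qed.

Lemma sgD_dtr h k x y : sgD (dtr h k x) (dtr h k y) = sgD x y.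
Proof. by case: x y => [x|x] [y|y]; rewrite ?dtrL ?dtrR //= opprD addrACA subrr addr0. Qed.

Lemma no_fpf al : pmatch [set: 'F_p] al -> False.
Proof.
move=> pa; have sa := introT (sectTP _ _) (sect_esec pa).
by have := card_sectT pa sa; rewrite card_Fp // => e; move: p_odd; rewrite e odd_double.
Qed.

Definition fixsum h k := \sum_(F | onef F && (F :^ dtr h k == F)%g) weight sgD F.

(** There are [2p - 1] factors, and the orbits under conjugation have length 1 or [p]. *)
Lemma card_commuting h k F : onef F -> (F :^ dtr h k)%g = F ->
  #|[set mu in F | (mu ^ dtr h k)%g == mu]| = p.-1 %[mod p].
Proof.
move=> hF gF; have gX : (dtr h k ^+ p = 1)%g by rewrite dtrX -(mulr_natr h) -(mulr_natr k) pr0 // !mulr0 dtr0.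
rewrite -(conj_fix_mod p_prime gX gF) (card_onef hF V2_gt0) card_V2.
by rewrite -pred_double ?modnDr ?prime_gt0.
Qed.

Lemma commuting_ex h k F : onef F -> (F :^ dtr h k)%g = F ->
  exists2 mu, mu \in F & forall x, dtr h k (mu x) = mu (dtr h k x).
Proof.
move=> hF gF; have := card_commuting hF gF; set C := [set _ in _ | _] => e.
have /card_gt0P[mu] : (0 < #|C|)%N.
  rewrite lt0n; apply: contra_eq_neq e => ->; rewrite mod0n.
  by rewrite modn_small; have := prime_gt1 p_prime; lia.
rewrite inE => /andP[hm /eqP c]; exists mu => // x.
by rewrite -permJ c.
Qed.

(** A factor commuting with the translation preserves the set of its fixed points, the first copy;
    but a set of odd size [p] has no perfect matching. *)
Lemma fixsum0 k : k != 0 -> fixsum 0 k = 0.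
Proof.
move=> k0; rewrite /fixsum big_pred0 // => F; apply/negP => /andP[hF /eqP gF].
have [mu hm cm] := commuting_ex hF gF.
have [mK mV] := pmatchP _ _ (onef_pmatch hF hm).
have mL x : exists y, mu (inl x) = inl y.
  have := cm (inl x); rewrite dtrL addr0; case: (mu (inl x)) => [y _|y]; first by exists y.
  by rewrite dtrR => -[/eqP]; rewrite -subr_eq0 addrAC subrr add0r (negbTE k0).
pose f x := if mu (inl x) is inl y then y else x.
have fE x : mu (inl x) = inl (f x) by rewrite /f; have [y ->] := mL x.
have fK : involutive f by move=> x; apply: (@inl_inj _ 'F_p); rewrite -!fE mK.
apply: (@no_fpf (perm (inv_inj fK))); apply/pmatchP; split=> x; rewrite !permE ?fK //.
by rewrite -(inj_eq (@inl_inj _ 'F_p)) -fE mV !inE.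
Qed.

Lemma swap_inj : injective (fun x : V => match x with inl x => inr x | inr y => inl y end : V).
Proof. by move=> [x|x] [y|y] // [->]. Qed.

Lemma fixsum_swap h : fixsum h 0 = fixsum 0 h.
Proof.
rewrite /fixsum; have -> : dtr h 0 = (dtr 0 h ^ perm swap_inj)%g.
  apply/permP => -[x|x].
    have -> : inl x = perm swap_inj (inr x) by rewrite permE.
    by rewrite permJ dtrR !permE /= permE.
  have -> : inr x = perm swap_inj (inl x) by rewrite permE.
  by rewrite permJ dtrL !permE /= permE.
exact: (fix_conj _ _ V2_gt0 V2_even tourn_sgD).
Qed.

(** Scaling the copies by [h] and [k] conjugates the translation by [(1, 1)] into the one by
    [(h, k)]. *)
Lemma fixsum_scale h k : h != 0 -> k != 0 -> fixsum h k = fixsum 1 1.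
Proof.
rewrite /fixsum => h0 k0; pose u := sump (perm (mulfI h0)) (perm (mulfI k0)).
have uL x : u (inl x) = inl (h * x) by rewrite sumpL permE.
have uR x : u (inr x) = inr (k * x) by rewrite sumpR permE.
have -> : dtr h k = (dtr 1 1 ^ u)%g.
  apply/permP => -[x|x].
    have -> : inl x = u (inl (x / h)) by rewrite uL mulrC divfK.
    by rewrite permJ (dtrL 1) !uL dtrL mulrDr mulr1.
  have -> : inr x = u (inr (x / k)) by rewrite uR mulrC divfK.
  by rewrite permJ (dtrR 1) !uR dtrR mulrDr mulr1.
exact: (fix_conj _ _ V2_gt0 V2_even tourn_sgD).
Qed.

Definition crossf t (x : V) : V := match x with inl x => inr (x + t) | inr y => inl (y - t) end.

Lemma crossfK t : involutive (crossf t).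
Proof. by case=> x /=; rewrite ?addrK ?subrK. Qed.

Definition cross t : {perm V} := perm (inv_inj (crossfK t)).

Lemma crossL t x : cross t (inl x) = inr (x + t). Proof. by rewrite permE. Qed.
Lemma crossR t y : cross t (inr y) = inl (y - t). Proof. by rewrite permE. Qed.

Lemma inj_cross : injective cross.
Proof. by move=> t t' e; have := crossL t 0; rewrite e crossL !add0r => -[]. Qed.

Lemma pmatch_cross t : pmatch [set: V] (cross t).
Proof.
apply/pmatchP; split=> -[x|x]; rewrite ?inE ?crossL ?crossR ?crossL //.
  by rewrite addrK.
by rewrite subrK.
Qed.

Lemma cross_dtr t h k : (cross t ^ dtr h k)%g = cross (t + (k - h)).
Proof.
apply/permP => -[x|x].
  rewrite -[x in LHS](subrK h) -(dtrL h k) permJ !crossL dtrR; congr inr; ring.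
rewrite -[x in LHS](subrK k) -(dtrR h k) permJ !crossR dtrL; congr inl; ring.
Qed.

(** Such a matching commutes with all diagonal translations, so its value at [inl 0] determines it
    on the first copy. *)
Lemma commuting_cross mu : pmatch [set: V] mu -> (mu ^ dtr 1 1)%g = mu -> exists t, mu = cross t.
Proof.
move=> /pmatchP[mK mV] e.
have c h : (mu ^ dtr h h)%g = mu.
  have -> : dtr h h = (dtr 1 1 ^+ h)%g by rewrite dtrX natFp.
  by rewrite conjgE (commuteX h (_ : commute mu (dtr 1 1))) ?mulKg //; apply/commgP/conjg_fixP.
have cL x : mu (inl x) = dtr x x (mu (inl 0)) by rewrite -{1}(c x) -[x in inl x]add0r -(dtrL x x) permJ.
case e0 : (mu (inl 0)) => [z|z].
  (* If [inl 0] is joined to [inl z], translation by [z] joins [inl z] to [inl (z + z)], which must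
     be [inl 0]. *)
  have zz : z + z = 0.
    by apply: (@inl_inj _ 'F_p); rewrite -(dtrL z z) -e0 -cL -e0 mK.
  have z0 : z = 0.
    apply/eqP; have := zz; rewrite -mulr2n -mulr_natl => /eqP; rewrite mulf_eq0 => /orP[] //.
    by rewrite (negbTE (natFp_neq0 p_prime _)) //; have := p_gt2 p_prime p_odd; lia.
  by have := mV (inl 0); rewrite e0 z0 eqxx inE.
have L x : mu (inl x) = inr (x + z) by rewrite cL e0 dtrR addrC.
exists z; apply/permP => -[x|x]; rewrite ?L ?crossL ?crossR //.
by rewrite -{1}(subrK z x) -L mK.
Qed.

Lemma commuting_shift mu h : h != 0 -> (mu ^ dtr h h)%g = mu -> (mu ^ dtr 1 1)%g = mu.
Proof.
move=> h0 e; have -> : dtr 1 1 = (dtr h h ^+ (h^-1 : 'F_p)%R)%g.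
  by rewrite dtrX -mulr_natr natFp divff.
by rewrite conjgE (commuteX _ (_ : commute mu (dtr h h))) ?mulKg //; apply/commgP/conjg_fixP.
Qed.

(** Meant for [nu] containing the edge from [inl 0] to [inr t] as its only edge between the copies:
    the edges of the missing [cross t] are then shared out among the [p] translates of [nu]. *)
Definition twisted t nu := [set cross t' | t' in [set~ t]] :|: [set (nu ^ dtr h h)%g | h : 'F_p].

Lemma twistedP t nu mu : reflect ((exists2 t', t' != t & mu = cross t') \/ exists h, mu = (nu ^ dtr h h)%g)
  (mu \in twisted t nu).
Proof.
apply: (iffP setUP) => [[]/imsetP[x]|[[x xt ->]|[x ->]]].
- by rewrite !inE => xt ->; left; exists x.
- by move=> _ ->; right; exists x.
- by left; apply: imset_f; rewrite !inE.
- by right; apply: imset_f.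
Qed.

Lemma twisted_fix t nu : (twisted t nu :^ dtr 1 1)%g == twisted t nu.
Proof.
rewrite eqEcard cardJg leqnn andbT; apply/subsetP => _ /imsetP[mu /twistedP hm ->].
apply/twistedP; case: hm => [[t' tt ->]|[h ->]].
  by left; exists t'; rewrite // cross_dtr subrr addr0.
by right; exists (h + 1); rewrite -conjgM dtrD.
Qed.

Section Twisted.
Variables (t : 'F_p) (nu : {perm V}).
Hypotheses (nuP : pmatch [set: V] nu) (nu0 : nu (inl 0) = inr t).
Hypothesis nuL : forall x, x != 0 -> exists y, nu (inl x) = inl y.

Lemma spin_cross h : (nu ^ dtr h h)%g (inl h) = inr (t + h).
Proof. by rewrite -(dtrL0 h h) permJ nu0 dtrR. Qed.

Lemma spin_inj : injective (fun h => (nu ^ dtr h h)%g).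
Proof.
move=> h k e; apply/eqP; rewrite -subr_eq0; apply: contraT => /nuL[y e1].
by have := permJ nu (dtr k k) (inl (h - k)); rewrite dtrL subrK e1 dtrL -e spin_cross.
Qed.

Lemma spin_neq h t' : cross t' != (nu ^ dtr h h)%g.
Proof.
apply/eqP => e; have [y e1] := nuL (oner_neq0 'F_p).
by have := permJ nu (dtr h h) (inl 1); rewrite -e e1 !dtrL crossL.
Qed.

Lemma twisted_disjoint :
  [disjoint [set cross t' | t' in [set~ t]] & [set (nu ^ dtr h h)%g | h : 'F_p]].
Proof.
rewrite disjoints_subset; apply/subsetP => _ /imsetP[t' _ ->]; rewrite inE.
by apply/imsetP => -[h _ /eqP]; rewrite (negbTE (spin_neq _ _)).
Qed.

Lemma card_twisted : #|twisted t nu| = (2 * p).-1.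
Proof.
rewrite cardsU (eqP (_ : _ :&: _ == set0)) ?setI_eq0 ?twisted_disjoint // cards0 subn0.
rewrite (card_imset _ inj_cross) (card_imset _ spin_inj) cardsC1 card_Fp //.
exact: pred_double (prime_gt0 p_prime).
Qed.

Lemma mem_cross t' : (cross t' \in twisted t nu) = (t' != t).
Proof.
apply/twistedP/idP => [[[u ut /inj_cross->]//|[h /eqP]]|tt]; last by left; exists t'.
by rewrite (negbTE (spin_neq _ _)).
Qed.

(** The [p - 1] matchings [cross t'] are translates of each other, and an even number of equal signs
    cancels; of the [p] equal signs of the translates of [nu], one is left. *)
Lemma weight_twisted : weight sgD (twisted t nu) = epsr sgD nu.
Proof.
have [sa _] := tourn_sgD.
rewrite /weight (eq_bigl (mem [predU [set cross t' | t' in [set~ t]] & [set (nu ^ dtr h h)%g | h : 'F_p]])).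
  rewrite bigU ?twisted_disjoint //= (big_imset _ (in2W inj_cross)) (big_imset _ (in2W spin_inj)) /=.
  rewrite (eq_bigr (fun _ => epsr sgD (cross 0))) => [|t' _]; last first.
    have -> : cross t' = (cross 0 ^ dtr 0 t')%g by rewrite cross_dtr subr0 add0r.
    by apply: epsr_invar => //; [exact: pmatch_cross|exact: sgD_dtr].
  rewrite [X in _ * X](eq_bigr (fun _ => epsr sgD nu)) => [|h _]; last first.
    by apply: epsr_invar => //; exact: sgD_dtr.
  rewrite !prodr_const cardsC1 card_Fp // (epsr_odd tourn_sgD nuP p_odd).
  have -> : p.-1 = (2 * m)%N by have := half_p p_prime p_odd; lia.
  by rewrite exprM expr2 (epsr_sq tourn_sgD (pmatch_cross 0)) expr1n mul1r.
by move=> mu; rewrite !inE.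
Qed.

End Twisted.

Section Doubled.
Variables (t : 'F_p) (al be : {perm 'F_p}).

(** For starters: [al] on the first copy, [be] moved by [t] on the second, and the edge joining the
    two vertices [inl 0] and [inr t] left over. *)
Definition doubled : {perm V} := (sump al (be ^ shift t) * tperm (inl 0) (inr t))%g.

Hypotheses (ha : startp al) (hb : startp be).

Lemma doubledL0 : doubled (inl 0) = inr t.
Proof. by rewrite permM sumpL (startp0 ha) tpermL. Qed.

Lemma doubledL x : x != 0 -> doubled (inl x) = inl (al x).
Proof.
move=> x0; rewrite permM sumpL tpermD //; apply/eqP => -[/esym/eqP].
by rewrite (startp_eq0 _ ha) (negbTE x0).
Qed.

Lemma conj_shift y : (be ^ shift t)%g (y + t) = be y + t.
Proof. by rewrite -shiftE permJ shiftE. Qed.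

Lemma doubledR0 : doubled (inr t) = inl 0.
Proof.
have e := conj_shift 0; rewrite add0r (startp0 hb) add0r in e.
by rewrite /doubled permM sumpR e tpermR.
Qed.

Lemma doubledR y : y != 0 -> doubled (inr (y + t)) = inr (be y + t).
Proof.
move=> y0; rewrite permM sumpR conj_shift tpermD //; apply/eqP => -[/esym/eqP].
by rewrite -subr_eq0 addrK (startp_eq0 _ hb) (negbTE y0).
Qed.

Lemma doubled_cases y : y = t \/ exists2 z, z != 0 & y = z + t.
Proof.
have [e|e] := eqVneq (y - t) 0; first by left; apply/eqP; rewrite -subr_eq0 e.
by right; exists (y - t); rewrite ?subrK.
Qed.

Lemma pmatch_doubled : pmatch [set: V] doubled.
Proof.
have [aK aV] := pmatchP _ _ (startp_pmatch ha).
have [bK bV] := pmatchP _ _ (startp_pmatch hb).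
apply/pmatchP; split=> -[x|x]; rewrite ?inE.
- have [->|x0] := eqVneq x 0; first by rewrite doubledL0 doubledR0.
  by rewrite !doubledL ?(startp_eq0 _ ha) // aK.
- have [->|[z z0 ->]] := doubled_cases x; first by rewrite doubledR0 doubledL0.
  by rewrite !doubledR ?(startp_eq0 _ hb) // bK.
- have [->|x0] := eqVneq x 0; first by rewrite doubledL0.
  by rewrite doubledL // (inj_eq (@inl_inj _ _)) aV inE x0.
- have [->|[z z0 ->]] := doubled_cases x; first by rewrite doubledR0.
  by rewrite doubledR // (inj_eq (@inr_inj _ _)) (inj_eq (addIr t)) bV inE z0.
Qed.

(** Edges in different copies do not cross, and the edge between the copies contributes the product
    of [eta] over the units once for each copy, hence a square. *)
Lemma epsr_doubled : epsr sgD doubled = epsr (@sgo _ 'F_p) al * epsr (@sgo _ 'F_p) be.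
Proof.
have pa := startp_pmatch ha; have [aK aV] := pmatchP _ _ pa.
have pb := startp_pmatch hb; have [bK bV] := pmatchP _ _ pb.
pose A := esec al; have [AU sA] := sect_esec pa; rewrite -/A in AU sA.
pose B := esec be; have [BU sB] := sect_esec pb; rewrite -/B in BU sB.
have A0 x : x \in A -> x != 0 by move/(subsetP AU); rewrite inE.
have B0 x : x \in B -> x != 0 by move/(subsetP BU); rewrite inE.
pose jr y : V := inr (y + t).
have jr_inj : injective jr by move=> y z /(@inr_inj 'F_p 'F_p)/addIr.
pose L : {set V} := inl @: A; pose R := jr @: B.
have LL x : (inl x \in L) = (x \in A) by rewrite mem_imset //; exact: inl_inj.
have RR x : (jr x \in R) = (x \in B) by rewrite mem_imset.
have RL x : (inl x \in R) = false by apply/negP => /imsetP[].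
have LR x : (inr x \in L) = false by apply/negP => /imsetP[].
have R0 : (inr t \in R) = false.
  by rewrite -[t]add0r RR; apply/negP => /B0; rewrite eqxx.
have L0 : (inl 0 \in L) = false by rewrite LL; apply/negP => /A0; rewrite eqxx.
have sec : sect doubled (inl 0 |: (L :|: R)) [set: V].
  split=> [|[x|x] _]; first exact: subsetT.
    rewrite in_setT; split=> //; have [->|x0] := eqVneq x 0.
      by rewrite doubledL0 !inE /= LR R0.
    rewrite doubledL // !inE !RL !LL !orbF !(inj_eq (@inl_inj _ _)) (startp_eq0 _ ha) (negbTE x0) /=.
    by have [|_ ->] := sA x; rewrite ?inE.
  rewrite in_setT; split=> //; have [->|[z z0 ->]] := doubled_cases x.
    by rewrite doubledR0 !inE eqxx /= LR R0.
  rewrite doubledR // !inE !LR /= -!/(jr _) !RR.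
  by have [|_ ->] := sB z; rewrite ?inE.
have [sa _] := tourn_sgD.
rewrite (epsr_sect sa pmatch_doubled sec) pp_setU1; first last.
- by move=> x y _ _; exact: crs_sym.
- by rewrite !inE L0 RL.
have dLR : [disjoint L & R].
  by rewrite disjoints_subset; apply/subsetP => _ /imsetP[x _ ->]; rewrite inE RL.
rewrite pp_setU //; last by move=> x y _ _; exact: crs_sym.
have -> : \prod_(x in L) \prod_(y in R) crs sgD doubled x y = 1.
  apply: big1 => _ /imsetP[x /A0 x0 ->]; apply: big1 => _ /imsetP[y /B0 y0 ->].
  by rewrite /crs doubledL // doubledR.
have -> : pp L (crs sgD doubled) = epsr (@sgo _ 'F_p) al.
  rewrite pp_imset; [|by move=> x y _ _; exact: inl_inj|by move=> x y _ _; exact: crs_sym].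
  rewrite -(epsr_eta p_prime p_odd pa).
  by apply: eq_pp => x y /A0 x0 /A0 y0 _; rewrite /crs !doubledL.
have -> : pp R (crs sgD doubled) = epsr (@sgo _ 'F_p) be.
  rewrite pp_imset; [|by move=> x y _ _; exact: jr_inj|by move=> x y _ _; exact: crs_sym].
  rewrite -(epsr_eta p_prime p_odd pb).
  apply: eq_pp => x y /B0 x0 /B0 y0 _; rewrite /crs !doubledR //=.
  by rewrite !(opprD _ t) !(addrACA _ t) !subrr !addr0.
have -> : \prod_(y in L :|: R) crs sgD doubled (inl 0) y = 1; last by rewrite mul1r mulr1.
rewrite (eq_bigl (mem [predU L & R])); last by move=> x; rewrite !inE.
rewrite bigU //= (big_imset _ (in2W (@inl_inj _ _))) (big_imset _ (in2W jr_inj)) /=.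
transitivity ((-1) ^+ m * (-1) ^+ m : int); last by rewrite -expr2 sqrr_sign.
rewrite -(prod_eta p_prime p_odd) {1}(prod_sect _ aK (sect_esec pa)) (prod_sect _ bK (sect_esec pb)).
congr (_ * _); apply: eq_bigr => x.
  by move/A0 => x0; rewrite /crs doubledL0 doubledL //= !subr0; ring.
by move/B0 => x0; rewrite /crs doubledL0 doubledR //= !addrK; ring.
Qed.

End Doubled.

End TwoCopies.

(** * One-factorizations fixed by the diagonal translation *)

Section Double.
Variable p : nat.
Hypotheses (p_prime : prime p) (p_odd : odd p).
Local Notation m := ((p - 1) %/ 2)%N.
Local Notation V := ('F_p + 'F_p)%type.
Implicit Types (h k t : 'F_p) (al be : {perm 'F_p}) (mu nu : {perm V}) (F : {set {perm V}}).

Lemma doubled_inl t al be : startp al -> forall x, x != 0 -> exists y, doubled t al be (inl x) = inl y.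
Proof. by move=> ha x x0; exists (al x); exact: doubledL. Qed.

Lemma onef_twisted t al be : startp al -> startp be -> onef (twisted t (doubled t al be)).
Proof.
move=> ha hb; set F := twisted _ _.
have pm mu : mu \in F -> pmatch [set: V] mu.
  by case/twistedP => [[t' _ ->]|[h ->]]; rewrite ?pmatch_conj ?pmatch_doubled ?pmatch_cross.
have LR x y : exists2 mu, mu \in F & mu (inl x) = inr y.
  have [e|e] := eqVneq (y - x) t.
    exists (doubled t al be ^ dtr x x)%g; first by apply/twistedP; right; exists x.
    by rewrite -(dtrL0 x x) permJ doubledL0 // dtrR -e subrK.
  exists (cross (y - x)); first by apply/twistedP; left; exists (y - x).
  by rewrite crossL addrC subrK.
have pt al' x y : startp al' -> x != y ->
    exists z h, [/\ z != 0, x = z + h & y = al' z + h].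
  move=> ha' xy; have [z e] : exists z, z - al' z = x - y.
    by apply: startp_ex => //; rewrite subr_eq0.
  exists z, (x - z); split; [|by rewrite addrC subrK|by rewrite -[al' z](subKr z) e; ring].
  apply: contraNneq xy => z0; move/eqP: e; rewrite z0 (startp0 ha') subrr eq_sym.
  by rewrite subr_eq0.
apply: onef_count; [exact: pm| |by rewrite (card_twisted p_prime (doubledL0 t be ha) (doubled_inl t be ha)) card_V2].
have N h : (doubled t al be ^ dtr h h)%g \in F by apply/twistedP; right; exists h.
move=> [x|x] [y|y] xy.
- have [|z [h [z0 -> ->]]] := pt al x y ha; first by apply: contraNneq xy => ->.
  exists (doubled t al be ^ dtr h h)%g; first exact: N.
  by rewrite -(dtrL h h) permJ doubledL // dtrL.
- exact: LR.
- have [mu hm e] := LR y x; exists mu => //.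
  by have [mK _] := pmatchP _ _ (pm _ hm); rewrite -e mK.
have [|z [h [z0 e1 e2]]] := pt be (x - t) (y - t) hb.
  by apply: contraNneq xy => /addIr->.
exists (doubled t al be ^ dtr h h)%g; first exact: N.
have -> : inr x = dtr h h (inr (z + t)).
  by rewrite dtrR addrAC -e1 subrK.
by rewrite permJ doubledR // dtrR addrAC -e2 subrK.
Qed.

Definition twistT (q : 'F_p * ({perm 'F_p} * {perm 'F_p})) := twisted q.1 (doubled q.1 q.2.1 q.2.2).

Definition starter_triples := [set q : 'F_p * ({perm 'F_p} * {perm 'F_p}) | startp q.2.1 && startp q.2.2].

Lemma twistT_inj : {in starter_triples &, injective twistT}.
Proof.
move=> [t [al be]] [t' [al' be']]; rewrite !inE /twistT /= => /andP[ha hb] /andP[ha' hb'] e.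
have et : t = t'.
  apply/eqP; apply: contraT => tt.
  have := mem_cross t' (doubled_inl t' be' ha') t; rewrite tt -e.
  by rewrite (mem_cross t (doubled_inl t be ha)) eqxx.
rewrite -{}et in e *; congr (_, _).
have N a b : doubled t a b \in twisted t (doubled t a b).
  by apply/twistedP; right; exists 0; rewrite dtr0 conjg1.
have ed : doubled t al be = doubled t al' be'.
  apply: (onef_uniq (onef_twisted t ha hb) (N _ _) _ (x := inl 0)); first by rewrite e N.
  by rewrite !doubledL0.
congr (_, _); apply/permP => x; have [->|x0] := eqVneq x 0; rewrite ?startp0 //.
  by apply: (@inl_inj _ 'F_p); rewrite -(doubledL t be ha x0) ed doubledL.
by apply: (addIr t); apply: (@inr_inj 'F_p _); rewrite -(doubledR t al hb x0) ed doubledR.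
Qed.

Lemma twisted_surj F : onef F -> (F :^ dtr 1 1)%g = F -> exists2 q, q \in starter_triples & F = twistT q.
Proof.
move=> hF gF.
have pF mu (hm : mu \in F) := onef_pmatch hF hm.
pose S := [set t : 'F_p | cross t \in F].
(* The factors fixed by the translation are the [cross t] in [F]. Their number is [p - 1] modulo [p]
   and at most [p], so exactly one shift [t] is missing. *)
have /cards1P[t eS] : #|~: S| == 1%N.
  have eC : [set mu in F | (mu ^ dtr 1 1)%g == mu] = @cross p @: S.
    apply/setP => mu; rewrite inE; apply/andP/imsetP => [[hm /eqP c]|[t]].
      by have [t e] := commuting_cross p_prime p_odd (pF mu hm) c; exists t; rewrite ?inE -?e.
    by rewrite inE => ht ->; rewrite ht cross_dtr subrr addr0.
  have := card_commuting p_prime hF gF; rewrite eC card_imset; last exact: inj_cross.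
  have := cardsC S; rewrite card_Fp // => e.
  have p2 := p_gt2 p_prime p_odd.
  rewrite (modn_small (_ : p.-1 < p)%N); last by lia.
  have [Sp|Sp] := ltnP #|S| p; first by rewrite modn_small //; lia.
  have -> : #|S| = p by lia.
  by rewrite modnn; lia.
have crossF t' : (cross t' \in F) = (t' != t).
  by have /setP/(_ t') := eS; rewrite !inE => <-; rewrite negbK.
have g_in mu h : mu \in F -> (mu ^ dtr h h)%g \in F.
  move=> hm; have e : (F :^ dtr h h)%g = F.
    have -> : dtr h h = (dtr 1 1 ^+ h)%g by rewrite dtrX natFp.
    by apply/normP; apply: groupX; apply/normP.
  by rewrite -{1}e memJ_conjg.
have [nu hn nu0] : exists2 nu, nu \in F & nu (inl 0) = inr t by exact: onef_ex.
have [nK nV] := pmatchP _ _ (pF _ hn).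
have n_cross t' : nu != cross t'.
  apply/eqP => e; have := crossF t'; rewrite -e hn => /esym/eqP; apply.
  by move: nu0; rewrite e crossL add0r => /(@inr_inj 'F_p 'F_p).
(* A second edge of [nu] between the copies would have shift [t], all other shifts being taken. Then
   [nu] would be fixed by a nonzero translation and be a [cross] itself. *)
have nuL x : x != 0 -> exists y, nu (inl x) = inl y.
  move=> x0; case e : (nu (inl x)) => [y|y]; first by exists y.
  have [et|et] := eqVneq (y - x) t; last first.
    case/negP: (n_cross (y - x)); apply/eqP.
    by apply: (onef_uniq hF hn _ (x := inl x)); rewrite ?crossF // e crossL addrC subrK.
  have en : (nu ^ dtr x x)%g = nu.
    apply: (onef_uniq hF (g_in _ x hn) hn (x := inl x)).
    by rewrite e -(dtrL0 x x) permJ nu0 dtrR -et subrK.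
  have [t' e'] := commuting_cross p_prime p_odd (pF _ hn) (commuting_shift x0 en).
  by case/eqP: (n_cross t').
have eF : F = twisted t nu.
  apply/esym/eqP; rewrite eqEcard (card_twisted p_prime nu0 nuL) (card_onef hF) ?V2_gt0 // card_V2 // leqnn andbT.
  apply/subsetP => mu /twistedP[[t' tt ->]|[h ->]]; first by rewrite crossF.
  exact: g_in.
have nuT : nu (inr t) = inl 0 by rewrite -nu0 nK.
have nuR y : y != 0 -> exists z, nu (inr (y + t)) = inr z.
  move=> y0; case e : (nu (inr (y + t))) => [x|z]; last by exists z.
  have e' : nu (inl x) = inr (y + t) by rewrite -e nK.
  have [x0|/nuL[z]] := eqVneq x 0; last by rewrite e'.
  move: e'; rewrite x0 nu0 => /(@inr_inj 'F_p 'F_p)/eqP; rewrite -subr_eq0 opprD addrCA subrr addr0.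
  by rewrite oppr_eq0 (negbTE y0).
have otherF x y : x != y -> exists2 mu, mu \in F & mu x = y := onef_ex hF.
have [|x|d d0|al ha fE] := @starter_of_copy _ _ (@inl 'F_p 'F_p) (fun h => dtr h h) nu
  (@inl_inj _ _) (fun h => dtrL h h) (pF _ hn).
- by move=> y; rewrite nu0.
- exact: nuL.
- have [|mu] := otherF (inl 0) (inl d); first by rewrite (inj_eq (@inl_inj _ _)) eq_sym.
  by rewrite eF => /twistedP[[t' _ ->]|[h ->]]; [rewrite crossL|exists h].
have jr_inj : injective (fun y : 'F_p => inr (y + t) : V) by move=> y z /(@inr_inj 'F_p 'F_p)/addIr.
have [h x|y|x|d d0|be hb gE] := @starter_of_copy _ _ _ (fun h => dtr h h) nu jr_inj _ (pF _ hn).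
- by rewrite dtrR addrAC.
- by rewrite add0r nuT.
- by move/nuR => [z ->]; exists (z - t); rewrite subrK.
- have [|mu] := otherF (inr (0 + t)) (inr (d + t)).
    by rewrite (inj_eq (@inr_inj _ _)) (inj_eq (addIr t)) eq_sym.
  by rewrite eF => /twistedP[[t' _ ->]|[h ->]]; [rewrite crossR|exists h].
exists (t, (al, be)); first by rewrite inE /= ha.
rewrite eF /twistT /=; congr twisted; apply/permP => -[x|x].
  have [->|x0] := eqVneq x 0; first by rewrite nu0 doubledL0.
  by rewrite fE // doubledL.
have [->|[z z0 ->]] := doubled_cases t x; first by rewrite nuT doubledR0.
by rewrite gE // doubledR.
Qed.

Lemma fixsum11 : @fixsum p 1 1 = p%:Z * starter_sum p ^+ 2.
Proof.
rewrite /fixsum (eq_bigl (fun F => F \in twistT @: starter_triples)).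
  rewrite big_imset /=; last exact: twistT_inj.
  pose E (al : {perm 'F_p}) := epsr (@sgo _ 'F_p) al.
  rewrite (eq_bigr (fun q => E q.2.1 * E q.2.2)) => [|[t [al be]]]; last first.
    rewrite inE /= => /andP[ha hb].
    rewrite (weight_twisted p_prime p_odd (pmatch_doubled t ha hb)) ?doubledL0 //.
      exact: epsr_doubled.
    exact: doubled_inl.
  rewrite (eq_bigl (fun q => xpredT q.1 && (startp q.2.1 && startp q.2.2))); last by move=> q; rewrite inE.
  rewrite -(pair_big xpredT (fun q => startp q.1 && startp q.2) (fun _ q => E q.1 * E q.2)) /=.
  rewrite -(pair_big (@startp p) (@startp p) (fun a b => E a * E b)) /=.
  rewrite sumr_const card_Fp // -mulr_natl natz starter_sumE -/E; congr (_ * _).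
  by rewrite expr2 big_distrlr.
move=> F; apply/andP/imsetP => [[hF /eqP gF]|[[t [al be]]]].
  by have [q hq ->] := twisted_surj hF gF; exists q.
rewrite inE => /andP[ha hb] ->; split; first exact: onef_twisted.
exact: twisted_fix.
Qed.

Lemma signed_count_double :
  (signed_count (2 * p) = - p%:Z * starter_sum p ^+ 2 %[mod (p ^ 2)%N])%Z.
Proof.
have e2 : #|{: V}| = (2 * p)%N by exact: card_V2.
rewrite (signed_count_on (V := V) (s := @sgD p)) ?e2 //; last exact: tourn_sgD.
- have := burnside_onef (@dtrG p) (V2_gt0 p_prime) (V2_even p_prime) (tourn_sgD p_prime p_odd).
  rewrite card_dtrG // big_imset /=; last by move=> q r _ _; exact: inj_dtr.
  rewrite -(pair_big xpredT xpredT (fun h k => @fixsum p h k)) /=.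
  rewrite (bigD1 0) //= (bigD1 0) //= big1 => [|k k0]; last exact: fixsum0.
  rewrite addr0 (eq_bigr (fun _ => p.-1%:Z * @fixsum p 1 1)) => [|h h0]; last first.
    rewrite (bigD1 0) //= fixsum_swap // fixsum0 // add0r.
    rewrite (eq_bigr (fun _ => @fixsum p 1 1)) => [|k k0]; last exact: fixsum_scale.
    by rewrite sumr_const cardC1 card_Fp // -mulr_natl natz.
  rewrite sumr_const cardC1 card_Fp // fixsum11 -mulr_natl natz.
  have -> : @fixsum p 0 0 = cnt (@sgD p).
    by apply: eq_bigl => F; rewrite dtr0 conjsg1 eqxx andbT.
  have p0 := prime_gt0 p_prime; set T := starter_sum p.
  move=> hd; apply/eqP; rewrite eqz_mod_dvd.
  set X := _ + _ in hd.
  (* The [(p - 1) ^ 2] translations moving both copies contribute [p T ^ 2] each, and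
     [p (p - 1) ^ 2 = p + p ^ 2 (p - 2)]. *)
  have -> : cnt (@sgD p) - (- p%:Z * T ^+ 2) = X - (p ^ 2)%N%:Z * ((p%:Z - 2) * T ^+ 2).
    rewrite /X (_ : p.-1%:Z = p%:Z - 1); last by lia.
    by rewrite PoszM; ring.
  by rewrite rpredB // dvdz_mulr.
- by rewrite muln_gt0; exact: prime_gt0.
- by rewrite mul2n odd_double.
Qed.

End Double.

(** * Euler criterion and conclusion *)

Section Legendre.
Variable p : nat.
Hypotheses (p_prime : prime p) (p_odd : odd p).
Local Notation m := ((p - 1) %/ 2)%N.

Lemma expf_pred (a : 'F_p) : a != 0 -> a ^+ m * a ^+ m = 1.
Proof.
move=> a0; apply: (mulfI a0); rewrite -exprD addnn -exprS -half_p // mulr1.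
by rewrite -{2}(expf_card a) card_Fp.
Qed.

(** The squares of the [m] even representatives are distinct roots of [x ^ m - 1]; a root [a] that
    is not a square would be one too many. *)
Lemma euler_criterion (a : 'F_p) : a != 0 -> a ^+ m = 1 -> exists x, x ^+ 2 = a.
Proof.
move=> a0 am; apply/existsPP; first by move=> x; exact: eqP.
apply: contraT => /existsPn ns.
pose sq := [seq (@evenres p i) ^+ 2 | i <- enum 'I_m].
have sq_inj : injective (fun i => (@evenres p i) ^+ 2).
  move=> i j /eqP; rewrite eqf_sqr => /orP[/eqP|/eqP e]; first exact: evenres_inj.
  have := congr1 (fun x : 'F_p => odd x) e.
  by rewrite odd_oppFp ?evenres_neq0 // !evenres_val // !odd_double.
have m0 : (0 < m)%N by have := half_p p_prime p_odd; have := p_gt2 p_prime p_odd; lia.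
have : (size (a :: sq) <= m)%N.
  apply: max_unity_roots => //=.
    rewrite unity_rootE am eqxx /=; apply/allP => _ /mapP[i _ ->].
    by rewrite unity_rootE -exprM mulnC exprM expr2 expf_pred ?evenres_neq0.
  rewrite (map_inj_uniq sq_inj) enum_uniq andbT.
  by apply/mapP => -[i _ e]; have := ns (evenres i); rewrite -e eqxx.
by rewrite /= size_map size_enum_ord ltnn.
Qed.

Lemma legendreE (a : int) : (legendre a p)%:~R = a%:~R ^+ m :> 'F_p.
Proof.
rewrite /legendre -intFp_eq0 //.
have m0 : (0 < m)%N by have := half_p p_prime p_odd; have := p_gt2 p_prime p_odd; lia.
have [->|a0] := eqVneq (a%:~R : 'F_p) 0; first by rewrite expr0n gtn_eqF.
case: existsP => [[x /eqP e]|ns].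
  by rewrite -e -exprM mulnC exprM expr2 expf_pred // -sqrf_eq0 e.
have /eqP : (a%:~R ^+ m) ^+ 2 = 1 :> 'F_p by rewrite expr2 expf_pred.
rewrite sqrf_eq1 => /orP[/eqP|/eqP->]; last by rewrite mulrNz.
by move/(euler_criterion a0) => [x e]; case: ns; exists x; rewrite e.
Qed.

End Legendre.

Theorem corollary5p4 (p : nat) (p_prime : prime p) (p_odd : odd p) :
  let m := ((p - 1) %/ 2)%N in
  [/\ (signed_count (p - 1) = (-1) ^+ (m + 1) * starter_sum p %[mod p])%Z
      /\ ((-1) ^+ (m + 1) * starter_sum p = legendre (-2) p %[mod p])%Z,
      (signed_count (p + 1) = (-1) ^+ m * starter_sum p %[mod p])%Z
      /\ ((-1) ^+ m * starter_sum p = - legendre (-2) p %[mod p])%Z,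
      (signed_count (2 * p) = - p%:Z * starter_sum p ^+ 2 %[mod (p ^ 2)%N])%Z
      /\ (- p%:Z * starter_sum p ^+ 2 = - p%:Z %[mod (p ^ 2)%N])%Z,
      (signed_count (p - 1) + signed_count (p + 1) = 0 %[mod p])%Z
    & [/\ (p %| signed_count (2 * p))%Z,
          (signed_count (p - 1) * signed_count (p + 1)
             = (signed_count (2 * p) %/ p)%Z %[mod p])%Z
        & ((signed_count (2 * p) %/ p)%Z = -1 %[mod p])%Z]].
Proof.
move=> m.
have p0 : p%:Z != 0 by rewrite eqz_nat -lt0n prime_gt0.
have eT := starter_sum_modp p_prime p_odd; rewrite -/m in eT.
have eL : (legendre (-2) p)%:~R = (-1) ^+ m * 2%:R ^+ m :> 'F_p.
  by rewrite legendreE // -/m -exprMn mulN1r mulrNz -pmulrn.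
have n2 : (2%:R : 'F_p) != 0 by apply: natFp_neq0; rewrite ?p_gt2.
have sq2 := expf_pred p_prime p_odd n2; rewrite -/m in sq2.
have sgn2 : (-1) ^+ m * (-1) ^+ m = 1 :> 'F_p by rewrite -expr2 sqrr_sign.
have /eqFp e1 := signed_count_pred p_prime p_odd; rewrite -/m in e1.
have {}e1 : (signed_count (p - 1))%:~R = (-1) ^+ m * 2%:R ^+ m :> 'F_p.
  by rewrite e1 // rmorphXn /= -exprMn mulN1r mulrNz -pmulrn.
have e2 := signed_count_succ p_prime p_odd; rewrite -/m in e2.
have {}e2' : (signed_count (p + 1))%:~R = - ((-1) ^+ m * 2%:R ^+ m) :> 'F_p.
  by move/(eqFp p_prime): e2 => ->; rewrite intrM eT rmorphXn /= rmorphN1; ring.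
have e3 := signed_count_double p_prime p_odd.
have T2 : (p %| starter_sum p ^+ 2 - 1)%Z.
  by rewrite -intFp_eq0 // rmorphB /= rmorphXn /= eT sqrrN expr2 sq2 subrr.
have e4 : (- p%:Z * starter_sum p ^+ 2 = - p%:Z %[mod (p ^ 2)%N])%Z.
  apply/eqP; rewrite eqz_mod_dvd.
  have -> : - p%:Z * starter_sum p ^+ 2 - - p%:Z = p%:Z * - (starter_sum p ^+ 2 - 1) by ring.
  by rewrite PoszM dvdz_mul2l // rpredN.
(* Written in this form, the exact quotient by [p] is visibly -1 modulo [p]. *)
have [q eq] : exists q, signed_count (2 * p) = p%:Z * (-1 + p%:Z * q).
  have := e3; rewrite e4 => /eqP; rewrite eqz_mod_dvd => /dvdzP[q e].
  exists q; rewrite -[LHS](subrK (- p%:Z)) e PoszM; ring.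
have e5 : (signed_count (2 * p) %/ p)%Z = -1 + p%:Z * q by rewrite eq mulKz.
have e6 : (-1 + p%:Z * q)%:~R = -1 :> 'F_p.
  by rewrite rmorphD /= rmorphN1 rmorphM /= -pmulrn pr0 // mul0r addr0.
split; [split|split|by split| |split].
- by apply/eqFp; rewrite // e1 intrM eT rmorphXn /= rmorphN1 addn1 exprS; ring.
- by apply/eqFp; rewrite // eL intrM eT rmorphXn /= rmorphN1 addn1 exprS; ring.
- exact: e2.
- by apply/eqFp; rewrite // mulrNz eL intrM eT rmorphXn /= rmorphN1; ring.
- by apply/eqFp; rewrite // intrD e1 e2' subrr.
- by rewrite eq dvdz_mulr.
- by apply/eqFp; rewrite // e5 e6 intrM e1 e2' mulrN mulrACA sgn2 sq2 mul1r.
- by apply/eqFp; rewrite // e5 e6.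
Qed.
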